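(* Let $\mathcal L$ be an extremal stationary line ensemble. Then there exist $\theta_0$ and $c>0$ such that for all $\theta>\theta_0$, $\mathbb P(\mathcal L_1(0)>\theta)\le\exp(-c\theta)$.
   Context: A line ensemble is a random continuous function $\mathcal L:\mathbb N\times\mathbb R\to\mathbb R$, $(i,x)\mapsto\mathcal L_i(x)$. For $k\in\mathbb N$ and $a<b$, let $\mathcal F_{\mathrm{ext}}(k,[a,b])$ be the $\sigma$-algebra generated by $\{\mathcal L_i(x):(i,x)\notin\{1,\dots,k\}\times[a,b]\}$. $\mathcal L$ has the Brownian Gibbs property if for all $k$ and $a<b$, conditionally on $\mathcal F_{\mathrm{ext}}(k,[a,b])$, the law of $(\mathcal L_1,\dots,\mathcal L_k)|_{[a,b]}$ is that of $k$ independent rate-two Brownian bridges, the $i$-th from $(a,\mathcal L_i(a))$ to $(b,\mathcal L_i(b))$, conditioned on $B_1(x)>\dots>B_k(x)>\mathcal L_{k+1}(x)$ for all $x\in[a,b]$. $\mathcal L$ is stationary if for every $s$ the ensemble $(\mathcal L_i(x+s)+(x+s)^2)_{i,x}$ has the same law as $(\mathcal L_i(x)+x^2)_{i,x}$. $\mathcal L$ is an extremal stationary line ensemble if it is stationary, has the Brownian Gibbs property, and its law is an extreme point of the convex set of laws of line ensembles having the Brownian Gibbs property. *)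

(* Defs.v *)
From HB Require Import structures.
From mathcomp Require Import all_boot all_order all_algebra.
From mathcomp Require Import all_classical all_reals all_analysis.
Set Implicit Arguments. Unset Strict Implicit. Unset Printing Implicit Defensive.
Import Order.TTheory GRing.Theory Num.Theory numFieldNormedType.Exports.
Local Open Scope classical_set_scope.
Local Open Scope ring_scope.

Section LineEnsembles.
Variable R : realType.

(* Line indices: the nat index i stands for the paper's line i+1,
   so L 0 is the top line L_1. *)
Definition ens := nat -> R -> R.

Definition ens_cylinders : set (set ens) :=
  [set C | exists (i : nat) (x : R) (B : set R),
      measurable B /\ C = (fun f : ens => f i x) @^-1` B].
Definition ens_measurable (S : set ens) : Prop := <<s ens_cylinders >> S.

Definition ens_at d (Omega : measurableType d) (L : nat -> R -> Omega -> R)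
  (w : Omega) : ens := fun i x => L i x w.

Definition line_ensemble d (Omega : measurableType d)
    (L : nat -> R -> Omega -> R) : Prop :=
  (forall i x, measurable_fun [set: Omega] (L i x)) /\
  (forall i w, continuous (fun x => L i x w)).

Definition Fext d (Omega : measurableType d) (L : nat -> R -> Omega -> R)
    (k : nat) (a b : R) : set (set Omega) :=
  <<s [set C | exists (i : nat) (x : R) (B : set R),
         ~ ((i < k)%N /\ a <= x <= b) /\ measurable B /\ C = L i x @^-1` B] >>.

(* W : a family (W_i)_{i in N} of independent standard Brownian motions on
   [0,1]: continuous paths, and (W_i(t)) is the centred Gaussian family with
   covariance E[W_i(s) W_j(t)] = [i = j] min(s,t), expressed through the
   characteristic function of every finite linear combination. *)
Definition std_BM_family d' (Omega' : measurableType d')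
    (Q : probability Omega' R) (W : nat -> R -> Omega' -> R) : Prop :=
  (forall i t, measurable_fun [set: Omega'] (W i t)) /\
  (forall i w, {within `[0, 1], continuous (fun t => W i t w)}) /\
  (forall s : seq (nat * R * R), (forall p, p \in s -> 0 <= p.1.2 <= 1) ->
     let Y := fun w => \sum_(p <- s) p.2 * W p.1.1 p.1.2 w in
     let v := \sum_(p <- s) \sum_(q <- s)
                p.2 * q.2 * (if p.1.1 == q.1.1 then Num.min p.1.2 q.1.2 else 0) in
     (\int[Q]_w (cos (Y w))%:E = (expR (- (v / 2)))%:E /\
      \int[Q]_w (sin (Y w))%:E = 0)%E).

(* Rate-two Brownian bridge on [a,b] from (a,La) to (b,Lb), built from a
   standard Brownian motion path w on [0,1]:
   variance 2 (x-a)(b-x)/(b-a). *)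
Definition bridge (La Lb a b : R) (w : R -> R) (x : R) : R :=
  let s := (x - a) / (b - a) in
  La + s * (Lb - La) + Num.sqrt (2 * (b - a)) * (w s - s * w 1).

Definition resample d (Omega : measurableType d) (L : nat -> R -> Omega -> R)
    d' (Omega' : measurableType d') (W : nat -> R -> Omega' -> R)
    (k : nat) (a b : R) (w : Omega) (w' : Omega') : ens :=
  fun i x => if (i < k)%N && (a <= x <= b)
             then bridge (L i a w) (L i b w) a b (fun t => W i t w') x
             else L i x w.

Definition nonint d (Omega : measurableType d) (L : nat -> R -> Omega -> R)
    d' (Omega' : measurableType d') (W : nat -> R -> Omega' -> R)
    (k : nat) (a b : R) (w : Omega) : set Omega' :=
  [set w' | forall x, a <= x <= b -> forall i, (i < k)%N ->
     resample L W k a b w w' i.+1 x < resample L W k a b w w' i x].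

(* Brownian Gibbs property: conditionally on F_ext(k,[a,b]), the ensemble is
   distributed as the resampled ensemble under Q conditioned on the
   non-intersection event. *)
Definition brownian_gibbs d' (Omega' : measurableType d')
    (Q : probability Omega' R) (W : nat -> R -> Omega' -> R)
    d (Omega : measurableType d) (P : probability Omega R)
    (L : nat -> R -> Omega -> R) : Prop :=
  forall (k : nat) (a b : R), (0 < k)%N -> a < b ->
  forall (A : set Omega) (S : set ens), Fext L k a b A -> ens_measurable S ->
    P (A `&` [set w | S (ens_at L w)]) =
    (\int[P]_(w in A)
       ((fine (Q ([set w' | S (resample L W k a b w w')] `&` nonint L W k a b w))
         / fine (Q (nonint L W k a b w)))%:E))%E.

Definition BG_line_ensemble d' (Omega' : measurableType d')
    (Q : probability Omega' R) (W : nat -> R -> Omega' -> R)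
    d (Omega : measurableType d) (P : probability Omega R)
    (L : nat -> R -> Omega -> R) : Prop :=
  line_ensemble L /\ brownian_gibbs Q W P L.

Definition law d (Omega : measurableType d) (P : probability Omega R)
    (L : nat -> R -> Omega -> R) (S : set ens) : \bar R :=
  P [set w | S (ens_at L w)].

Definition stationary d (Omega : measurableType d) (P : probability Omega R)
    (L : nat -> R -> Omega -> R) : Prop :=
  forall (s : R) (S : set ens), ens_measurable S ->
    P [set w | S (fun i x => L i (x + s) w + (x + s) ^+ 2)] =
    P [set w | S (fun i x => L i x w + x ^+ 2)].

Definition extremal d' (Omega' : measurableType d')
    (Q : probability Omega' R) (W : nat -> R -> Omega' -> R)
    d (Omega : measurableType d) (P : probability Omega R)
    (L : nat -> R -> Omega -> R) : Prop :=
  BG_line_ensemble Q W P L /\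
  forall d1 (Omega1 : measurableType d1) (P1 : probability Omega1 R)
         (L1 : nat -> R -> Omega1 -> R)
         d2 (Omega2 : measurableType d2) (P2 : probability Omega2 R)
         (L2 : nat -> R -> Omega2 -> R) (lam : R),
    BG_line_ensemble Q W P1 L1 -> BG_line_ensemble Q W P2 L2 ->
    0 < lam < 1 ->
    (forall S, ens_measurable S ->
       law P L S = (lam%:E * law P1 L1 S + (1 - lam)%:E * law P2 L2 S)%E) ->
    forall S, ens_measurable S -> law P1 L1 S = law P2 L2 S.

Definition extremal_stationary d' (Omega' : measurableType d')
    (Q : probability Omega' R) (W : nat -> R -> Omega' -> R)
    d (Omega : measurableType d) (P : probability Omega R)
    (L : nat -> R -> Omega -> R) : Prop :=
  stationary P L /\ extremal Q W P L.

End LineEnsembles.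

(* Main.v *)
Require Import Defs.
From HB Require Import structures.
From mathcomp Require Import all_boot all_order all_algebra.
From mathcomp Require Import all_classical all_reals all_analysis.
From mathcomp Require Import measurable_realfun random_variable normal_distribution.
From mathcomp Require Import ring lra.
Set Implicit Arguments. Unset Strict Implicit. Unset Printing Implicit Defensive.
Import Order.TTheory GRing.Theory Num.Theory numFieldNormedType.Exports.
Import HBNNSimple.
Local Open Scope classical_set_scope.
Local Open Scope ring_scope.

(** Write [G t = P (L_1(0) > t)].  Conditionally on the exterior of the box [{1..n} x [-n,n]], the law of the top
    line at [0] is that of a Gaussian vector conditioned on a convex event, so by the Prekopa-Leindler inequality
    its tail [kappa_n t] satisfies [kappa_n s * kappa_n t <= kappa_n ((s + t) / 2) ^ 2] pointwise.  The exterior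
    sigma-algebras decrease with [n], so [kappa_n t] is a reverse martingale; extremality makes its limit have
    second moment [G t ^ 2], that is, [kappa_n t -> G t] in L2.  Hence [G s * G t <= G ((s + t) / 2) ^ 2], and a
    midpoint log-concave tail function decays exponentially. *)

(** * Integrals of bounded measurable functions *)

Section integration_tools.
Context d (T : measurableType d) (R : realType).

(** Two features of the definitions shape the argument. The Brownian motions are given only through
    characteristic functions of finite linear combinations, so the product structure that
    Prekopa-Leindler needs is recovered by hand: scaled increments on a dyadic grid have the
    characteristic function of independent standard normals, and indicators of intervals are limits
    of combinations of cosines. Non-intersection is a strict inequality at a continuum of points; it
    is replaced by inequalities with margin [1 / (q + 1)] on the grid of level [p + 1]. For fixed
    exterior data the resampled heights are affine in the increments, so the average of two
    admissible configurations is admissible, with the average height at 0. The limits in [p], then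
    in [q], restore the original event. Extremality speaks only of mixtures of Gibbs laws. It is
    tested on laws of the same [L] under densities affine in the limit [g] of the conditional
    probabilities. A density measurable for every exterior sigma-algebra preserves the Gibbs
    property; hence [g] is built as a pointwise limsup and not as a class modulo null sets. *)

Lemma ge0_integral_density (m m2 : {measure set T -> \bar R}) (h : T -> R) (f : T -> \bar R) :
  measurable_fun [set: T] h -> (forall x, 0 <= h x) ->
  (forall A, measurable A -> m2 A = \int[m]_(x in A) (h x)%:E)%E ->
  measurable_fun [set: T] f -> (forall x, 0 <= f x)%E ->
  (\int[m2]_x f x = \int[m]_x (f x * (h x)%:E))%E.
Proof.
move=> mh h0 m2E mf f0.
have mhE : measurable_fun setT (EFin \o h) by exact/measurable_EFinP.
pose g := nnsfun_approx measurableT mf.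
have gE (n : nat) : (\int[m2]_x (g n x)%:E = \int[m]_x ((g n x)%:E * (h x)%:E))%E.
  under eq_integral do rewrite fimfunE -fsumEFin//.
  rewrite ge0_integral_fsum//; last 2 first.
  - by move=> r; exact/measurable_EFinP/measurableT_comp.
  - by move=> r x _; rewrite EFinM nnfun_muleindic_ge0.
  transitivity (\int[m]_x (\sum_(y \in range (g n)) (y%:E * (\1_(g n @^-1` [set y]) x)%:E * (h x)%:E)))%E; last first.
    apply: eq_integral => x _.
    rewrite -ge0_mule_fsuml; last by move=> r; rewrite -EFinM nnfun_muleindic_ge0.
    congr (_ * _)%E; rewrite fimfunE -fsumEFin//.
  rewrite ge0_integral_fsum//; last 2 first.
  - move=> r; apply: emeasurable_funM => //.
    by apply/measurable_EFinP; exact: measurable_funM.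
  - by move=> r x _; rewrite mule_ge0// ?lee_fin//; exact: nnfun_muleindic_ge0.
  apply: eq_fsbigr => r _.
  have mr : measurable (g n @^-1` [set r]) by exact: measurable_funPTI.
  under eq_integral do rewrite EFinM.
  have [r0|r0] := ltP r 0.
    rewrite preimage_nnfun0// integral0_eq ?integral0_eq//.
      by move=> x _; rewrite indic0 mule0 mul0e.
    by move=> x _; rewrite indic0 mule0.
  rewrite ge0_integralZl_EFin//; last exact/measurable_EFinP.
  rewrite integral_indic// setIT m2E//.
  under [RHS]eq_integral do rewrite -muleA.
  rewrite ge0_integralZl_EFin//; last 2 first.
  - by move=> x _; rewrite mule_ge0// lee_fin.
  - by apply: emeasurable_funM => //; exact/measurable_EFinP.
  congr (_ * _)%E; rewrite integral_mkcond; apply: eq_integral => x _.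
  rewrite /patch indicE; case: (x \in _); first by rewrite mul1e.
  by rewrite mul0e.
have cg x : (g^~ x n)%:E @[n --> \oo] --> f x.
  by apply: (@cvg_nnsfun_approx _ _ _ _ measurableT f mf (fun x _ => f0 x)).
transitivity (limn (fun n => \int[m2]_x (g n x)%:E))%E.
  rewrite -monotone_convergence//.
  - by apply: eq_integral => x _; apply/esym/cvg_lim => //; exact: cg.
  - by move=> n; exact/measurable_EFinP.
  - by move=> n x _; rewrite lee_fin.
  - by move=> x _ a b ab; rewrite lee_fin; exact/lefP/nd_nnsfun_approx.
rewrite (_ : (fun n => _) = (fun n => \int[m]_x ((g n x)%:E * (h x)%:E)))%E; last exact/funext.
rewrite -monotone_convergence//.
- apply: eq_integral => x _; apply/cvg_lim => //.
  apply: cvgeZr => //; exact: cg.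
- by move=> n; apply: emeasurable_funM => //; exact/measurable_EFinP.
- by move=> n x _; rewrite mule_ge0// lee_fin.
- move=> x _ a b ab; apply: lee_wpmul2r; rewrite lee_fin//.
  exact/lefP/nd_nnsfun_approx.
Qed.

(** Under a probability measure such functions are integrable, so the closure rules below settle the
    integrability side conditions of linearity, Fubini and dominated convergence. *)
Definition bmeas d1 (T1 : measurableType d1) (f : T1 -> R) :=
  measurable_fun [set: T1] f /\ exists M, forall x, `|f x| <= M.

End integration_tools.

Section bounded_measurable.
Context d (T : measurableType d) (R : realType).
Implicit Types f g : T -> R.

Lemma bmeas_cst (r : R) : bmeas (fun _ : T => r).
Proof. by split; [exact: measurable_cst|exists `|r|]. Qed.

Lemma bmeasD f g : bmeas f -> bmeas g -> bmeas (fun x => f x + g x).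
Proof.
move=> [mf [M fM]] [mg [N gN]]; split; first exact: measurable_funD.
by exists (M + N) => x; rewrite (le_trans (ler_normD _ _))// lerD.
Qed.

Lemma bmeasM f g : bmeas f -> bmeas g -> bmeas (fun x => f x * g x).
Proof.
move=> [mf [M fM]] [mg [N gN]]; split; first exact: measurable_funM.
by exists (M * N) => x; rewrite normrM ler_pM.
Qed.

Lemma bmeasZ f (r : R) : bmeas f -> bmeas (fun x => r * f x).
Proof. by move=> bf; apply: bmeasM => //; exact: bmeas_cst. Qed.

Lemma bmeasN f : bmeas f -> bmeas (fun x => - f x).
Proof. by move=> /(bmeasZ (-1)); under eq_fun do rewrite mulN1r. Qed.

Lemma bmeasB f g : bmeas f -> bmeas g -> bmeas (fun x => f x - g x).
Proof. by move=> bf /bmeasN; exact: bmeasD. Qed.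

Lemma bmeas_sum (I : Type) (s : seq I) (F : I -> T -> R) :
  (forall i, bmeas (F i)) -> bmeas (fun x => \sum_(i <- s) F i x).
Proof.
move=> bF; elim: s => [|i s IH].
  by under eq_fun do rewrite big_nil; exact: bmeas_cst.
by under eq_fun do rewrite big_cons; exact: bmeasD.
Qed.

Lemma bmeas_prod (I : Type) (s : seq I) (F : I -> T -> R) :
  (forall i, bmeas (F i)) -> bmeas (fun x => \prod_(i <- s) F i x).
Proof.
move=> bF; elim: s => [|i s IH].
  by under eq_fun do rewrite big_nil; exact: bmeas_cst.
by under eq_fun do rewrite big_cons; exact: bmeasM.
Qed.

Lemma bmeasX f n : bmeas f -> bmeas (fun x => f x ^+ n).
Proof.
move=> bf; elim: n => [|n IH].
  by under eq_fun do rewrite expr0; exact: bmeas_cst.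
by under eq_fun do rewrite exprS; exact: bmeasM.
Qed.

Lemma bmeas_indic (A : set T) : measurable A -> bmeas (\1_A : T -> R).
Proof.
move=> mA; split; first exact: measurable_indic.
by exists 1 => x; rewrite indicE; case: (_ \in _); rewrite ?normr1 ?normr0.
Qed.

Lemma bmeas01 f : measurable_fun [set: T] f -> (forall x, 0 <= f x <= 1) -> bmeas f.
Proof.
move=> mf f01; split=> //; exists 1 => x.
by have /andP[f0 f1] := f01 x; rewrite ger0_norm.
Qed.

Lemma bmeas_cos f : measurable_fun [set: T] f -> bmeas (fun x => cos (f x)).
Proof.
move=> mf; split; last by exists 1 => x; rewrite ler_norml cos_geN1 cos_le1.
by apply: measurableT_comp => //; apply: continuous_measurable_fun; exact: continuous_cos.
Qed.

Lemma bmeas_sin f : measurable_fun [set: T] f -> bmeas (fun x => sin (f x)).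
Proof.
move=> mf; split; last by exists 1 => x; rewrite ler_norml sin_geN1 sin_le1.
by apply: measurableT_comp => //; apply: continuous_measurable_fun; exact: continuous_sin.
Qed.

Lemma bmeas_comp d' (T' : measurableType d') (g : T' -> T) f :
  measurable_fun [set: T'] g -> bmeas f -> bmeas (fun x => f (g x)).
Proof.
move=> mg [mf [M fM]]; split; first exact: measurableT_comp.
by exists M => x; exact: fM.
Qed.

Variable P : probability T R.

Lemma bmeas_integrable f : bmeas f -> P.-integrable [set: T] (EFin \o f).
Proof. move=> [mf [M fM]]; apply: measurable_bounded_integrable => //.
  by rewrite /= probability_setT ltry.
exists M; split; first exact: num_real.
by move=> x Mx y _; exact: le_trans (fM y) (ltW Mx). Qed.

Lemma bmeas_integralE f : bmeas f -> (\int[P]_x (f x)%:E = (\int[P]_x f x)%R%:E)%E.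
Proof.
move=> bf; rewrite /Rintegral fineK//.
by apply: integrable_fin_num => //; exact: bmeas_integrable.
Qed.

Lemma bintD f g : bmeas f -> bmeas g ->
  \int[P]_x (f x + g x) = \int[P]_x f x + \int[P]_x g x.
Proof. by move=> bf bg; rewrite RintegralD//; exact: bmeas_integrable. Qed.

Lemma bintB f g : bmeas f -> bmeas g ->
  \int[P]_x (f x - g x) = \int[P]_x f x - \int[P]_x g x.
Proof. by move=> bf bg; rewrite RintegralB//; exact: bmeas_integrable. Qed.

Lemma bintZ f (r : R) : bmeas f -> \int[P]_x (r * f x) = r * \int[P]_x f x.
Proof. by move=> bf; rewrite RintegralZl//; exact: bmeas_integrable. Qed.

Lemma bintZr f (r : R) : bmeas f -> \int[P]_x (f x * r) = (\int[P]_x f x) * r.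
Proof. by move=> bf; rewrite RintegralZr//; exact: bmeas_integrable. Qed.

Lemma bint_cst (r : R) : \int[P]_x (fun _ : T => r) x = r.
Proof. by rewrite Rintegral_cst//= probability_setT/= mulr1. Qed.

Lemma bint_sum (I : Type) (s : seq I) (F : I -> T -> R) :
  (forall i, bmeas (F i)) ->
  \int[P]_x (\sum_(i <- s) F i x) = \sum_(i <- s) \int[P]_x (F i x).
Proof.
move=> bF; elim: s => [|i s IH].
  under eq_Rintegral do rewrite big_nil.
  by rewrite big_nil (bint_cst 0).
under eq_Rintegral do rewrite big_cons.
by rewrite bintD// ?IH ?big_cons//; exact: bmeas_sum.
Qed.

Lemma bint_le f g : bmeas f -> bmeas g -> (forall x, f x <= g x) ->
  \int[P]_x f x <= \int[P]_x g x.
Proof. by move=> bf bg fg; apply: le_Rintegral => //; exact: bmeas_integrable. Qed.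

Lemma bint_indic (A : set T) : measurable A -> \int[P]_x (\1_A x) = fine (P A).
Proof. by move=> mA; rewrite /Rintegral integral_indic// setIT. Qed.

Lemma bint_ge0 f : (forall x, 0 <= f x) -> 0 <= \int[P]_x f x.
Proof. by move=> f0; exact: Rintegral_ge0. Qed.

Lemma bint_norm f (M : R) : measurable_fun [set: T] f -> (forall x, `|f x| <= M) ->
  `|\int[P]_x f x| <= M.
Proof.
move=> mf fM; have bf : bmeas f by split => //; exists M.
rewrite (le_trans (le_normr_Rintegral _ _))//; first exact: bmeas_integrable.
rewrite -[leRHS]bint_cst; apply: bint_le => //; last exact: bmeas_cst.
split; first exact: measurableT_comp.
by exists M => x; rewrite normr_id.
Qed.

Lemma bint_cvg (f : nat -> T -> R) (g : T -> R) (M : R) :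
  (forall n, measurable_fun [set: T] (f n)) -> (forall n x, `|f n x| <= M) ->
  (forall x, f n x @[n --> \oo] --> g x) ->
  bmeas g /\ \int[P]_x f n x @[n --> \oo] --> \int[P]_x g x.
Proof.
move=> mf fM fg.
have mg : measurable_fun [set: T] g.
  by apply: (measurable_fun_cvg mf) => x _; exact: fg.
have gM x : `|g x| <= M.
  rewrite -(cvg_lim _ (cvg_norm (fg x)))//.
  apply: limr_le; first by apply/cvg_ex; eexists; exact: cvg_norm (fg x).
  by apply: nearW => n; exact: fM.
have bg : bmeas g by split => //; exists M.
split => //.
have bf n : bmeas (f n) by split => //; exists M; exact: fM.
apply: (@fine_cvg _ _ _ _ (fun n => \int[P]_x (f n x)%:E)%E).
rewrite -bmeas_integralE//.
apply: (@dominated_cvg _ _ _ P _ measurableT _ _ (fun=> M%:E)) => //.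
- by move=> n; exact/measurable_EFinP.
- by move=> x _; apply: cvg_EFin; [exact: nearW|exact: fg].
- exact: finite_measure_integrable_cst.
- by move=> n x _; rewrite lee_fin.
Qed.

End bounded_measurable.

(** * Image measures and comparison sets *)

Section pushforward_tools.
Context d1 d2 (T1 : measurableType d1) (T2 : measurableType d2) (R : realType).
Variable f : T1 -> T2.
Hypothesis mf : measurable_fun [set: T1] f.

Let mfpack : {mfun T1 >-> T2} := HB.pack f (isMeasurableFun.Build _ _ _ _ f mf).

Definition law_of (P : probability T1 R) : probability T2 R := distribution P mfpack.

Lemma bint_law_of (P : probability T1 R) (g : T2 -> R) : bmeas g ->
  (\int[law_of P]_y g y = \int[P]_x g (f x))%R.
Proof.
move=> bg; rewrite /Rintegral integral_distribution//.
  by apply/measurable_EFinP; exact: bg.1.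
exact: (bmeas_integrable P (bmeas_comp mf bg)).
Qed.

Lemma pushforward_measure (m : {measure set T1 -> \bar R}) :
  exists m' : {measure set T2 -> \bar R}, forall A, m' A = m (f @^-1` A).
Proof.
by exists (measure_function_pushforward__canonical__measure_function_Measure m mf).
Qed.

End pushforward_tools.

Section comparison_sets.
Context d (T : measurableType d) (R : realType).
Implicit Types f g : T -> R.

Lemma measurable_le_set f g : measurable_fun [set: T] f -> measurable_fun [set: T] g ->
  measurable [set x | f x <= g x].
Proof. by move=> mf mg; rewrite -[X in measurable X]setTI; exact: measurable_fun_le. Qed.

Lemma measurable_lt_set f g : measurable_fun [set: T] f -> measurable_fun [set: T] g ->
  measurable [set x | f x < g x].
Proof.
move=> mf mg; rewrite (_ : [set x | _] = ~` [set x | g x <= f x]).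
  by apply: measurableC; exact: measurable_le_set.
by apply/seteqP; split => x /=; rewrite ltNge => /negP.
Qed.

End comparison_sets.

(** * Gaussian characteristic function *)

Section gauss_charfun.
Variable R : realType.
Local Notation mu := (@lebesgue_measure R).
Local Notation phi := (normal_pdf (0:R) 1).
Local Notation gam := (normal_prob (0:R) 1).

Lemma ge0_integral_normal_prob (f : R -> \bar R) :
  measurable_fun [set: R] f -> (forall x, 0 <= f x)%E ->
  (\int[gam]_x f x = \int[mu]_x (f x * (phi x)%:E))%E.
Proof.
move=> mf f0; apply: ge0_integral_density => //.
- exact: measurable_normal_pdf.
- by move=> x; rewrite normal_pdf_ge0.
Qed.

Lemma phiE x : phi x = phi 0 * expR (- x ^+ 2 / 2).
Proof.
rewrite normal_pdfE ?oner_eq0// /normal_fun !subr0 expr0n/= oppr0 mul0r expR0 mulr1.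
by rewrite expr1n.
Qed.

Lemma is_derive_phi x : is_derive x (1:R) (phi : R -> R) (- x * phi x).
Proof.
have -> : (phi : R -> R) = (fun x => phi 0 * expR (- x ^+ 2 / 2)) by apply/funext => y; exact: phiE.
apply: is_derive_eq.
rewrite !scaler0 add0r /GRing.scale/=; set e := expR _; set p := phi 0; lra.
Qed.

(** The phase [del] lets one computation yield both transforms of the normal law: cosine for
    [del = 0], sine for [del = - pi / 2]. *)
Definition rot (del lam x : R) := cos (lam * x + del).

Lemma measurable_phi : measurable_fun [set: R] phi.
Proof. exact: measurable_normal_pdf. Qed.

Lemma integrable_phiM (f : R -> R) M : measurable_fun [set: R] f -> (forall x, `|f x| <= M) ->
  mu.-integrable [set: R] (fun x => (f x * phi x)%:E).
Proof.
move=> mf fM.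
have M0 : 0 <= M by exact: le_trans (fM 0).
have ig : mu.-integrable [set: R] (fun x => (M%:E * (phi x)%:E)%E).
  by apply: integrableZl => //; exact: integrable_normal_pdf.
apply: (le_integrable _ _ _ ig) => //.
- by apply/measurable_EFinP; apply: measurable_funM => //; exact: measurable_phi.
- move=> x _; rewrite -EFinM lee_fin !normrM ler_pM//.
  by rewrite (le_trans (fM x)) ?ler_norm.
Qed.

(** Half of the Gaussian exponent absorbs the factor: [|x| <= 1 + x^2 / 4 <= exp (x^2 / 4)], which
    leaves a multiple of the density of standard deviation [sqrt 2]. This is the dominating function
    for differentiation under the integral sign. *)
Lemma integrable_xphi : mu.-integrable [set: R] (fun x => (`|x| * phi x)%:E).
Proof.
have s2 : Num.sqrt 2 != 0 :> R by rewrite gt_eqF// sqrtr_gt0.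
pose c : R := phi 0 / normal_peak (Num.sqrt 2).
have ig : mu.-integrable [set: R] (fun x => (c%:E * (normal_pdf 0 (Num.sqrt 2) x)%:E)%E).
  by apply: integrableZl => //; exact: integrable_normal_pdf.
apply: (le_integrable _ _ _ ig) => //.
- apply/measurable_EFinP; apply: measurable_funM; last exact: measurable_phi.
  exact: normr_measurable.
- move=> x _; rewrite -EFinM lee_fin ger0_norm; last first.
    by rewrite mulr_ge0 ?normal_pdf_ge0.
  rewrite ger0_norm; last first.
    by rewrite mulr_ge0 ?normal_pdf_ge0// divr_ge0 ?normal_pdf_ge0 ?normal_peak_ge0.
  rewrite (normal_pdfE 0 s2) /c mulrA divfK ?gt_eqF ?normal_peak_gt0//.
  rewrite /normal_fun subr0 sqr_sqrtr// phiE mulrCA ler_wpM2l ?normal_pdf_ge0//.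
  have -> : - x ^+ 2 / 2 = - x ^+ 2 / 4 + - x ^+ 2 / 4 by field.
  have -> : (2 *+ 2 : R) = 4 by rewrite mulr2n; ring.
  rewrite expRD mulrA ler_piMl ?expR_ge0//.
  have := expR_ge1Dx (x ^+ 2 / 4).
  rewrite [- _ / _]mulNr expRN => h.
  rewrite ler_pdivrMr ?expR_gt0// mul1r (le_trans _ h)//.
  have := sqr_ge0 (`|x| / 2 - 1); rewrite -[x^+2]real_normK ?num_real//.
  by set y := `|x|; nra.
Qed.

Lemma measurable_rot del lam : measurable_fun [set: R] (rot del lam).
Proof.
apply: measurableT_comp; first by apply: continuous_measurable_fun; exact: continuous_cos.
by apply: measurable_funD => //; exact: measurable_funM.
Qed.

Lemma rot_le1 del lam x : `|rot del lam x| <= 1.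
Proof. by rewrite ler_norml cos_geN1 cos_le1. Qed.

Lemma is_derive_rot del lam x :
  is_derive lam (1:R) (fun l => rot del l x * phi x) (- x * sin (lam * x + del) * phi x).
Proof.
rewrite /rot; apply: is_derive_eq.
rewrite /GRing.scale/= !mulr0 ?addr0 ?add0r; ring.
Qed.

Let J del lam := (\int[mu]_x (rot del lam x * phi x))%R.
Let K del lam := (\int[mu]_x (- x * sin (lam * x + del) * phi x))%R.

Let integrable_rot del lam : mu.-integrable [set: R] (fun x => (rot del lam x * phi x)%:E).
Proof. by apply: (@integrable_phiM _ 1); [exact: measurable_rot|exact: rot_le1]. Qed.

Let measurable_sinlam del lam : measurable_fun [set: R] (fun x : R => sin (lam * x + del)).
Proof.
apply: measurableT_comp; first by apply: continuous_measurable_fun; exact: continuous_sin.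
by apply: measurable_funD => //; exact: measurable_funM.
Qed.

Let integrable_xsin del lam :
  mu.-integrable [set: R] (fun x => (- x * sin (lam * x + del) * phi x)%:E).
Proof.
apply: (le_integrable _ _ _ integrable_xphi) => //.
  apply/measurable_EFinP; apply: measurable_funM; last exact: measurable_phi.
  by apply: measurable_funM; [exact: oppr_measurable|exact: measurable_sinlam].
move=> x _; rewrite lee_fin !normrM normrN normr_id ler_wpM2r// ler_piMr//.
by rewrite ler_norml sin_geN1 sin_le1.
Qed.

Let is_derive_J del lam : is_derive lam (1:R) (J del) (K del lam).
Proof.
pose f (l x : R) := rot del l x * phi x.
have df x y : is_derive x (1:R) (f^~ y) (- y * sin (x * y + del) * phi y).
  exact: is_derive_rot.
have Ia : (`](lam - 1), (lam + 1)[%classic : set R) lam by rewrite /= in_itv/=; lra.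
have G0 (y : R) : 0 <= `|y| * phi y by rewrite mulr_ge0// normal_pdf_ge0.
have pE x y : partial1of2 f x y = - y * sin (x * y + del) * phi y.
  by rewrite partial1of2E; have /@derive_val := df x y.
have Gub (x y : R) : (`](lam - 1), (lam + 1)[%classic : set R) x -> [set: R] y -> `|partial1of2 f x y| <= `|y| * phi y.
  move=> _ _; rewrite pE !normrM normrN (ger0_norm (normal_pdf_ge0 _ _ _)).
  rewrite ler_wpM2r ?normal_pdf_ge0// ler_piMr//.
  by rewrite ler_norml sin_geN1 sin_le1.
have dJ : derivable (J del) lam 1.
  apply: (@derivable_under_integral _ _ _ mu f setT measurableT lam _ _ Ia _ _ (fun y => `|y| * phi y)) => //.
  - by move=> x _; exact: integrable_rot.
  - exact: integrable_xphi.
apply: DeriveDef => //.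
rewrite -derive1E.
rewrite (@differentiation_under_integral _ _ _ mu f setT measurableT lam _ _ Ia _ _ (fun y => `|y| * phi y)) => //.
- by apply: eq_Rintegral => x _; rewrite pE.
- by move=> x _; exact: integrable_rot.
- exact: integrable_xphi.
Qed.

(** Integration by parts. The difference of the two sides is the integral over the line of the
    derivative of [sin (lam x + del) * phi x]; over [[-(n+1), n+1]] it equals a boundary term
    bounded by a multiple of [1 / (n + 1)]. *)
Let KE del lam : K del lam = - lam * J del lam.
Proof.
pose F (x : R) := sin (lam * x + del) * phi x.
pose h (x : R) := lam * (rot del lam x * phi x) + - x * sin (lam * x + del) * phi x.
have dF x : is_derive x (1:R) F (h x).
  have dp := is_derive_phi x.
  rewrite /F; apply: is_derive_eq.
  by rewrite /h /rot /GRing.scale/= addr0 mulr1; ring.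
have ih1 : mu.-integrable [set: R] (fun x => (lam * (rot del lam x * phi x))%:E).
  under eq_fun do rewrite EFinM.
  by apply: integrableZl => //; exact: integrable_rot.
have ih : mu.-integrable [set: R] (EFin \o h).
  rewrite /h /comp; under eq_fun do rewrite EFinD.
  by apply: integrableD => //; exact: integrable_xsin.
suff : (\int[mu]_x h x)%R = 0.
  rewrite /h RintegralD//; last exact: integrable_xsin.
  rewrite RintegralZl//; last exact: integrable_rot.
  by rewrite -/(J del lam) -/(K del lam); lra.
have mh : measurable_fun [set: R] h by apply/measurable_EFinP; exact: measurable_int ih.
have cF : continuous F by move=> x; apply: differentiable_continuous; apply/derivable1_diffP; have [] := dF x.
have ch : continuous h.
  have cphi : continuous phi by apply: continuous_normal_pdf; rewrite oner_eq0.
  have clin : continuous (fun x : R => lam * x + del).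
    by move=> x; apply: cvgD; [apply: cvgM; [exact: cvg_cst|exact: cvg_id]|exact: cvg_cst].
  move=> x; apply: cvgD.
    apply: cvgM; first exact: cvg_cst.
    apply: cvgM; last exact: cphi.
    by apply: continuous_comp; [exact: clin|exact: continuous_cos].
  apply: cvgM; last exact: cphi.
  apply: cvgM; first exact: opp_continuous.
  by apply: continuous_comp; [exact: clin|exact: continuous_sin].
pose I n : R := (\int[mu]_(x in `[(- n.+1%:R), n.+1%:R]) h x)%R.
have IE n : I n = F n.+1%:R - F (- n.+1%:R).
  have n0 : - n.+1%:R < n.+1%:R :> R by rewrite -subr_gt0 opprK addr_gt0.
  rewrite /I /Rintegral (@continuous_FTC2 _ h F)//.
  - exact: continuous_subspaceT.
  - split.
    + by move=> x _; have [] := dF x.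
    + by apply: cvg_at_right_filter; exact: cF.
    + by apply: cvg_at_left_filter; exact: cF.
  - by move=> x _; rewrite derive1E; have /@derive_val := dF x.
have I0 : I n @[n --> \oo] --> (0:R).
  have Fn (n : nat) (b : R) : `|b| = n.+1%:R -> `|F b| <= 2 * phi 0 * n.+1%:R^-1.
    move=> bn; rewrite /F normrM (ger0_norm (normal_pdf_ge0 _ _ _)).
    apply: (@le_trans _ _ (phi b)).
      by rewrite ler_piMl ?normal_pdf_ge0// ler_norml sin_geN1 sin_le1.
    rewrite phiE -mulrA mulrCA ler_wpM2l ?normal_pdf_ge0// mulNr expRN.
    rewrite -[_^+2]real_normK ?num_real// bn.
    rewrite -ler_pdivrMl// -invfM lef_pV2 ?posrE ?expR_gt0 ?mulr_gt0 ?invr_gt0//.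
    have := expR_ge1Dx ((n.+1%:R ^+ 2 / 2) : R); set e := expR _.
    have : 1 <= n.+1%:R :> R by rewrite ler1n.
    set m : R := n.+1%:R; nra.
  have b0 : (2 * phi 0 * n.+1%:R^-1 + 2 * phi 0 * n.+1%:R^-1) @[n --> \oo] --> (0:R).
    rewrite -[X in _ --> X](_ : 2 * phi 0 * 0 + 2 * phi 0 * 0 = 0); last by rewrite !mulr0 addr0.
    by apply: cvgD; apply: cvgM; (exact: cvg_cst || exact: cvg_harmonic).
  have b0N : (- (2 * phi 0 * n.+1%:R^-1 + 2 * phi 0 * n.+1%:R^-1)) @[n --> \oo] --> (0:R).
    by rewrite -[X in _ --> X]oppr0; exact: cvgN.
  apply: (squeeze_cvgr _ b0N b0); apply: nearW => n.
  rewrite -ler_norml IE (le_trans (ler_normB _ _))// lerD//.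
    by apply: Fn; rewrite ger0_norm.
  by apply: Fn; rewrite normrN ger0_norm.
have I1 : I n @[n --> \oo] --> (\int[mu]_x h x)%R.
  pose hn n x := (h x * \1_(`[(- n.+1%:R), n.+1%:R]%classic : set R) x).
  have mi n : measurable (`[(- n.+1%:R), n.+1%:R]%classic : set R) by exact: measurable_itv.
  pose An n : set R := `[(- n.+1%:R), n.+1%:R]%classic.
  suff : (fun n => \int[mu]_(x in An n) (h x)%:E)%E @ \oo -->
      (fine (\int[mu]_x (h x)%:E)%E)%:E by move=> /fine_cvg.
  rewrite fineK; last by apply: integrable_fin_num.
  rewrite (_ : (fun n => _) = (fun n => \int[mu]_x (hn n x)%:E)%E); last first.
    apply/funext => n; rewrite integral_mkcond; apply: eq_integral => x _.
    by rewrite /hn /patch indicE; case: (x \in _); rewrite ?mulr1 ?mulr0.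
  apply: (@dominated_cvg _ _ _ mu _ measurableT _ _ (fun x => `|(h x)%:E|)%E) => //.
  - by move=> n; apply/measurable_EFinP; apply: measurable_funM => //; exact: measurable_indic.
  - move=> x _; apply: cvg_EFin; first exact: nearW.
    apply: cvg_near_cst; exists (Num.truncn `|x|) => // n /= xn.
    rewrite /hn indicE mem_set ?mulr1//= in_itv/= -ler_norml.
    have := truncnS_gt `|x|; move/ltW/le_trans; apply.
    by rewrite ler_nat.
  - exact: integrable_abse ih.
  - move=> n x _; rewrite lee_fin /hn normrM ler_piMr// indicE.
    by case: (x \in _); rewrite ?normr1 ?normr0.
exact: (cvg_unique _ I1 I0).
Qed.

(** By [KE], [J] solves [J' = - lam J], so its product with [exp (lam^2 / 2)] is constant; at
    [lam = 0] it is [cos del] times the mass of [phi]. *)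
Let JE del lam : J del lam = cos del * expR (- lam ^+ 2 / 2).
Proof.
pose E (l : R) := J del l * expR (l ^+ 2 / 2).
have dE l : is_derive l (1:R) E 0.
  have dJ := is_derive_J del l.
  rewrite /E; apply: is_derive_eq.
  by rewrite !scaler0 ?addr0 ?add0r KE /GRing.scale/=; lra.
have := @is_derive_0_is_cst R E lam 0 dE.
rewrite /E expr0n/= mul0r expR0 mulr1 => /(congr1 (fun z => z * expR (- lam ^+ 2 / 2))).
rewrite -mulrA -expRD mulNr subrr expR0 mulr1 => ->; congr (_ * _).
rewrite /J /rot; under eq_Rintegral do rewrite mul0r add0r.
rewrite RintegralZl//; last exact: integrable_normal_pdf.
by rewrite /Rintegral integral_normal_pdf mulr1.
Qed.

Lemma bint_normal_prob (f : R -> R) : bmeas f ->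
  (\int[gam]_x f x = \int[mu]_x (f x * phi x))%R.
Proof.
move=> bf; have [mf [M fM]] := bf.
have mfM : measurable_fun [set: R] (fun x => f x + M) by exact: measurable_funD.
have fM0 x : 0 <= f x + M by rewrite -lerBlDr sub0r; have := fM x; rewrite ler_norml => /andP[].
have mfME : measurable_fun [set: R] (fun x => (f x + M)%:E) by exact/measurable_EFinP.
have /(congr1 fine) := @ge0_integral_normal_prob (fun x => (f x + M)%:E) mfME fM0.
rewrite -!/(Rintegral _ _ _) bintD//; last exact: bmeas_cst.
rewrite bint_cst.
have -> : (\int[mu]_x ((f x + M) * phi x) = \int[mu]_x (f x * phi x + M * phi x))%R.
  by apply: eq_Rintegral => x _; rewrite mulrDl.
rewrite RintegralD//.
- rewrite RintegralZl//; last exact: integrable_normal_pdf.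
  by rewrite [X in _ = _ + M * X]/Rintegral integral_normal_pdf mulr1 => /addIr.
- exact: integrable_phiM fM.
- rewrite /comp; under eq_fun do rewrite EFinM.
  by apply: integrableZl => //; exact: integrable_normal_pdf.
Qed.

Lemma cos_normal (lam : R) : (\int[gam]_x cos (lam * x) = expR (- lam ^+ 2 / 2))%R.
Proof.
rewrite bint_normal_prob; last by apply: bmeas_cos; exact: measurable_funM.
have := JE 0 lam; rewrite cos0 mul1r => <-.
by apply: eq_Rintegral => x _; rewrite /rot addr0.
Qed.

Lemma sin_normal (lam : R) : (\int[gam]_x sin (lam * x) = 0)%R.
Proof.
rewrite bint_normal_prob; last by apply: bmeas_sin; exact: measurable_funM.
transitivity (J (- (pi / 2)) lam); last by rewrite JE cosN cos_pihalf mul0r.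
by apply: eq_Rintegral => x _; rewrite /rot cosBpihalf.
Qed.

End gauss_charfun.

(** * Fubini for bounded functions *)

Section bounded_fubini.
Context d1 d2 (T1 : measurableType d1) (T2 : measurableType d2) (R : realType).
Variables (P1 : probability T1 R) (P2 : probability T2 R).

Lemma bmeas_prod_integrable (f : T1 * T2 -> R) : bmeas f ->
  (P1 \x P2)%E.-integrable [set: T1 * T2] (EFin \o f).
Proof. by move=> bf; exact: (bmeas_integrable (P1 \x P2)%E bf). Qed.

Lemma bint_prod (f : T1 * T2 -> R) : bmeas f ->
  (\int[(P1 \x P2)%E]_z f z = \int[P1]_x (\int[P2]_y f (x, y)))%R.
Proof.
move=> bf; rewrite /Rintegral -integral12_prod_meas1; last exact: bmeas_prod_integrable.
congr fine; apply: eq_integral => x _; rewrite /fubini_F.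
have bfx : bmeas (fun y => f (x, y)).
  by apply: (bmeas_comp (g := fun y => (x, y))) bf; exact: pair1_measurable.
by rewrite bmeas_integralE.
Qed.

Lemma bint_fubini (f : T1 * T2 -> R) : bmeas f ->
  (\int[P1]_x (\int[P2]_y f (x, y)) = \int[P2]_y (\int[P1]_x f (x, y)))%R.
Proof.
move=> bf; rewrite -bint_prod// /Rintegral -integral21_prod_meas1; last exact: bmeas_prod_integrable.
congr fine; apply: eq_integral => y _; rewrite /fubini_G.
have bfy : bmeas (fun x => f (x, y)).
  by apply: (bmeas_comp (g := fun x => (x, y))) bf; exact: pair2_measurable.
by rewrite bmeas_integralE.
Qed.

Lemma bmeas_bint (f : T1 * T2 -> R) : bmeas f ->
  bmeas (fun x => \int[P2]_y f (x, y))%R.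
Proof.
move=> bf; have [mf [M fM]] := bf; split.
  apply/measurable_EFinP.
  rewrite (_ : _ \o _ = fubini_F P2 (EFin \o f)).
    exact: (measurable_fubini_F (m1 := P1) (bmeas_prod_integrable bf)).
  apply/funext => x; rewrite /fubini_F/= bmeas_integralE//.
  by apply: (bmeas_comp (g := fun y => (x, y))) bf; exact: pair1_measurable.
exists M => x; apply: bint_norm => //.
by have [] := bmeas_comp (@pair1_measurable _ _ T1 T2 x) bf.
Qed.

End bounded_fubini.

(** * From trigonometric transforms to indicators of intervals *)

Section charfun_transfer.
Variable R : realType.
Local Notation gam := (normal_prob (0:R) 1).

(* [exp (- c (x - y)^2)] is an average of cosines, by the Gaussian characteristic function. *)
Lemma bump_cosE d (T : measurableType d) (P : probability T R) (X Z : T -> R) (c y : R) :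
  0 <= c -> measurable_fun [set: T] X -> bmeas Z ->
  (\int[P]_w (expR (- c * (X w - y) ^+ 2) * Z w) =
   \int[gam]_l (cos (Num.sqrt (2 * c) * l * y) * \int[P]_w (cos (Num.sqrt (2 * c) * l * X w) * Z w)
    + sin (Num.sqrt (2 * c) * l * y) * \int[P]_w (sin (Num.sqrt (2 * c) * l * X w) * Z w)))%R.
Proof.
move=> c0 mX bZ; set s := Num.sqrt (2 * c).
have s2 : s ^+ 2 = 2 * c by rewrite sqr_sqrtr// mulr_ge0.
pose f (z : T * R) := cos (s * (X z.1 - y) * z.2) * Z z.1.
have bf : bmeas f.
  apply: bmeasM; last exact: (bmeas_comp measurable_fst bZ).
  apply: bmeas_cos; apply: measurable_funM => //.
  apply: measurable_funM => //; apply: measurable_funB => //.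
  exact: measurableT_comp.
transitivity (\int[P]_w (\int[gam]_l f (w, l)))%R.
  apply: eq_Rintegral => w _; rewrite /f/= bintZr; last first.
    by apply: bmeas_cos; exact: measurable_funM.
  rewrite cos_normal; congr (expR _ * _).
  by rewrite exprMn s2; field.
rewrite bint_fubini//; apply: eq_Rintegral => l _; rewrite /f/=.
have mlX : measurable_fun [set: T] (fun w => s * l * X w) by exact: measurable_funM.
have bc : bmeas (fun w => cos (s * l * X w) * Z w) by apply: bmeasM => //; exact: bmeas_cos.
have bs : bmeas (fun w => sin (s * l * X w) * Z w) by apply: bmeasM => //; exact: bmeas_sin.
rewrite -!bintZ// -bintD; [|exact: bmeasZ..].
apply: eq_Rintegral => w _.
have -> : s * (X w - y) * l = s * l * X w - s * l * y by ring.
by rewrite cosB; ring.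
Qed.

Variables (d1 d2 : measure_display) (T1 : measurableType d1) (T2 : measurableType d2).
Variables (P1 : probability T1 R) (P2 : probability T2 R).
Variables (X1 Z1 : T1 -> R) (X2 Z2 : T2 -> R).
Hypotheses (mX1 : measurable_fun [set: T1] X1) (mX2 : measurable_fun [set: T2] X2).
Hypotheses (bZ1 : bmeas Z1) (bZ2 : bmeas Z2).
Hypothesis cosE : forall l, (\int[P1]_w (cos (l * X1 w) * Z1 w) = \int[P2]_w (cos (l * X2 w) * Z2 w))%R.
Hypothesis sinE : forall l, (\int[P1]_w (sin (l * X1 w) * Z1 w) = \int[P2]_w (sin (l * X2 w) * Z2 w))%R.

Let agree (f : R -> R) := (\int[P1]_w (f (X1 w) * Z1 w) = \int[P2]_w (f (X2 w) * Z2 w))%R.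

Let bX d (T : measurableType d) (X Z : T -> R) (f : R -> R) : measurable_fun [set: T] X -> bmeas Z ->
  bmeas f -> bmeas (fun w => f (X w) * Z w).
Proof. by move=> mX bZ bf; apply: bmeasM => //; exact: bmeas_comp. Qed.

Let agree_bump c y : 0 <= c -> agree (fun x => expR (- c * (x - y) ^+ 2)).
Proof.
move=> c0; rewrite /agree !bump_cosE//; apply: eq_Rintegral => l _.
by rewrite cosE sinE.
Qed.

Let bmeas_bump (c y : R) : 0 <= c -> bmeas (fun x : R => expR (- c * (x - y) ^+ 2)).
Proof.
move=> c0; apply: bmeas01.
  apply: measurableT_comp => //; apply: measurable_funM => //.
  by apply: measurable_funX; exact: measurable_funB.
by move=> x; rewrite expR_ge0 -expR0 ler_expR mulNr oppr_le0 mulr_ge0 ?sqr_ge0.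
Qed.

(** In the binomial expansion the [i]-th power of a bump is again a bump, with [c] replaced by
    [i c]. *)
Let agree_pow c y n : 0 <= c -> agree (fun x => (1 - expR (- c * (x - y) ^+ 2)) ^+ n).
Proof.
move=> c0.
pose g (i : 'I_n.+1) (x : R) := (-1) ^+ i *+ 'C(n, i) * expR (- (c *+ i) * (x - y) ^+ 2).
have E x : (1 - expR (- c * (x - y) ^+ 2)) ^+ n = \sum_(i < n.+1) g i x.
  rewrite exprDn; apply: eq_bigr => i _; rewrite expr1n mul1r exprNn -mulrnAl; congr (_ * _).
  by rewrite -expRM_natl; congr expR; rewrite -mulr_natl -[c *+ _]mulr_natl; ring.
have bg i : bmeas (g i) by apply: bmeasZ; apply: bmeas_bump; rewrite mulrn_wge0.
have S d (T : measurableType d) (P : probability T R) (X Z : T -> R) :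
    measurable_fun [set: T] X -> bmeas Z ->
    (\int[P]_w ((1 - expR (- c * (X w - y) ^+ 2)) ^+ n * Z w) =
     \sum_(i < n.+1) (-1) ^+ i *+ 'C(n, i) * \int[P]_w (expR (- (c *+ i) * (X w - y) ^+ 2) * Z w))%R.
  move=> mX bZ; under eq_Rintegral do rewrite E big_distrl/=.
  rewrite bint_sum; last by move=> i; exact: bX.
  apply: eq_bigr => i _; rewrite -bintZ; last first.
    apply: (@bX _ _ X Z (fun x => expR (- (c *+ i) * (x - y) ^+ 2)) mX bZ).
    by apply: bmeas_bump; rewrite mulrn_wge0.
  by apply: eq_Rintegral => w _; rewrite /g mulrA.
rewrite /agree !S//; apply: eq_bigr => i _; congr (_ * _).
by apply: (agree_bump y); rewrite mulrn_wge0.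
Qed.

Let agreeB1 (f : R -> R) : bmeas f -> agree f -> agree (fun x => 1 - f x).
Proof.
move=> bf af; rewrite /agree.
under eq_Rintegral do rewrite mulrBl.
under [RHS]eq_Rintegral do rewrite mulrBl.
have b1 : bmeas (fun _ : R => 1 : R) by exact: bmeas_cst.
rewrite !bintB ?af; last 4 first.
- exact: (@bX _ _ X2 Z2 (fun=> 1)).
- exact: (@bX _ _ X2 Z2 f).
- exact: (@bX _ _ X1 Z1 (fun=> 1)).
- exact: (@bX _ _ X1 Z1 f).
congr (_ - _).
(* The bump with [c = 0] is the constant 1, so the total masses of [Z1] and [Z2] agree. *)
have := agree_bump 0 (lexx 0); rewrite /agree.
under eq_Rintegral do rewrite oppr0 mul0r expR0.
by under [in X in _ = X -> _]eq_Rintegral do rewrite oppr0 mul0r expR0.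
Qed.

Let agree_lim (f : nat -> R -> R) (g : R -> R) : (forall n, measurable_fun [set: R] (f n)) ->
  (forall n x, 0 <= f n x <= 1) -> (forall x, f n x @[n --> \oo] --> g x) ->
  (forall n, agree (f n)) -> agree g.
Proof.
move=> mf f01 fg af.
have C d (T : measurableType d) (P : probability T R) (X Z : T -> R) :
    measurable_fun [set: T] X -> bmeas Z ->
    (\int[P]_w (f n (X w) * Z w) @[n --> \oo] --> (\int[P]_w (g (X w) * Z w)))%R.
  move=> mX [mZ [M ZM]]; apply: (bint_cvg (M := M) _ _ _ _).2.
  - by move=> n; apply: measurable_funM => //; exact: measurableT_comp.
  - move=> n x; rewrite normrM; have /andP[f0 f1] := f01 n (X x).
    by rewrite (ger0_norm f0) (le_trans _ (ZM x))// ler_piMl.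
  - by move=> x; apply: cvgM; [exact: fg|exact: cvg_cst].
have := C _ _ P1 _ _ mX1 bZ1.
under eq_fun do rewrite af.
move=> c1; have c2 := C _ _ P2 _ _ mX2 bZ2.
exact: (cvg_unique _ c1 c2).
Qed.

(* With this exponent, [1 - (1 - exp (- n (x - y)^2)) ^ K r n] tends to 1 for [|x - y| <= r] and to 0 otherwise. *)
Let K (r : R) (n : nat) := (Num.truncn (n%:R * expR (n%:R * r ^+ 2))).+1.

(** From [1 - u <= exp (- u)]: the exponent [K r n] exceeds [n exp (n r^2)], hence [K r n * u >= n]
    when [|x - y| <= r]. *)
Let bump_pow_le (x y r : R) n : `|x - y| <= r ->
  (1 - expR (- n%:R * (x - y) ^+ 2)) ^+ K r n <= (expR n%:R)^-1.
Proof.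
move=> xr; set u := expR _.
have u1 : 0 <= 1 - u.
  by rewrite subr_ge0 -expR0 ler_expR mulNr oppr_le0 mulr_ge0 ?sqr_ge0.
apply: (@le_trans _ _ (expR (- u) ^+ K r n)).
  by rewrite lerXn2r ?nnegrE ?expR_ge0//; exact: expR_ge1Dx.
rewrite -expRM_natl -expRN ler_expR mulrN lerN2.
apply: (@le_trans _ _ (n%:R * expR (n%:R * r ^+ 2) * u)); last first.
  by rewrite ler_wpM2r ?expR_ge0// ltW// truncnS_gt.
rewrite -mulrA -expRD ler_peMr// -expR0 ler_expR mulNr subr_ge0 ler_wpM2l//.
by rewrite -[leLHS]real_normK ?num_real// lerXn2r ?nnegrE// (le_trans _ xr).
Qed.

(** By Bernoulli, [1 - (1 - u)^m <= m u]. Outside the interval the gap [e = (x - y)^2 - r^2] is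
    positive, and [K r n * u] is at most [(n + 1) exp (- n e)]. *)
Let bump_pow_gt (x y r : R) : r < `|x - y| -> 0 <= r -> exists C, forall n,
  1 - (1 - expR (- n%:R * (x - y) ^+ 2)) ^+ K r n <= C * n.+1%:R^-1.
Proof.
move=> rx r0; set d := x - y in rx *.
pose e := d ^+ 2 - r ^+ 2.
have e0 : 0 < e by rewrite subr_gt0 -[ltRHS]real_normK ?num_real// ltrXn2r.
have B (u : R) m : 0 <= u -> u <= 1 -> 1 - (1 - u) ^+ m <= m%:R * u.
  move=> u0 u1; elim: m => [|m IH]; first by rewrite expr0 subrr mul0r.
  rewrite exprS -natr1 mulrDl mul1r.
  have p1 : (1 - u) ^+ m <= 1 by rewrite exprn_ile1 ?subr_ge0// lerBlDr lerDl.
  have p0 : 0 <= (1 - u) ^+ m by rewrite exprn_ge0// subr_ge0.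
  by move: IH; set p := (1 - u) ^+ m in p0 p1 *; nra.
(* The first two summands bound [n exp (- n e)] by means of [exp (n e) >= (1 + n e / 2)^2]; the last
   bracket bounds [exp (- n e)] by means of [exp (n e) >= 1 + n e]. *)
exists (4 / e ^+ 2 + e^-1 + (1 + e^-1)) => n.
set u := expR _.
have u1 : u <= 1 by rewrite -expR0 ler_expR mulNr oppr_le0 mulr_ge0 ?sqr_ge0.
apply: le_trans (B u _ (expR_ge0 _) u1) _.
have Kle : (K r n)%:R <= n%:R * expR (n%:R * r ^+ 2) + 1 :> R.
  by rewrite -natr1 lerD2r truncn_le// mulr_ge0// expR_ge0.
apply: (@le_trans _ _ ((n%:R * expR (n%:R * r ^+ 2) + 1) * u)).
  by rewrite ler_wpM2r ?expR_ge0.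
have E : expR (n%:R * r ^+ 2) * u = (expR (n%:R * e))^-1.
  by rewrite -expRD -expRN; congr expR; rewrite /e; ring.
rewrite mulrDl -mulrA E mul1r.
have ue : u <= (expR (n%:R * e))^-1.
  by rewrite -expRN ler_expR mulNr lerN2 ler_wpM2l// /e gerBl sqr_ge0.
have n0 : 0 <= n%:R :> R by [].
have h1 : 1 + n%:R * e <= expR (n%:R * e) by exact: expR_ge1Dx.
have h2 : (1 + n%:R * e / 2) ^+ 2 <= expR (n%:R * e).
  have -> : expR (n%:R * e) = expR (n%:R * e / 2) ^+ 2.
    by rewrite -expRM_natl; congr expR; field.
  rewrite lerXn2r ?nnegrE ?expR_ge0 ?expR_ge1Dx//.
  by rewrite addr_ge0// divr_ge0// mulr_ge0// ltW.
rewrite -(natr1 n) [leRHS]mulrDl.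
move: h1 h2 (expR_gt0 (n%:R * e)) n0 ue; set N : R := n%:R; set X := expR _.
move=> h1 h2 X0 N0 ue.
have N1 : 0 < N + 1 by lra.
apply: lerD.
  rewrite ler_pdivlMr// mulrAC ler_pdivrMr//.
  apply: (@le_trans _ _ ((4 / e ^+ 2 + e^-1) * (1 + N * e / 2) ^+ 2)); last first.
    by rewrite ler_wpM2l// addr_ge0 ?divr_ge0 ?sqr_ge0 ?invr_ge0// ltW.
  have -> : (4 / e ^+ 2 + e^-1) * (1 + N * e / 2) ^+ 2 =
     N * (N + 1) + (4 / e ^+ 2 + 4 * N / e + e^-1 + N ^+ 2 * e / 4).
    by field; rewrite gt_eqF.
  have e'0 : 0 <= e^-1 by rewrite invr_ge0 ltW.
  by rewrite lerDl !addr_ge0 ?mulr_ge0 ?invr_ge0 ?sqr_ge0 // ltW.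
apply: le_trans ue _.
rewrite ler_pdivlMr// mulrC ler_pdivrMr//.
apply: (@le_trans _ _ ((1 + e^-1) * (1 + N * e))); last first.
  by rewrite ler_wpM2l// addr_ge0// invr_ge0 ltW.
have -> : (1 + e^-1) * (1 + N * e) = N + 1 + (N * e + e^-1) by field; rewrite gt_eqF.
by rewrite lerDl addr_ge0 ?mulr_ge0 ?invr_ge0// ltW.
Qed.

(** Agreement passes from trigonometric functions to Gaussian bumps, to the powers of their
    complements, and by bounded convergence to the indicator. The signed weights [Z1] and [Z2] allow
    a vector to be treated one coordinate at a time, the other coordinates being kept in the
    weight. *)
Lemma charfun_transfer (a b : R) : a <= b ->
  (\int[P1]_w (\1_(`[a, b]%classic : set R) (X1 w) * Z1 w) =
   \int[P2]_w (\1_(`[a, b]%classic : set R) (X2 w) * Z2 w))%R.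
Proof.
move=> ab; pose y := (a + b) / 2; pose r := (b - a) / 2.
pose f (n : nat) (x : R) := 1 - (1 - expR (- n%:R * (x - y) ^+ 2)) ^+ K r n.
have e01 (n : nat) (x : R) : 0 <= 1 - expR (- n%:R * (x - y) ^+ 2) <= 1.
  rewrite subr_ge0 lerBlDr lerDl expR_ge0 andbT -expR0 ler_expR mulNr oppr_le0.
  by rewrite mulr_ge0 ?sqr_ge0.
apply: (@agree_lim f).
- move=> n; apply: measurable_funB => //; apply: measurable_funX.
  by apply: measurable_funB => //; have [] := @bmeas_bump n%:R y (ler0n _ _).
- move=> n x; have /andP[e0 e1] := e01 n x.
  by rewrite subr_ge0 exprn_ile1//= lerBlDr lerDl exprn_ge0.
- move=> x; have rE : (x \in (`[a, b]%classic : set R)) = (`|x - y| <= r).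
    rewrite ler_norml; apply/idP/idP; rewrite ?inE /= in_itv/= => /andP[h1 h2];
      by apply/andP; rewrite /y /r in h1 h2 *; split; lra.
  have r0 : 0 <= r by rewrite /r; lra.
  rewrite indicE rE; have [xr|xr] := leP (`|x - y|) r.
    have lo : (1 - n.+1%:R^-1) @[n --> \oo] --> (true%:R : R).
      rewrite -[X in _ --> X]subr0; apply: cvgB; first exact: cvg_cst.
      exact: cvg_harmonic.
    apply: (squeeze_cvgr _ lo (cvg_cst _)); apply: nearW => n; apply/andP; split; last first.
      rewrite /f lerBlDr lerDl exprn_ge0//.
      by have /andP[] := e01 n x.
    rewrite /f lerB//; apply: le_trans (bump_pow_le n xr) _.
    rewrite lef_pV2 ?posrE ?expR_gt0// -natr1 addrC.
    exact: expR_ge1Dx.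
  have [C HC] := bump_pow_gt xr r0.
  have hi : (C * n.+1%:R^-1) @[n --> \oo] --> (false%:R : R).
    rewrite -[X in _ --> X](mulr0 C); apply: cvgM; first exact: cvg_cst.
    exact: cvg_harmonic.
  apply: (squeeze_cvgr _ (cvg_cst _) hi); apply: nearW => n; apply/andP; split; last exact: HC.
  have /andP[e0 e1] := e01 n x.
  by rewrite subr_ge0 exprn_ile1//= lerBlDr lerDl exprn_ge0.
- by move=> n; apply: agreeB1; [apply: bmeasX; apply: bmeasB; [exact: bmeas_cst|exact: bmeas_bump]|exact: agree_pow].
Qed.

End charfun_transfer.

(** * The Prekopa-Leindler inequality *)

Section brunn_minkowski_1d.
Variable R : realType.
Local Notation mu := (@lebesgue_measure R).
Local Notation phi := (normal_pdf (0:R) 1).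
Local Notation gam := (normal_prob (0:R) 1).

Lemma measurable_affine (a b : R) : measurable_fun [set: R] (fun x : R => a * x + b).
Proof. by apply: measurable_funD => //; exact: measurable_funM. Qed.

Lemma lebesgue_measure_dilate (b : R) (S : set R) : measurable S ->
  (mu S = 2%:E * mu [set x : R | S (2 * x - b)%R])%E.
Proof.
move=> mS.
pose f (x : measurableTypeR R) : measurableTypeR R := 2 * x + (- b).
have mf : measurable_fun [set: measurableTypeR R] f by exact: measurable_affine.
have two : (0 <= 2 :> R) by [].
have [pm pmE] := pushforward_measure mf mu.
pose m : {measure set (measurableTypeR R) -> \bar R} := mscale (NngNum two) pm.
have -> : (2%:E * mu [set x : R | S (2 * x - b)%R])%E = m S by rewrite /m /= /mscale/= pmE.
apply: (@lebesgue_measure_unique R m) => // _ [[p q]] _ <-.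
rewrite /m /= /mscale/= pmE.
have -> : f @^-1` `]p, q]%classic = `]((p + b) / 2), ((q + b) / 2)]%classic.
  apply/seteqP; split => x; rewrite /= !in_itv/= /f => /andP[h1 h2]; apply/andP; split; lra.
rewrite lebesgue_measure_itv/= lebesgue_measure_itv/= !lte_fin.
rewrite ltr_pM2r ?invr_gt0// ltrD2r; case: ifPn => _; last by rewrite mule0.
by rewrite -!EFinD -EFinM; congr EFin; field.
Qed.

(** Take [a] in [A] close to its supremum and [b] in [B] close to its infimum. Then [C] contains the
    averages of [b] with the points of [A] up to [a], and of [a] with the points of [B] beyond [b].
    These two sets lie on either side of [(a + b) / 2], each has half the measure of its source, and
    the cuts cost at most [e / 2] each. *)
Lemma brunn_minkowski_midpoint (A B C : set R) (M : R) :
  measurable A -> measurable B -> measurable C ->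
  A !=set0 -> B !=set0 -> A `<=` [set x | `|x| <= M] -> B `<=` [set x | `|x| <= M] ->
  (forall x y, A x -> B y -> C ((x + y) / 2)) ->
  (mu A + mu B <= 2%:E * mu C)%E.
Proof.
move=> mA mB mC A0 B0 AM BM ABC.
have hsA : has_sup A.
  by split => //; exists M => x /AM /=; rewrite ler_norml => /andP[].
have hiB : has_inf B.
  by split => //; exists (- M) => x /BM /=; rewrite ler_norml => /andP[].
apply/lee_addgt0Pr => e e0.
have [a Aa ae] := sup_adherent (divr_gt0 e0 (ltr0n R 2)) hsA.
have [b Bb be] := inf_adherent (divr_gt0 e0 (ltr0n R 2)) hiB.
pose A1 := A `&` `]-oo, a]%classic; pose B1 := B `&` `]b, +oo[%classic.
have mA1 : measurable A1 by exact: measurableI.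
have mB1 : measurable B1 by exact: measurableI.
have leA : (mu A <= mu A1 + (e / 2)%:E)%E.
  have -> : A = A1 `|` (A `&` `]a, +oo[%classic).
    rewrite /A1 -setIUr -[LHS]setIT; congr (_ `&` _).
    apply/seteqP; split => x //= _; rewrite !in_itv/= andbT.
    by have [|] := leP x a; [left|right].
  apply: le_trans (measureU2 _ _ _) _ => //; first exact: measurableI.
  rewrite leeD2l//.
  apply: (@le_trans _ _ (mu `]a, (a + e / 2)]%classic)).
    apply: le_measure; rewrite ?inE//; first exact: measurableI.
    move=> x [Ax]; rewrite /= !in_itv/= andbT => ->/=.
    have xs : x <= sup A by apply: ub_le_sup => //; exact: hsA.2.
    lra.
  by rewrite lebesgue_measure_itv/= lte_fin; case: ifPn => _; rewrite ?lee_fin; lra.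
have leB : (mu B <= mu B1 + (e / 2)%:E)%E.
  have -> : B = B1 `|` (B `&` `]-oo, b]%classic).
    rewrite /B1 -setIUr -[LHS]setIT; congr (_ `&` _).
    apply/seteqP; split => x //= _; rewrite !in_itv/= andbT.
    by have [|] := leP x b; [right|left].
  apply: le_trans (measureU2 _ _ _) _ => //; first exact: measurableI.
  rewrite leeD2l//.
  apply: (@le_trans _ _ (mu `[(b - e / 2), b]%classic)).
    apply: le_measure; rewrite ?inE//; first exact: measurableI.
    move=> x [Bx]; rewrite /= !in_itv/= => ->; rewrite andbT.
    have xs : inf B <= x by apply: ge_inf => //; exact: hiB.2.
    lra.
  by rewrite lebesgue_measure_itv/= lte_fin; case: ifPn => _; rewrite ?lee_fin; lra.
have main : (mu A1 + mu B1 <= 2%:E * mu C)%E.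
  rewrite (lebesgue_measure_dilate b mA1) (lebesgue_measure_dilate a mB1).
  rewrite -ge0_muleDr//.
  set SA := [set x | A1 _]; set SB := [set x | B1 _].
  have mSA : measurable SA.
    by have := measurable_affine 2 (- b); move=> /(_ measurableT _ mA1); rewrite setTI.
  have mSB : measurable SB.
    by have := measurable_affine 2 (- a); move=> /(_ measurableT _ mB1); rewrite setTI.
  rewrite lee_pmul2l// -measureU//.
    apply: le_measure; rewrite ?inE//; first exact: measurableU.
    move=> x [[Ax _]|[Bx _]].
      by have := ABC _ _ Ax Bb; rewrite (_ : (_ + b) / 2 = x)//; field.
    by have := ABC _ _ Aa Bx; rewrite (_ : (a + _) / 2 = x)//; field.
  apply/seteqP; split => x // [[_ ]]; rewrite /= in_itv/= => h1 [_]; rewrite /= in_itv/= andbT => h2.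
  lra.
apply: (le_trans (leeD leA leB)).
rewrite addeACA -EFinD -splitr leeD2r//.
Qed.

Lemma layer_cake01 (U : R -> R) : measurable_fun [set: R] U -> (forall x, 0 <= U x) ->
  (\int[mu]_x (U x)%:E = \int[mu]_t mu [set x | (0 <= t < U x)%R])%E.
Proof.
move=> mU U0.
pose S : set (R * R) := [set z | 0 <= z.2 < U z.1].
have mS : measurable S.
  have -> : S = [set z | 0 <= z.2] `&` [set z | z.2 < U z.1].
    by apply/seteqP; split => z /=; [move/andP|move=> h; apply/andP].
  apply: measurableI; first exact: measurable_le_set.
  by apply: measurable_lt_set => //; exact: measurableT_comp.
have mf : measurable_fun [set: R * R] (fun z => (\1_S z : R)%:E).
  by apply/measurable_EFinP; exact: measurable_indic.
have := @fubini_tonelli _ _ _ _ R mu mu _ mf (fun z => _).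
move=> F.
transitivity (\int[mu]_x \int[mu]_y (\1_S (x, y) : R)%:E)%E.
  apply: eq_integral => x _.
  rewrite (_ : (fun y => _) = (fun y => (\1_(`[0, U x[%classic : set R) y)%:E)); last first.
    by apply/funext => y; rewrite !indicE; congr (_ %:R%:E); rewrite !inE /S/= in_itv/=; apply/idP/idP; rewrite ?inE /= ?in_itv.
  have -> : (\int[mu]_y (\1_(`[0%R, U x[%classic : set R) y)%:E = mu `[0%R, U x[%classic)%E.
    by rewrite integral_indic ?setIT//; exact: measurable_itv.
  rewrite lebesgue_measure_itv/= lte_fin.
  case: ifPn => [_|]; first by rewrite oppr0 adde0.
  by rewrite -leNgt => h; congr EFin; apply/eqP; rewrite eq_le h U0.
rewrite F; last by move=> z; rewrite lee_fin indicE.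
apply: eq_integral => t _.
rewrite (_ : (fun y => _) = (fun y => (\1_([set x | 0 <= t < U x] : set R) y)%:E)); last first.
  by apply/funext => y; rewrite !indicE; congr (_ %:R%:E); apply/idP/idP; rewrite ?inE.
rewrite (integral_indic _ measurableT) ?setIT//.
have := measurable_ysection t mS; congr (measurable _).
by apply/seteqP; split => x; rewrite /ysection/= ?inE.
Qed.

(** If [t < U x] and [t < V y] with [t > 0], then [t < H ((x + y) / 2)], so the superlevel sets at a
    common level satisfy the one-dimensional Brunn-Minkowski inequality, which is then integrated
    over levels. Normalising both suprema to 1 makes the sets of [U] and [V] nonempty for exactly
    the same positive levels. *)
Lemma prekopa_leindler_normalized (U V H : R -> R) :
  measurable_fun [set: R] U -> measurable_fun [set: R] V -> measurable_fun [set: R] H ->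
  (forall x, 0 <= U x <= 1) -> (forall x, 0 <= V x <= 1) -> (forall x, 0 <= H x) ->
  (forall t, t < 1 -> exists x, t < U x) -> (forall t, t < 1 -> exists x, t < V x) ->
  (forall t, 0 < t -> exists M, forall x, t < U x -> `|x| <= M) ->
  (forall t, 0 < t -> exists M, forall x, t < V x -> `|x| <= M) ->
  (forall x y, U x * V y <= H ((x + y) / 2) ^+ 2) ->
  (\int[mu]_x (U x)%:E + \int[mu]_x (V x)%:E <= 2%:E * \int[mu]_x (H x)%:E)%E.
Proof.
move=> mU mV mH U01 V01 H0 Us Vs Ub Vb UVH.
have U0 x : 0 <= U x by have /andP[] := U01 x.
have V0 x : 0 <= V x by have /andP[] := V01 x.
have mlev (F : R -> R) t : measurable_fun [set: R] F -> measurable [set x : R | 0 <= t < F x].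
  move=> mF; have [t0|t0] := leP 0 t; last by rewrite (_ : [set x | _] = set0)//; apply/seteqP; split.
  by apply: measurable_lt_set.
have mm (F : R -> R) : measurable_fun [set: R] F ->
    measurable_fun [set: R] (fun t => mu [set x | (0 <= t < F x)%R]).
  move=> mF.
  pose S : set (R * R) := [set z | 0 <= z.2 < F z.1].
  have mS : measurable S.
    have -> : S = [set z | 0 <= z.2] `&` [set z | z.2 < F z.1].
      by apply/seteqP; split => z /=; [move/andP|move=> h; apply/andP].
    apply: measurableI; first exact: measurable_le_set.
    by apply: measurable_lt_set => //; exact: measurableT_comp.
  have := measurable_fun_ysection mu mS.
  congr (measurable_fun _ _); apply/funext => t /=; congr (mu _).
  by apply/seteqP; split => x; rewrite /ysection/= ?inE.
rewrite !layer_cake01// -ge0_integralD//; [|exact: mm..].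
rewrite -ge0_integralZl//; last exact: mm.
apply: ae_ge0_le_integral => //.
- by move=> t _; rewrite adde_ge0.
- by apply: emeasurable_funD; exact: mm.
- by move=> t _; rewrite mule_ge0.
- by apply: measurable_funeM; exact: mm.
(* Level 0 is dropped as a null set: boundedness of the superlevel sets is available only at
   positive levels. *)
exists ([set 0] : set R); split; [exact: measurable_set1|exact: lebesgue_measure_set1|].
move=> t /= ht; apply: contrapT => /eqP t0; apply: ht => _.
have /orP[tlt0|tge0] : (t < 0) || (0 < t) by rewrite -neq_lt.
  have E (F : R -> R) : [set x : R | 0 <= t < F x] = set0.
    by apply/seteqP; split => x //= /andP[]; rewrite leNgt tlt0.
  by rewrite !E measure0 adde0 mule0.
have [t1|t1] := leP 1 t.
  have E (F : R -> R) : (forall x, 0 <= F x <= 1) -> [set x : R | 0 <= t < F x] = set0.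
    move=> F01; apply/seteqP; split => x //= /andP[_ tF].
    by have /andP[_ F1] := F01 x; have := lt_le_trans tF (le_trans F1 t1); rewrite ltxx.
  by rewrite (E U)// (E V)// measure0 adde0 mule_ge0.
have [M1 HM1] := Ub _ tge0; have [M2 HM2] := Vb _ tge0.
apply: (@brunn_minkowski_midpoint _ _ _ (Num.max M1 M2)); [exact: mlev..| | | | |].
- by have [x tx] := Us _ t1; exists x; rewrite /= ltW.
- by have [x tx] := Vs _ t1; exists x; rewrite /= ltW.
- by move=> x /= /andP[_ /HM1 h]; rewrite le_max h.
- by move=> x /= /andP[_ /HM2 h]; rewrite le_max h orbT.
move=> x y /= /andP[_ tU] /andP[_ tV]; rewrite (ltW tge0)/=.
have := UVH x y; have := H0 ((x + y) / 2); set h := H _ => h0 le.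
have tt : t * t < U x * V y by rewrite ltr_pM// ltW.
rewrite ltNge; apply/negP => ht.
by have := lt_le_trans tt le; rewrite expr2 ltNge ler_pM.
Qed.

(** The Prekopa-Leindler inequality with weights one half, relative to an abstract midpoint map, so
    that one predicate serves the real line and the sequence space. *)
Definition prekopa d (T : measurableType d) (mid : T -> T -> T) (P : probability T R) :=
  forall f g h : T -> R,
  measurable_fun [set: T] f -> measurable_fun [set: T] g -> measurable_fun [set: T] h ->
  (forall x, 0 <= f x <= 1) -> (forall x, 0 <= g x <= 1) -> (forall x, 0 <= h x <= 1) ->
  (forall x y, f x * g y <= h (mid x y) ^+ 2) ->
  (\int[P]_x f x)%R * (\int[P]_x g x)%R <= (\int[P]_x h x)%R ^+ 2.

Lemma phi_midpoint x y : phi x * phi y <= phi ((x + y) / 2) ^+ 2.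
Proof.
rewrite (phiE x) (phiE y) (phiE ((x + y) / 2)) exprMn mulrACA -expr2 ler_wpM2l ?sqr_ge0//.
rewrite -expRD -expRM_natl ler_expR.
by have := sqr_ge0 (x - y); nra.
Qed.

Lemma phi_level_bounded t : 0 < t -> exists M, forall x, t < phi x -> `|x| <= M.
Proof.
move=> t0; exists (1 + 2 * phi 0 / t) => x; rewrite phiE mulNr expRN => h.
have e1 := expR_ge1Dx (x ^+ 2 / 2); set e := expR _ in h e1.
have e0 : 0 < e by exact: expR_gt0.
have h1 : t * e < phi 0 by rewrite -ltr_pdivlMr.
have h2 : t * (1 + x ^+ 2 / 2) < phi 0 by apply: le_lt_trans h1; rewrite ler_pM2l.
rewrite -lerBlDl ler_pdivlMr//.
rewrite -[x ^+ 2]real_normK ?num_real// in h2.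
move: h2; set y := `|x|; set p := phi 0.
have := sqr_ge0 (y - 1); nra.
Qed.

(** Log-concavity of the density, [phi_midpoint], carries the hypothesis from [f], [g], [h] to their
    products with [phi]. After division by the suprema the normalised inequality applies; its
    additive conclusion is stronger than the multiplicative one, by the inequality of arithmetic and
    geometric means. *)
Lemma prekopa_normal : @prekopa _ (measurableTypeR R) (fun x y : R => (x + y) / 2) gam.
Proof.
move=> f g h mf mg mh f01 g01 h01 fgh.
have b01 (u : R -> R) : measurable_fun [set: R] u -> (forall x, 0 <= u x <= 1) -> bmeas u by exact: bmeas01.
rewrite !bint_normal_prob; [|exact: b01..].
pose F x := f x * phi x; pose G x := g x * phi x; pose H x := h x * phi x.
have phi0 x : 0 <= phi x by exact: normal_pdf_ge0.
have mphi : measurable_fun [set: R] phi by exact: measurable_normal_pdf.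
have F0 x : 0 <= F x by rewrite mulr_ge0//; have /andP[] := f01 x.
have G0 x : 0 <= G x by rewrite mulr_ge0//; have /andP[] := g01 x.
have H0 x : 0 <= H x by rewrite mulr_ge0//; have /andP[] := h01 x.
have phib x : phi x <= phi 0.
  by rewrite [phi x]phiE ler_piMr// -expR0 ler_expR mulNr oppr_le0 divr_ge0 ?sqr_ge0.
have le1 (u : R -> R) x : (forall x, 0 <= u x <= 1) -> u x * phi x <= phi x.
  by move=> u01; rewrite ler_piMl//; have /andP[] := u01 x.
have iI (u : R -> R) : measurable_fun [set: R] u -> (forall x, 0 <= u x <= 1) ->
    mu.-integrable [set: R] (fun x => (u x * phi x)%:E).
  move=> mu_ u01; apply: (@integrable_phiM _ _ 1) => // x.
  by have /andP[h0 h1] := u01 x; rewrite ger0_norm.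
have FGH x y : F x * G y <= H ((x + y) / 2) ^+ 2.
  rewrite /F /G /H mulrACA exprMn ler_pM ?mulr_ge0//; last exact: phi_midpoint.
  - by have /andP[] := f01 x.
  - by have /andP[] := g01 y.
have hsF (u : R -> R) : (forall x, 0 <= u x <= 1) -> has_sup (range (fun x => u x * phi x)).
  move=> u01; split; first by exists (u 0 * phi 0), 0.
  by exists (phi 0) => _ [x _ <-]; exact: le_trans (le1 _ _ u01) (phib x).
have zero (u : R -> R) : (forall x, 0 <= u x <= 1) -> sup (range (fun x => u x * phi x)) <= 0 ->
    (\int[mu]_x (u x * phi x))%R = 0.
  move=> u01 s0; have E : (fun x => u x * phi x) = (fun=> 0).
    apply/funext => x; apply/eqP; rewrite eq_le; apply/andP; split.
      by apply: le_trans s0; apply: ub_le_sup; [exact: (hsF u u01).2|exists x].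
    by rewrite mulr_ge0//; have /andP[] := u01 x.
  by rewrite E /Rintegral integral0.
set a := sup (range F); set b := sup (range G).
have [a0|a0] := leP a 0; first by rewrite (zero f)// mul0r sqr_ge0.
have [b0|b0] := leP b 0; first by rewrite (zero g)// mulr0 sqr_ge0.
(* The geometric mean is the scale for [H] that preserves the hypothesis when [F] and [G] are
   divided by [a] and [b]. *)
pose c := Num.sqrt (a * b).
have c0 : 0 < c by rewrite sqrtr_gt0 mulr_gt0.
have c2 : c ^+ 2 = a * b by rewrite sqr_sqrtr// ltW// mulr_gt0.
have sup_lt (u : R -> R) s : (forall x, 0 <= u x <= 1) -> s = sup (range (fun x => u x * phi x)) -> 0 < s ->
    [/\ (forall x, 0 <= (u x * phi x) / s <= 1), (forall t, t < 1 -> exists x, t < (u x * phi x) / s) &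
        (forall t, 0 < t -> exists M, forall x, t < (u x * phi x) / s -> `|x| <= M)].
  move=> u01 sE s0; split.
  - move=> x; rewrite divr_ge0 ?(ltW s0) ?mulr_ge0//=; last by have /andP[] := u01 x.
    by rewrite ler_pdivrMr// mul1r sE; apply: ub_le_sup; [exact: (hsF u u01).2|exists x].
  - move=> t t1; have e0 : 0 < s * (1 - t) by rewrite mulr_gt0// subr_gt0.
    have [_ [x _ <-] hx] := sup_adherent e0 (hsF u u01).
    by exists x; rewrite ltr_pdivlMr//; move: hx; rewrite -sE; lra.
  - move=> t t0; have [M HM] := phi_level_bounded (mulr_gt0 t0 s0).
    by exists M => x; rewrite ltr_pdivlMr// => hx; apply: HM; exact: lt_le_trans hx (le1 _ _ u01).
have [U1 U2 U3] := sup_lt f a f01 erefl a0.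
have [V1 V2 V3] := sup_lt g b g01 erefl b0.
have mscale_ (u : R -> R) s : measurable_fun [set: R] u -> measurable_fun [set: R] (fun x => u x * phi x / s).
  by move=> mu_; apply: measurable_funM => //; exact: measurable_funM.
have := @prekopa_leindler_normalized _ _ (fun x => H x / c) (mscale_ f a mf) (mscale_ g b mg) (mscale_ h c mh) U1 V1.
move=> /(_ (fun x => divr_ge0 (H0 x) (ltW c0)) U2 V2 U3 V3).
have K x y : F x / a * (G y / b) <= (H ((x + y) / 2) / c) ^+ 2.
  rewrite mulrACA -invfM exprMn exprVn c2 ler_wpM2r// invr_ge0 ltW// mulr_gt0//.
move=> /(_ K).
have IE (u : R -> R) s : measurable_fun [set: R] u -> (forall x, 0 <= u x <= 1) ->
    (\int[mu]_x (u x * phi x / s)%:E = ((\int[mu]_x (u x * phi x))%R / s)%:E)%E.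
  move=> mu_ u01; under eq_integral do rewrite EFinM.
  rewrite integralZr//; last exact: iI.
  by rewrite /Rintegral EFinM fineK//; apply: integrable_fin_num => //; exact: iI.
rewrite !IE// -EFinD -EFinM lee_fin.
set IF := (\int[mu]_x (f x * phi x))%R; set IG := (\int[mu]_x (g x * phi x))%R.
set IH := (\int[mu]_x (h x * phi x))%R => le.
have IF0 : 0 <= IF by apply: Rintegral_ge0 => x _; exact: F0.
have IG0 : 0 <= IG by apply: Rintegral_ge0 => x _; exact: G0.
have IH0 : 0 <= IH by apply: Rintegral_ge0 => x _; exact: H0.
have x0 : 0 <= IF / a by rewrite divr_ge0// ltW.
have y0 : 0 <= IG / b by rewrite divr_ge0// ltW.
have z0 : 0 <= IH / c by rewrite divr_ge0// ltW.
have : IF / a * (IG / b) <= (IH / c) ^+ 2.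
  move: x0 y0 z0 le; set X := IF / a; set Y := IG / b; set Z := IH / c => x0 y0 z0 le.
  have := sqr_ge0 (X - Y); nra.
by rewrite mulrACA -invfM exprMn exprVn c2 ler_pM2r// invr_gt0 mulr_gt0.
Qed.

End brunn_minkowski_1d.

(** * Real sequences with the product sigma-algebra *)

Section sequence_space.
Variable R : realType.

Definition seqcyl : set (set (nat -> R)) :=
  [set C | exists (i : nat) (B : set R), measurable B /\ C = (fun f => f i) @^-1` B].
(** One space for all dimensions: a vector of length [n] is padded with zeros, so an induction on
    the dimension never changes the type. *)
Definition seqspace := g_sigma_algebraType seqcyl.

Lemma measurable_coord (i : nat) : measurable_fun [set: seqspace] (fun v : seqspace => v i).
Proof.
move=> _ B mB; rewrite setTI; apply: sub_sigma_algebra.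
by exists i, B.
Qed.

Lemma measurable_to_seq d (T : measurableType d) (F : T -> seqspace) :
  (forall i, measurable_fun [set: T] (fun w => F w i)) -> measurable_fun [set: T] F.
Proof.
move=> mF; apply: (@measurability _ _ T seqspace setT F seqcyl erefl).
move=> _ [_ [i [B [mB ->]]] <-]; exact: (mF i measurableT B mB).
Qed.

Definition upd (v : seqspace) (n : nat) (z : R) : seqspace :=
  fun j => if j == n then z else v j.

Definition midseq (u v : seqspace) : seqspace := fun j => (u j + v j) / 2.

Lemma measurable_upd d (T : measurableType d) (v : T -> seqspace) n (z : T -> R) :
  measurable_fun [set: T] v -> measurable_fun [set: T] z ->
  measurable_fun [set: T] (fun w => upd (v w) n (z w)).
Proof.
move=> mv mz; apply: measurable_to_seq => i; rewrite /upd; case: eqP => // _.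
exact: measurableT_comp (measurable_coord i) mv.
Qed.

Lemma midseq_upd u v n x y : midseq (upd u n x) (upd v n y) = upd (midseq u v) n ((x + y) / 2).
Proof. by apply/funext => j; rewrite /midseq /upd; case: eqP. Qed.

(** The sides of the boxes used as a pi-system. [setT] frees a coordinate; compact intervals are the
    sets reached by [charfun_transfer]. *)
Definition interval_or_full (B : set R) := B = setT \/ exists a b, B = `[a, b]%classic.

End sequence_space.

(** * Vectors with a standard Gaussian characteristic function *)

Section gaussian_vectors.
Context d (T : measurableType d) (R : realType) (Q : probability T R).
Local Notation gam := (normal_prob (0:R) 1).
Variables (xi : nat -> T -> R) (N : nat).
Hypothesis mxi : forall j, measurable_fun [set: T] (xi j).
Hypothesis charE : forall (l : nat -> R) (del : R),
  (\int[Q]_w cos (\sum_(0 <= j < N) l j * xi j w + del) =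
   cos del * expR (- (\sum_(0 <= j < N) l j ^+ 2) / 2))%R.

Let mlin (l : nat -> R) n : measurable_fun [set: T] (fun w => \sum_(n <= j < N) l j * xi j w).
Proof. by apply: measurable_sum => j; exact: measurable_funM. Qed.

Let ind (B : nat -> set R) n w : R := \prod_(0 <= j < n) \1_(B j) (xi j w).

Let mset (B : set R) : interval_or_full B -> measurable B.
Proof. by move=> [->|[a [b ->]]]; [exact: measurableT|exact: measurable_itv]. Qed.

Let bind B n : (forall j, interval_or_full (B j)) -> bmeas (ind B n).
Proof.
move=> HB; apply: bmeas_prod => j.
exact: (bmeas_comp (mxi j) (bmeas_indic R (mset (HB j)))).
Qed.

Let upl (l : nat -> R) n (z s : R) : nat -> R := fun j => if j == n then z else s * l j.

Let sum_upl l n z s (c : nat -> R -> R) : (n < N)%N ->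
  \sum_(n <= j < N) c j (upl l n z s j) = c n z + \sum_(n.+1 <= j < N) c j (s * l j).
Proof.
move=> nN; rewrite big_ltn// {1}/upl eqxx; congr (_ + _).
apply: eq_big_nat => j /andP[nj _]; rewrite /upl; case: eqP => // jn.
by rewrite jn ltnn in nj.
Qed.

(** The induction on [n] moves one coordinate at a time from the cosine into the indicators.
    Weighted by everything else, [xi n] has the same cosine and sine transforms as a standard normal
    with the constant weight [C], so [charfun_transfer] replaces its trigonometric factor by the
    indicator of [B n]. *)
Let box_trig (B : nat -> set R) n l del : (forall j, interval_or_full (B j)) -> (n <= N)%N ->
  (\int[Q]_w (ind B n w * cos (\sum_(n <= j < N) l j * xi j w + del)) =
   cos del * (\prod_(0 <= j < n) fine (gam (B j))) * expR (- (\sum_(n <= j < N) l j ^+ 2) / 2))%R.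
Proof.
move=> HB; elim: n l del => [|n IH] l del nN.
  rewrite big_nil mulr1 -charE; apply: eq_Rintegral => w _.
  by rewrite /ind big_nil mul1r.
have {}IH l' del' := IH l' del' (ltnW nN).
set E := expR (- (\sum_(n.+1 <= j < N) l j ^+ 2) / 2).
set PP := \prod_(0 <= j < n) fine (gam (B j)).
(* Only [s = 1] and [s = -1] are used: they give the sum and the difference of angles whose
   combination is the product of a function of [xi n] with the weight [Z]. *)
have key z s del' : s ^+ 2 = 1 ->
    (\int[Q]_w (ind B n w * cos (z * xi n w + s * (\sum_(n.+1 <= j < N) l j * xi j w) + del')) =
     cos del' * PP * (expR (- z ^+ 2 / 2) * E))%R.
  move=> s2; have := IH (upl l n z s) del'.
  rewrite (sum_upl _ _ _ (fun _ x => x ^+ 2))//.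
  under eq_Rintegral do rewrite (sum_upl _ _ _ (fun j x => x * xi j _))//.
  rewrite /E -expRD => IHn.
  transitivity (cos del' * PP * expR (- (z ^+ 2 + \sum_(n.+1 <= j < N) (s * l j) ^+ 2) / 2)).
    rewrite -IHn; apply: eq_Rintegral => w _; rewrite big_distrr/=.
    by congr (_ * cos (_ + _ + _)); apply: eq_bigr => j _; rewrite mulrA.
  congr (_ * expR _); under eq_bigr do rewrite exprMn s2 mul1r.
  by rewrite opprD mulrDl.
have bB := bind n HB.
pose S w := \sum_(n.+1 <= j < N) l j * xi j w + del.
have mS : measurable_fun [set: T] S by apply: measurable_funD => //; exact: mlin.
pose Z w := ind B n w * cos (S w).
have bZ : bmeas Z by apply: bmeasM => //; exact: bmeas_cos.
pose C := cos del * PP * E.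
have zc z : (\int[Q]_w (cos (z * xi n w) * Z w) = \int[gam]_x (cos (z * x) * C))%R.
  rewrite bintZr; last by apply: bmeas_cos; exact: measurable_funM.
  rewrite cos_normal.
  transitivity (\int[Q]_w (2^-1 * (ind B n w * cos (z * xi n w + 1 * (\sum_(n.+1 <= j < N) l j * xi j w) + del)
     + ind B n w * cos (z * xi n w + (-1) * (\sum_(n.+1 <= j < N) l j * xi j w) + - del))))%R.
    apply: eq_Rintegral => w _; rewrite /Z /S mul1r mulN1r.
    set X := z * xi n w; set Y := \sum_(_ <= _ < _) _.
    have -> : X + Y + del = X + (Y + del) by ring.
    have -> : X - Y - del = X - (Y + del) by ring.
    by rewrite [cos (X + _)]cosD cosB; set a := ind _ _ _; field.
  have bb s del' : bmeas (fun w => ind B n w * cos (z * xi n w + s * (\sum_(n.+1 <= j < N) l j * xi j w) + del')).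
    apply: bmeasM => //; apply: bmeas_cos; apply: measurable_funD => //.
    by apply: measurable_funD; apply: measurable_funM => //; exact: mlin.
  rewrite bintZ; last exact: bmeasD.
  by rewrite bintD// !key ?expr1n ?sqrrN ?expr1n// cosN /C; field.
have zs z : (\int[Q]_w (sin (z * xi n w) * Z w) = \int[gam]_x (sin (z * x) * C))%R.
  rewrite bintZr; last by apply: bmeas_sin; exact: measurable_funM.
  rewrite sin_normal mul0r.
  transitivity (\int[Q]_w (2^-1 * (ind B n w * cos (z * xi n w + 1 * (\sum_(n.+1 <= j < N) l j * xi j w) + (del - pi / 2))
     + ind B n w * cos (z * xi n w + (-1) * (\sum_(n.+1 <= j < N) l j * xi j w) + (- del - pi / 2)))))%R.
    apply: eq_Rintegral => w _; rewrite /Z /S mul1r mulN1r.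
    set X := z * xi n w; set Y := \sum_(_ <= _ < _) _.
    have -> : X + Y + (del - pi / 2) = (X + (Y + del)) - pi / 2 by ring.
    have -> : X - Y + (- del - pi / 2) = (X - (Y + del)) - pi / 2 by ring.
    by rewrite !cosBpihalf [sin (X + _)]sinD sinB; set a := ind _ _ _; field.
  have bb s del' : bmeas (fun w => ind B n w * cos (z * xi n w + s * (\sum_(n.+1 <= j < N) l j * xi j w) + del')).
    apply: bmeasM => //; apply: bmeas_cos; apply: measurable_funD => //.
    by apply: measurable_funD; apply: measurable_funM => //; exact: mlin.
  rewrite bintZ; last exact: bmeasD.
  by rewrite bintD// !key ?expr1n ?sqrrN ?expr1n// !cosBpihalf sinN; ring.
rewrite big_nat_recr//= -/PP.
case: (HB n) => [BT|[a [b Bab]]].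
  have := key 0 1 del (expr1n _ _); rewrite BT probability_setT/= mulr1.
  rewrite expr0n/= oppr0 mul0r expR0 mul1r => <-.
  apply: eq_Rintegral => w _; rewrite mul0r add0r mul1r /ind big_nat_recr//= BT indicT mulr1//.
have [ab|ba] := leP a b; last first.
  have B0 : B n = set0 by rewrite Bab set_itv_ge// bnd_simp -ltNge.
  rewrite B0 measure0 /= !mulr0 mul0r.
  rewrite -[RHS](bint_cst Q 0); apply: eq_Rintegral => w _.
  by rewrite /ind big_nat_recr//= B0 indic0 mulr0 mul0r.
have := charfun_transfer (mxi n) (@measurable_id _ (measurableTypeR R) setT) bZ (bmeas_cst _ C) zc zs ab.
rewrite -Bab bintZr; last exact: (bmeas_indic _ (mset (HB n))).
rewrite bint_indic; last exact: mset.
move=> H; transitivity (fine (gam (B n)) * C).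
  rewrite -H; apply: eq_Rintegral => w _; rewrite /Z /ind big_nat_recr//=.
  by rewrite -/(S w); ring.
by rewrite /C; ring.
Qed.

Let V n (w : T) : seqspace R := fun j => if (j < n)%N then xi j w else 0.

Lemma measurable_gauss_trunc n : measurable_fun [set: T] (V n).
Proof.
apply: measurable_to_seq => i; rewrite /V; case: (i < n)%N => //.
Qed.

Let box (B : nat -> set R) : set (seqspace R) := [set v | forall j, B j (v j)].

(** The coordinates of [V n] from [n] on are 0, hence the condition on [B]. The rest is [box_trig]
    at zero frequencies. *)
Let box_prob B n : (forall j, interval_or_full (B j)) -> (n <= N)%N ->
  (forall j, (n <= j)%N -> B j 0) ->
  fine (Q (V n @^-1` box B)) = \prod_(0 <= j < n) fine (gam (B j)).
Proof.
move=> HB nN B0.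
have mb : measurable (V n @^-1` box B).
  rewrite (_ : _ @^-1` _ = \bigcap_j ((fun w => V n w j) @^-1` B j)); last first.
    by apply/seteqP; split => w h j; [move=> _; exact: h|exact: h].
  apply: bigcapT_measurable => j.
  have := measurableT_comp (measurable_coord j) (measurable_gauss_trunc n).
  by move=> /(_ measurableT (B j) (mset (HB j))); rewrite setTI.
rewrite -bint_indic//.
have := box_trig (fun=> 0) 0 HB nN.
have S1 : \sum_(n <= j < N) (0 : R) ^+ 2 = 0 by rewrite big1// => j _; rewrite expr0n.
rewrite cos0 mul1r S1 oppr0 mul0r expR0 mulr1 => <-.
apply: eq_Rintegral => w _.
rewrite big1 ?addr0 ?cos0 ?mulr1; last by move=> j _; rewrite mul0r.
rewrite indicE /ind; case: (boolP (w \in _)) => h.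
  rewrite inE /box/= in h; apply/esym; rewrite big_nat big1// => j /andP[_ jn].
  by have := h j; rewrite /V jn indicE => hj; rewrite mem_set.
have [j nBj] : exists j, ~ B j (V n w j).
  apply: contrapT => nex; move/negP: h; apply; rewrite inE => j.
  by apply: contrapT => nB; apply: nex; exists j.
have jn : (j < n)%N by rewrite ltnNge; apply/negP => nj; apply: nBj; rewrite /V ltnNge nj; exact: B0.
rewrite /V jn in nBj.
rewrite (bigD1_seq j) ?mem_index_iota ?iota_uniq//=.
by rewrite indicE memNset// mul0r.
Qed.

Let G : set (set (seqspace R)) := [set S | exists2 B, (forall j, interval_or_full (B j)) & S = box B].

Let measurable_G : G `<=` measurable.
Proof.
move=> _ [B HB ->].
rewrite (_ : box B = \bigcap_j ((fun v : seqspace R => v j) @^-1` B j)); last first.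
  by apply/seteqP; split => w h j; [move=> _; exact: h|exact: h].
apply: bigcapT_measurable => j.
by have := measurable_coord j measurableT (mset (HB j)); rewrite setTI.
Qed.

Let seqcyl_G : <<s @seqcyl R >> `<=` <<s G >>.
Proof.
apply: smallest_sub; first exact: smallest_sigma_algebra.
move=> _ [i [B [mB ->]]].
suff : measurable_fun [set: g_sigma_algebraType G] (fun v : g_sigma_algebraType G => v i).
  by move=> /(_ measurableT _ mB); rewrite setTI.
apply: (measurability _ (RGenCInfty.measurableE R)).
move=> _ [_ [a ->] <-]; rewrite setTI.
rewrite (_ : _ @^-1` _ = \bigcup_k [set v | (`[a, (a + k%:R)]%classic : set R) (v i)]); last first.
  apply/seteqP; split => v /=; rewrite ?in_itv/= ?andbT.
    move=> av; exists (Num.truncn (v i - a)).+1 => //=; rewrite in_itv/= av/=.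
    by rewrite -lerBlDl ltW// truncnS_gt.
  by move=> [k _]; rewrite /= in_itv/= => /andP[].
apply: bigcupT_measurable => k; apply: sub_sigma_algebra.
exists (fun j => if j == i then `[a, (a + k%:R)]%classic else setT).
  by move=> j; case: eqP => _; [right; exists a, (a + k%:R)|left].
apply/seteqP; split => v /=.
  by move=> h j; case: eqP => // ->.
by move=> /(_ i); rewrite eqxx.
Qed.

Let setI_G : setI_closed G.
Proof.
move=> _ _ [B HB ->] [C HC ->]; exists (fun j => B j `&` C j); last first.
  by apply/seteqP; split => v /=; [move=> [h1 h2] j|move=> h; split=> j; have [] := h j].
move=> j; case: (HB j) => [->|[a [b Bab]]]; first by rewrite setTI.
case: (HC j) => [->|[c [e Cce]]]; first by rewrite setIT; exact: HB.
right; exists (Num.max a c), (Num.min b e); rewrite Bab Cce.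
by apply/seteqP; split => x /=; rewrite !in_itv/= ge_max le_min;
  [move=> [/andP[-> ->] /andP[-> ->]]|move=> /andP[/andP[-> ->] /andP[-> ->]]].
Qed.

(** Independence of coordinate [n] from the earlier ones, as a disintegration: the law of [V n.+1]
    and the image of [Q \x gam] under [upd] agree on boxes, a pi-system that generates the
    sigma-algebra. *)
Lemma gauss_trunc_succ n (f : seqspace R -> R) : (n < N)%N -> bmeas f ->
  (\int[Q]_w f (V n.+1 w) = \int[Q]_w \int[gam]_z f (upd (V n w) n z))%R.
Proof.
move=> nN bf.
have mup : measurable_fun [set: T * measurableTypeR R] (fun p => upd (V n p.1) n p.2).
  by apply: measurable_upd => //; exact: measurableT_comp (measurable_gauss_trunc n) _.
pose m1 := law_of (measurable_gauss_trunc n.+1) Q.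
pose m2 := law_of mup (Q \x gam)%E.
have eqm A : measurable A -> m1 A = m2 A.
  move=> mA; apply: (g_sigma_algebra_measure_unique G measurable_G (fun=> setT)) => //.
  - move=> _; exists (fun=> setT); first by move=> j; left.
    by apply/seteqP; split.
  - by rewrite bigcup_const//; exists 0%N.
  - move=> _ [B HB ->].
    (* Freeing side [n] splits the preimage of the box into a rectangle. *)
    pose B' j := if j == n then setT else B j.
    have HB' j : interval_or_full (B' j) by rewrite /B'; case: eqP => // _; left.
    have E : (fun p : T * R => upd (V n p.1) n p.2) @^-1` box B = (V n @^-1` box B') `*` B n.
      apply/seteqP; split => [[w z] h|[w z] [h1 h2] j]; rewrite /=.
        split => /=; last by have := h n; rewrite /upd/= eqxx.
        by move=> j; have := h j; rewrite /upd /B'/=; case: eqP.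
      by rewrite /upd/=; case: eqP => [->//|jn]; have := h1 j; rewrite /B'; case: eqP.
    have mV (m : nat) C : (forall j, interval_or_full (C j)) -> measurable (V m @^-1` box C).
      move=> HC; have mC : measurable (box C) by apply: measurable_G; exists C.
      by have := measurable_gauss_trunc m measurableT mC; rewrite setTI.
    change (Q (V n.+1 @^-1` box B) =
      (Q \x gam)%E ((fun p : T * R => upd (V n p.1) n p.2) @^-1` box B)); rewrite E.
    rewrite product_measure1E//; [|exact: mV|exact: mset].
    (* If a later side misses 0, both preimages are empty, because the coordinates beyond [n] are
       0. *)
    have [B0|nB0] := pselect (forall j, (n.+1 <= j)%N -> B j 0).
      have B'0 j : (n <= j)%N -> B' j 0.
        by rewrite leq_eqVlt /B' eq_sym; case: eqP => //= _ /B0.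
      have f1 : Q (V n @^-1` box B') \is a fin_num by apply: fin_num_measure; exact: mV.
      have f2 : gam (B n) \is a fin_num by apply: (fin_num_measure gam); exact: mset.
      have f3 : Q (V n.+1 @^-1` box B) \is a fin_num by apply: fin_num_measure; exact: mV.
      transitivity ((fine (Q (V n @^-1` box B')))%:E * (fine (gam (B n)))%:E)%E; last first.
        by rewrite (fineK f1) (fineK f2).
      rewrite -EFinM; transitivity ((fine (Q (V n.+1 @^-1` box B)))%:E); first by rewrite (fineK f3).
      congr EFin.
      rewrite box_prob// (box_prob HB' (ltnW nN) B'0) big_nat_recr//=; congr (_ * _).
      by apply: eq_big_nat => j /andP[_ jn]; rewrite /B' ltn_eqF.
    have [j [nj nBj]] : exists j, (n.+1 <= j)%N /\ ~ B j 0.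
      apply: contrapT => nex; apply: nB0 => j nj; apply: contrapT => nB; apply: nex.
      by exists j.
    have -> : V n.+1 @^-1` box B = set0.
      by apply/seteqP; split => w // /(_ j); rewrite /V/= ltnNge nj.
    have -> : V n @^-1` box B' = set0.
      apply/seteqP; split => w // /(_ j); rewrite /V/= ltnNge (ltnW nj)/= /B' gtn_eqF//.
    by rewrite !measure0 mul0e.
  - by move=> _; rewrite -ge0_fin_numE// fin_num_measure.
  - exact: seqcyl_G.
rewrite -(bint_law_of (measurable_gauss_trunc n.+1))//.
transitivity (\int[m2]_v f v)%R.
  by rewrite /Rintegral; congr fine; apply: eq_measure_integral => A mA _; exact: eqm.
rewrite /m2 bint_law_of// (@bint_prod _ _ _ _ _ Q gam (fun p => f (upd (V n p.1) n p.2)))//.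
exact: bmeas_comp mup bf.
Qed.

(** Tensorisation: the one-dimensional inequality along coordinate [n] says that the partial
    integrals [I f], [I g], [I h] satisfy the hypothesis again, and the induction hypothesis
    integrates out the remaining coordinates. *)
Lemma prekopa_gauss n : (n <= N)%N ->
  prekopa (@midseq R) (law_of (measurable_gauss_trunc n) Q).
Proof.
elim: n => [|n IH] nN f g h mf mg mh f01 g01 h01 fgh.
  have b01 (u : seqspace R -> R) : measurable_fun [set: seqspace R] u -> (forall x, 0 <= u x <= 1) -> bmeas u by exact: bmeas01.
  rewrite !bint_law_of; [|exact: b01..].
  have V0 w : V 0 w = (fun=> 0) by apply/funext.
  have E (u : seqspace R -> R) : (\int[Q]_x u (V 0 x) = u (fun=> 0%R))%R.
    by under eq_Rintegral do rewrite V0; exact: bint_cst.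
  rewrite !E; have := fgh (fun=> 0) (fun=> 0).
  by rewrite (_ : midseq _ _ = (fun=> 0))//; apply/funext => j; rewrite /midseq addr0 mul0r.
have b01 (u : seqspace R -> R) : measurable_fun [set: seqspace R] u -> (forall x, 0 <= u x <= 1) -> bmeas u by exact: bmeas01.
have mupd v : measurable_fun [set: measurableTypeR R] (fun z => upd v n z).
  by apply: measurable_upd; [exact: measurable_cst|exact: measurable_id].
pose I (u : seqspace R -> R) (v : seqspace R) : R := (\int[gam]_z u (upd v n z))%R.
have bI (u : seqspace R -> R) : measurable_fun [set: seqspace R] u -> (forall x, 0 <= u x <= 1) ->
    measurable_fun [set: seqspace R] (I u) /\ forall v, 0 <= I u v <= 1.
  move=> mu_ u01; split.
    have mup : measurable_fun [set: seqspace R * measurableTypeR R] (fun p => upd p.1 n p.2).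
      exact: measurable_upd.
    exact: (@bmeas_bint _ _ _ _ _ (law_of (measurable_gauss_trunc n) Q) gam _ (bmeas_comp mup (b01 _ mu_ u01))).1.
  move=> v; have bu := bmeas_comp (mupd v) (b01 _ mu_ u01).
  rewrite bint_ge0; last by move=> z; have /andP[] := u01 (upd v n z).
  rewrite -(bint_cst gam 1); apply: bint_le => //; first exact: bmeas_cst.
  by move=> z; have /andP[] := u01 (upd v n z).
have [mIf If01] := bI f mf f01; have [mIg Ig01] := bI g mg g01; have [mIh Ih01] := bI h mh h01.
have := IH (ltnW nN) (I f) (I g) (I h) mIf mIg mIh If01 Ig01 Ih01.
rewrite !bint_law_of; [|exact: b01..].
rewrite !gauss_trunc_succ; [|by []|exact: b01|by []|exact: b01|by []|exact: b01].
apply=> u v; apply: prekopa_normal => //.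
- exact: measurableT_comp mf (mupd u).
- exact: measurableT_comp mg (mupd v).
- exact: measurableT_comp mh (mupd _).
- by move=> x y; rewrite -midseq_upd.
Qed.

End gaussian_vectors.

Lemma prekopa_sets d (T : measurableType d) (R : realType) (mid : T -> T -> T) (P : probability T R) :
  prekopa mid P -> forall A B C : set T, measurable A -> measurable B -> measurable C ->
  (forall x y, A x -> B y -> C (mid x y)) -> fine (P A) * fine (P B) <= fine (P C) ^+ 2.
Proof.
move=> PL A B C mA mB mC ABC.
have i01 (S : set T) x : 0 <= (\1_S x : R) <= 1 by rewrite indicE; case: (_ \in _); rewrite lexx ler01.
have mI (S : set T) : measurable S -> measurable_fun [set: T] (\1_S : T -> R) by move=> mS; exact: measurable_indic.
have := PL _ _ _ (mI _ mA) (mI _ mB) (mI _ mC) (i01 A) (i01 B) (i01 C).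
rewrite !bint_indic//; apply=> x y; rewrite !indicE.
case: (boolP (x \in A)) => xA; last by rewrite mul0r sqr_ge0.
case: (boolP (y \in B)) => yB; last by rewrite mulr0 sqr_ge0.
rewrite mem_set ?mul1r ?expr1n//; apply: ABC; exact: set_mem.
Qed.

(** * Log-concavity of resampled lines *)

Section brownian_increments.
Context d' (Omega' : measurableType d') (R : realType).
Variables (Q : probability Omega' R) (W : nat -> R -> Omega' -> R).
Hypothesis HW : std_BM_family Q W.

Let mW i t : measurable_fun [set: Omega'] (W i t). Proof. exact: HW.1. Qed.

Lemma bm_char (s : seq (nat * R * R)) (del : R) :
  (forall p, p \in s -> 0 <= p.1.2 <= 1) ->
  (\int[Q]_w cos (\sum_(p <- s) p.2 * W p.1.1 p.1.2 w + del) =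
   cos del * expR (- (\sum_(p <- s) \sum_(q <- s)
     p.2 * q.2 * (if p.1.1 == q.1.1 then Num.min p.1.2 q.1.2 else 0)) / 2))%R.
Proof.
move=> s01; have [_ [_ H]] := HW; have /= [Hc Hs] := H s s01.
have mY : measurable_fun [set: Omega'] (fun w => \sum_(p <- s) p.2 * W p.1.1 p.1.2 w).
  by apply: measurable_sum => p; exact: measurable_funM.
have bc := bmeas_cos mY; have bs := bmeas_sin mY.
under eq_Rintegral do rewrite cosD mulrC [sin _ * _]mulrC.
rewrite bintB ?bintZ//; [|exact: bmeasZ..].
by rewrite /Rintegral Hc Hs mulr0 subr0 mulNr.
Qed.

(** At time 0 the variance vanishes, so [W i 0] has the characteristic function of the constant 0;
    [charfun_transfer] is applied to the degenerate interval [[0, 0]]. *)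
Lemma bm_zero i : fine (Q [set w | W i 0 w = 0]) = 1.
Proof.
have c0 l del : (\int[Q]_w cos (l * W i 0 w + del) = cos del)%R.
  have := @bm_char [:: (i, 0, l)] del; rewrite /= !big_cons !big_nil/= eqxx minxx mulr0 !addr0 oppr0 mul0r expR0 mulr1.
  move=> <-; last by move=> p; rewrite inE => /eqP -> /=; rewrite lexx ler01.
  by apply: eq_Rintegral => w _; rewrite big_cons big_nil addr0.
have b1 := @bmeas_cst _ Omega' R 1.
have := @charfun_transfer R _ _ _ _ Q Q (W i 0) (fun=> 1) (fun=> 0) (fun=> 1) (mW i 0) (measurable_cst _) b1 b1 _ _ 0 0 (lexx _).
have -> : (\int[Q]_w (\1_(`[0%R, 0%R]%classic : set R) (W i 0 w) * 1) = fine (Q [set w | W i 0 w = 0]))%R.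
  rewrite -bint_indic; last first.
    by have := mW i 0 measurableT (measurable_set1 (0 : R)); rewrite setTI.
  apply: eq_Rintegral => w _; rewrite mulr1 !indicE; congr (_ %:R); congr nat_of_bool.
  by rewrite set_itv1; apply/idP/idP; rewrite !inE.
move=> ->.
- by rewrite set_itv1 indicE mem_set//= mulr1; exact: bint_cst.
- move=> l; under eq_Rintegral do rewrite mulr1 -[l * _]addr0.
  rewrite c0 cos0; under eq_Rintegral do rewrite mulr0 cos0 mulr1.
  by rewrite bint_cst.
- move=> l; under eq_Rintegral do rewrite mulr1 -cosBpihalf.
  rewrite c0 cosN cos_pihalf; under eq_Rintegral do rewrite mulr0 sin0 mul0r.
  by rewrite bint_cst.
Qed.

Variables (M : nat).
Hypothesis M0 : (0 < M)%N.

(** A single index codes the line [q %/ M] and the time step [q %% M]; the factor [sqrt M] gives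
    variance 1. *)
Definition incr (q : nat) (w : Omega') : R :=
  Num.sqrt M%:R * (W (q %/ M)%N ((q %% M).+1%:R / M%:R) w - W (q %/ M)%N ((q %% M)%:R / M%:R) w).

Lemma measurable_incr q : measurable_fun [set: Omega'] (incr q).
Proof. by apply: measurable_funM => //; exact: measurable_funB. Qed.

Let MR0 : 0 < M%:R :> R. Proof. by rewrite ltr0n. Qed.

Lemma incr_char N (l : nat -> R) (del : R) :
  (\int[Q]_w cos (\sum_(0 <= q < N) l q * incr q w + del) =
   cos del * expR (- (\sum_(0 <= q < N) l q ^+ 2) / 2))%R.
Proof.
pose sM : R := Num.sqrt M%:R.
pose e q : seq (nat * R * R) := [:: ((q %/ M)%N, (q %% M).+1%:R / M%:R, l q * sM); ((q %/ M)%N, (q %% M)%:R / M%:R, - (l q * sM))].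
pose s := flatten (map e (index_iota 0 N)).
have s01 p : p \in s -> 0 <= p.1.2 <= 1.
  move=> /flattenP[_ /mapP[q _ ->]]; rewrite !inE => /orP[] /eqP -> /=.
    by rewrite divr_ge0//= ler_pdivrMr// mul1r ler_nat ltn_pmod.
  by rewrite divr_ge0//= ler_pdivrMr// mul1r ler_nat ltnW// ltn_pmod.
have bigs (F : nat * R * R -> R) : \sum_(p <- s) F p = \sum_(0 <= q < N) \sum_(p <- e q) F p.
  by rewrite /s big_flatten big_map.
have minE (x y : nat) : Num.min (x%:R / M%:R) (y%:R / M%:R) = (minn x y)%:R / M%:R :> R.
  rewrite minEle ler_pM2r ?invr_gt0// ler_nat.
  by case: leqP.
transitivity (\int[Q]_w cos (\sum_(p <- s) p.2 * W p.1.1 p.1.2 w + del))%R.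
  apply: eq_Rintegral => w _; congr (cos (_ + _)); rewrite bigs; apply: eq_bigr => q _.
  by rewrite /e !big_cons big_nil/= /incr -/sM; ring.
rewrite bm_char//; congr (_ * expR (- _ / 2)).
rewrite bigs; apply: eq_big_nat => q /andP[_ qN].
(* The covariance of two scaled increments. Different lines contribute 0; on the same line with
   different time steps the four minima cancel. *)
have covE q' : \sum_(p <- e q) \sum_(r <- e q') p.2 * r.2 * (if p.1.1 == r.1.1 then Num.min p.1.2 r.1.2 else 0)
    = if q' == q then l q ^+ 2 else 0.
  rewrite /e !big_cons !big_nil/= !minE !addr0.
  have [<-|neq] := eqVneq q' q.
    rewrite eqxx !minnn (minn_idPr (leqnSn _)) (minn_idPl (leqnSn _)) -natr1.
    have -> : l q' ^+ 2 = l q' ^+ 2 * (sM ^+ 2 / M%:R).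
      by rewrite sqr_sqrtr ?ler0n// divff ?mulr1// gt_eqF.
    by field; rewrite gt_eqF.
  case: eqP => [qq|_]; last by rewrite !mulr0 !addr0.
  have : (q %% M)%N != (q' %% M)%N.
    by apply: contra_neq neq => mm; rewrite (divn_eq q' M) (divn_eq q M) qq mm.
  rewrite neq_ltn => /orP[lt|lt].
    rewrite (minn_idPl (ltnW lt)) (minn_idPl lt) (minn_idPl (leqW (ltnW lt))) (minn_idPl (_ : (_.+1 <= _.+1)%N)) //; last by rewrite ltnS ltnW.
    by ring.
  rewrite (minn_idPr (ltnW lt)) (minn_idPr lt) (minn_idPr (leqW (ltnW lt))) (minn_idPr (_ : (_.+1 <= _.+1)%N)) //; last by rewrite ltnS ltnW.
  by ring.
transitivity (\sum_(0 <= q' < N) \sum_(p <- e q) \sum_(r <- e q') p.2 * r.2 * (if p.1.1 == r.1.1 then Num.min p.1.2 r.1.2 else 0)).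
  rewrite [RHS]exchange_big/=; apply: eq_bigr => p _; exact: bigs.
under eq_bigr do rewrite covE.
by rewrite (bigD1_seq q) ?mem_index_iota ?iota_uniq//= eqxx big1 ?addr0// => i /negbTE ->.
Qed.

Definition incr_vec N (w : Omega') : seqspace R := fun j => if (j < N)%N then incr j w else 0.

Lemma measurable_incr_vec N : measurable_fun [set: Omega'] (incr_vec N).
Proof. exact: measurable_gauss_trunc measurable_incr N. Qed.

Lemma prekopa_incr N (A B C : set (seqspace R)) : measurable A -> measurable B -> measurable C ->
  (forall x y, A x -> B y -> C (midseq x y)) ->
  fine (Q (incr_vec N @^-1` A)) * fine (Q (incr_vec N @^-1` B)) <= fine (Q (incr_vec N @^-1` C)) ^+ 2.
Proof.
move=> mA mB mC ABC.
have PL := prekopa_gauss measurable_incr (@incr_char N) (leqnn N).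
exact: prekopa_sets PL _ _ _ mA mB mC ABC.
Qed.

End brownian_increments.

(** * Strict positivity read on dyadic grids *)

Section grid_positivity.
Variable R : realType.
Variables (a b : R).
Hypothesis ab : a < b.

Definition gridpt (p j : nat) : R := a + (b - a) * (j%:R / (2 ^ p)%:R).

Lemma gridpt_itv p j : (j <= 2 ^ p)%N -> a <= gridpt p j <= b.
Proof.
move=> jp; rewrite /gridpt.
have j0 : 0 <= j%:R / (2 ^ p)%:R :> R by rewrite divr_ge0.
have j1 : j%:R / (2 ^ p)%:R <= 1 :> R by rewrite ler_pdivrMr ?ltr0n ?expn_gt0// mul1r ler_nat.
have ba : 0 <= b - a by rewrite subr_ge0 ltW.
by rewrite lerDl mulr_ge0//= -lerBrDl ler_piMr.
Qed.

Lemma gridpt_succ p j : gridpt p.+1 (2 * j) = gridpt p j.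
Proof.
rewrite /gridpt expnS !natrM; congr (_ + _ * _).
by field; rewrite pnatr_eq0 -lt0n expn_gt0.
Qed.

Lemma gridpt_dense x e : a <= x <= b -> 0 < e ->
  exists p j, (j <= 2 ^ p.+1)%N /\ `|gridpt p.+1 j - x| < e.
Proof.
move=> /andP[ax xb] e0.
have ba : 0 < b - a by rewrite subr_gt0.
pose p := Num.truncn ((b - a) / e).
have pe : (b - a) / e < (2 ^ p.+1)%:R.
  apply: lt_trans (truncnS_gt _) _; rewrite ltr_nat.
  by apply: (leq_trans (ltn_expl _ (isT : (1 < 2)%N))); rewrite leq_exp2l.
pose y := (x - a) / (b - a) * (2 ^ p.+1)%:R.
have M0 : 0 < (2 ^ p.+1)%:R :> R by rewrite ltr0n expn_gt0.
have y0 : 0 <= y by rewrite mulr_ge0// divr_ge0// ?subr_ge0// ltW.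
exists p, (Num.truncn y); split.
  have : (Num.truncn y)%:R <= (2 ^ p.+1)%:R :> R.
    apply: (@le_trans _ _ y); first by rewrite truncn_le.
    by rewrite /y ler_piMl ?(ltW M0)// ler_pdivrMr// mul1r lerD2r.
  by rewrite ler_nat.
have t1 : (Num.truncn y)%:R <= y by rewrite truncn_le.
have t2 := truncnS_gt y.
rewrite -(natr1 (Num.truncn y)) in t2.
move: t1 t2; set m : R := (Num.truncn y)%:R => t1 t2.
have xE : x = a + (b - a) * (y / (2 ^ p.+1)%:R).
  by rewrite /y mulfK ?gt_eqF// mulrC divfK ?gt_eqF//; lra.
rewrite {1}/gridpt -/m distrC {1}xE.
have -> : a + (b - a) * (y / (2 ^ p.+1)%:R) - (a + (b - a) * (m / (2 ^ p.+1)%:R)) = (b - a) / (2 ^ p.+1)%:R * (y - m) by ring.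
have D0 : 0 < (b - a) / (2 ^ p.+1)%:R by rewrite divr_gt0.
have De : (b - a) / (2 ^ p.+1)%:R < e by rewrite ltr_pdivrMr// mulrC -ltr_pdivrMr.
rewrite ger0_norm; last by rewrite mulr_ge0 ?(ltW D0)// subr_ge0.
apply: le_lt_trans De; by rewrite ler_piMr ?(ltW D0)//; lra.
Qed.

(** A continuous function attains its minimum on [[a, b]], so positivity leaves a uniform margin;
    conversely a margin on a dense set passes to the limit, whereas mere positivity there would
    allow a zero in between. Levels start at 1 so that each grid contains the midpoint of the
    interval. *)
Lemma positive_on_gridP (f : R -> R) : {within `[a, b], continuous f} ->
  (forall x, a <= x <= b -> 0 < f x) <->
  (exists q : nat, forall p j, (j <= 2 ^ p.+1)%N -> q.+1%:R^-1 <= f (gridpt p.+1 j)).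
Proof.
move=> cf; split => [f0|[q Hq] x xab].
  have [c cab Hc] := EVT_min (ltW ab) cf.
  have fc : 0 < f c by apply: f0; rewrite in_itv in cab.
  exists (Num.truncn (f c)^-1) => p j jp.
  apply: (@le_trans _ _ (f c)); last by apply: Hc; rewrite in_itv; exact: gridpt_itv.
  by rewrite -[leRHS]invrK lef_pV2 ?posrE ?invr_gt0// ltW// truncnS_gt.
have q0 : 0 < q.+1%:R^-1 :> R by rewrite invr_gt0.
rewrite ltNge; apply/negP => fx0.
have cx : f @ within [set` `[a, b]] (nbhs x) --> f x.
  by move/subspace_continuousP : cf => /(_ x); apply; rewrite /= in_itv.
have := cx; move/cvgrPdist_lt => /(_ _ q0).
rewrite /= near_withinE => -[e /= e0 He].
have [p [j [jp Hj]]] := gridpt_dense xab e0.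
have := He (gridpt p.+1 j); rewrite /ball/= distrC => /(_ Hj).
have := gridpt_itv jp => gi; rewrite in_itv/= => /(_ gi).
rewrite ltr_norml => /andP[h1 _]; have := Hq p j jp.
move: h1 fx0; set c := q.+1%:R^-1; lra.
Qed.

End grid_positivity.

(** * The resampled ensemble as a function of exterior data and Brownian paths *)

Section resampling.
Context (R : realType) d' (Omega' : measurableType d') (Q : probability Omega' R)
  (W : nat -> R -> Omega' -> R) d (Omega : measurableType d) (L : nat -> R -> Omega -> R).
Hypothesis HW : std_BM_family Q W.
Hypothesis HL : line_ensemble L.
Variables (k : nat) (a b : R).
Hypothesis ab : a < b.

Let rs w w' := resample L W k a b w w'.

Lemma unit_param x : a <= x <= b -> 0 <= (x - a) / (b - a) <= 1.
Proof.
have ba : 0 < b - a by rewrite subr_gt0.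
move=> /andP[ax xb]; rewrite divr_ge0 ?subr_ge0// ?(ltW ab)//=.
by rewrite ler_pdivrMr// mul1r lerD2r.
Qed.

Lemma bridge_continuous La Lb i w' :
  {within `[a, b], continuous (bridge La Lb a b (fun t => W i t w'))}.
Proof.
have ba : 0 < b - a by rewrite subr_gt0.
have cs : continuous (fun x : R => (x - a) / (b - a)).
  by move=> x; apply: cvgM; [apply: cvgB; [exact: cvg_id|exact: cvg_cst]|exact: cvg_cst].
have cW : {within `[a, b], continuous (fun x => W i ((x - a) / (b - a)) w')}.
  apply/subspace_continuousP => x xab.
  have := HW.2.1 i w'; move/subspace_continuousP => /(_ ((x - a) / (b - a))).
  have xab' : a <= x <= b by move: xab; rewrite /= in_itv.
  have s01 : (`[0, 1]%classic : set R) ((x - a) / (b - a)) by rewrite /= in_itv/= unit_param.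
  move=> /(_ s01)/cvgrPdist_lt H; apply/cvgrPdist_lt => e e0.
  have := H e e0; rewrite !near_withinE => -[r /= r0 Hr].
  have cx := cs x; move/cvgrPdist_lt : cx => /(_ r r0) cx.
  near=> y => yab.
  apply: Hr; last by rewrite /= in_itv/= unit_param.
  by rewrite /ball/=; near: y.
have csT : {within `[a, b], continuous (fun x : R => (x - a) / (b - a))} by exact: continuous_subspaceT.
rewrite /bridge => x.
apply: cvgD.
  apply: cvgD; first exact: cvg_cst.
  by apply: cvgM; [exact: csT|exact: cvg_cst].
apply: cvgM; first exact: cvg_cst.
apply: cvgB; first exact: cW.
by apply: cvgM; [exact: csT|exact: cvg_cst].
Unshelve. all: by end_near. Qed.

Definition gapf i x w w' : R := rs w w' i x - rs w w' i.+1 x.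

Lemma gapf_continuous i w w' : (i < k)%N -> {within `[a, b], continuous (fun x => gapf i x w w')}.
Proof.
move=> ik.
have c1 j : (j < k)%N -> {within `[a, b], continuous (fun x => rs w w' j x)}.
  move=> jk; apply: (@subspace_eq_continuous _ _ _ (bridge (L j a w) (L j b w) a b (fun t => W j t w'))).
    move=> x; rewrite inE /= in_itv/= => xab.
    by rewrite /from_subspace /rs /resample jk/=; case: ifPn => // /negP; case.
  exact: bridge_continuous.
have c2 : {within `[a, b], continuous (fun x => rs w w' i.+1 x)}.
  have [jk|jk] := boolP (i.+1 < k)%N; first exact: c1.
  apply: continuous_subspaceT; rewrite /rs /resample (negbTE jk)/=.
  exact: HL.2.
by move=> x; apply: cvgB; [exact: (c1 i ik)|exact: c2].
Qed.

Lemma finite_uniform_index (n : nat) (A : nat -> nat -> Prop) :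
  (forall i q q', (q <= q')%N -> A i q -> A i q') ->
  (forall i, (i < n)%N -> exists q, A i q) -> exists q, forall i, (i < n)%N -> A i q.
Proof.
move=> mono; elim: n => [|n IH] H; first by exists 0%N.
have [q1 H1] := IH (fun i ik => H i (ltnW ik)); have [q2 H2] := H n (ltnSn n).
exists (maxn q1 q2) => i; rewrite ltnS leq_eqVlt => /orP[/eqP ->|ik].
  by apply: mono H2; exact: leq_maxr.
by apply: mono (H1 i ik); exact: leq_maxl.
Qed.

Definition grid_gap (q p : nat) w w' := forall i j, (i < k)%N -> (j <= 2 ^ p.+1)%N ->
  q.+1%:R^-1 <= gapf i (gridpt a b p.+1 j) w w'.

(** Rewrites a condition on a continuum as a countable union over margins of intersections over
    levels of finitely many linear inequalities. Both joint measurability and, later, the convexity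
    argument rest on this form. *)
Lemma nonint_gridP w w' : nonint L W k a b w w' <-> exists q, forall p, grid_gap q p w w'.
Proof.
split => [H|[q Hq] x xab i ik].
  pose A i q := forall p j, (j <= 2 ^ p.+1)%N -> q.+1%:R^-1 <= gapf i (gridpt a b p.+1 j) w w'.
  have mono i q q' : (q <= q')%N -> A i q -> A i q'.
    move=> qq' h p j jp; apply: le_trans (h p j jp).
    by rewrite lef_pV2 ?posrE// ler_nat.
  have [q Hq] : exists q, forall i, (i < k)%N -> A i q.
    apply: finite_uniform_index => [|i ik]; first exact: mono.
    have [h _] := positive_on_gridP ab (@gapf_continuous i w w' ik).
    have /h [q hq] : forall x, a <= x <= b -> 0 < gapf i x w w'.
      by move=> x xab; rewrite /gapf subr_gt0; exact: H.
    by exists q.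
  by exists q => p i j ik jp; exact: Hq.
have := (positive_on_gridP ab (@gapf_continuous i w w' ik)).2.
move=> /(_ (ex_intro _ q (fun p j jp => Hq p i j ik jp)) x xab).
by rewrite /gapf subr_gt0.
Qed.

(** The generators of [Fext], kept apart so that [Omega] can be retyped with the exterior
    sigma-algebra; exterior measurability then becomes ordinary measurability on [extspace]. *)
Definition extgen : set (set Omega) :=
  [set C | exists (i : nat) (x : R) (B : set R),
     ~ ((i < k)%N /\ a <= x <= b) /\ measurable B /\ C = L i x @^-1` B].
Definition extspace := g_sigma_algebraType extgen.

Lemma measurable_ext i x : ~ ((i < k)%N /\ a <= x <= b) ->
  measurable_fun [set: extspace] (L i x : extspace -> R).
Proof.
move=> ext _ B mB; rewrite setTI; apply: sub_sigma_algebra.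
by exists i, x, B.
Qed.

(* The endpoints (i, a) and (i, b) are not exterior, but by continuity the values there are limits of exterior ones. *)
Lemma measurable_ext_left i : measurable_fun [set: extspace] (L i a : extspace -> R).
Proof.
apply: (@measurable_fun_cvg _ _ _ _ (fun n => L i (a - n.+1%:R^-1) : extspace -> R)).
  move=> n; apply: measurable_ext => -[_ /andP[h _]].
  by move: h; rewrite lerBrDr gerDl leNgt invr_gt0 ltr0n.
move=> w _; apply: (@continuous_cvg _ _ _ _ _ _ (fun x => L i x w)); first exact: HL.2.
rewrite -[X in _ --> X]subr0; apply: cvgB; [exact: cvg_cst|exact: cvg_harmonic].
Qed.

Lemma measurable_ext_right i : measurable_fun [set: extspace] (L i b : extspace -> R).
Proof.
apply: (@measurable_fun_cvg _ _ _ _ (fun n => L i (b + n.+1%:R^-1) : extspace -> R)).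
  move=> n; apply: measurable_ext => -[_ /andP[_ h]].
  by move: h; rewrite gerDl leNgt invr_gt0 ltr0n.
move=> w _; apply: (@continuous_cvg _ _ _ _ _ _ (fun x => L i x w)); first exact: HL.2.
rewrite -[X in _ --> X]addr0; apply: cvgD; [exact: cvg_cst|exact: cvg_harmonic].
Qed.

(** The resampled ensemble sees [L] only outside the box and at the endpoints of the bridges. This
    is why the Gibbs kernel is an exterior measurable function. *)
Lemma measurable_resample i x :
  measurable_fun [set: extspace * Omega'] (fun z => rs z.1 z.2 i x).
Proof.
have [c|/negP ext] := boolP ((i < k)%N && (a <= x <= b)); rewrite /rs /resample ?c; last first.
  move/negP/negbTE : (ext) => ->.
  apply: (measurableT_comp (f := (L i x : extspace -> R))) => //.
  by apply: measurable_ext => -[ik xab]; apply: ext; rewrite ik.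
rewrite /bridge.
have mL : measurable_fun [set: extspace * Omega'] (fun z => L i a z.1).
  exact: (measurableT_comp (measurable_ext_left i) measurable_fst).
have mR : measurable_fun [set: extspace * Omega'] (fun z => L i b z.1).
  exact: (measurableT_comp (measurable_ext_right i) measurable_fst).
have mW t : measurable_fun [set: extspace * Omega'] (fun z => W i t z.2).
  exact: (measurableT_comp (HW.1 i t) measurable_snd).
apply: measurable_funD.
  by apply: measurable_funD => //; apply: measurable_funM => //; exact: measurable_funB.
by apply: measurable_funM => //; apply: measurable_funB => //; exact: measurable_funM.
Qed.

Lemma measurable_nonint : measurable [set z : extspace * Omega' | nonint L W k a b z.1 z.2].
Proof.
rewrite (_ : [set z | _] = \bigcup_q \bigcap_p \bigcap_i \bigcap_j
   [set z : extspace * Omega' | (i < k)%N -> (j <= 2 ^ p.+1)%N ->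
      q.+1%:R^-1 <= gapf i (gridpt a b p.+1 j) z.1 z.2]); last first.
  apply/seteqP; split => z /=.
    by move=> /nonint_gridP[q Hq]; exists q => // p _ i _ j _ ik jp; exact: Hq.
  by move=> [q _ Hq]; apply/nonint_gridP; exists q => p i j ik jp; exact: (Hq p I i I j I).
apply: bigcupT_measurable => q; apply: bigcapT_measurable => p.
apply: bigcapT_measurable => i; apply: bigcapT_measurable => j.
have [ik|ik] := boolP (i < k)%N; last by rewrite (_ : [set z | _] = setT)//; apply/seteqP; split.
have [jp|jp] := boolP (j <= 2 ^ p.+1)%N; last by rewrite (_ : [set z | _] = setT)//; apply/seteqP; split.
rewrite (_ : [set z | _] = [set z : extspace * Omega' | q.+1%:R^-1 <= gapf i (gridpt a b p.+1 j) z.1 z.2]).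
  by apply: measurable_le_set => //; apply: measurable_funB; exact: measurable_resample.
by apply/seteqP; split => z /=; [exact|move=> ? _ _].
Qed.

Lemma measurable_resample_event (S : set (ens R)) : ens_measurable S ->
  measurable [set z : extspace * Omega' | S (rs z.1 z.2)].
Proof.
move=> mS.
have mF : measurable_fun [set: extspace * Omega'] (fun z => rs z.1 z.2 : g_sigma_algebraType (@ens_cylinders R)).
  apply: (@measurability _ _ _ (g_sigma_algebraType (@ens_cylinders R)) setT _ (@ens_cylinders R) erefl).
  move=> _ [_ [i [x [B [mB ->]]]] <-]; exact: (measurable_resample i x measurableT mB).
by have := mF measurableT S mS; rewrite setTI.
Qed.

Definition wt (S : set (ens R)) w : R := fine (Q ([set w' | S (rs w w')] `&` nonint L W k a b w)).
(** The Gibbs kernel: the conditional probability of [S] given the exterior. Where non-intersection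
    has probability 0, the quotient is 0 by the convention for division. *)
Definition kap (S : set (ens R)) w : R := wt S w / wt setT w.

Lemma measurable_section_event (S : set (ens R)) w : ens_measurable S ->
  measurable ([set w' | S (rs w w')] `&` nonint L W k a b w).
Proof.
move=> mS.
have := measurable_xsection (w : extspace) (measurableI _ _ (measurable_resample_event mS) measurable_nonint).
by congr (measurable _); apply/seteqP; split => w'; rewrite /xsection/= inE.
Qed.

Lemma measurable_wt S : ens_measurable S -> measurable_fun [set: extspace] (wt S : extspace -> R).
Proof.
move=> mS.
have mE := measurableI _ _ (measurable_resample_event mS) measurable_nonint.
have := measurable_fun_xsection Q mE => mx.
rewrite (_ : wt S = fine \o (Q \o xsection ([set z : extspace * Omega' | S (rs z.1 z.2)] `&` [set z | nonint L W k a b z.1 z.2]))).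
  exact: measurableT_comp.
apply/funext => w /=; congr (fine (Q _)).
by apply/seteqP; split => w'; rewrite /xsection/= inE.
Qed.

Lemma ens_measurableT : ens_measurable (setT : set (ens R)).
Proof. exact: (@measurableT _ (g_sigma_algebraType (@ens_cylinders R))). Qed.

Lemma wt_ge0 S w : 0 <= wt S w.
Proof. by rewrite fine_ge0. Qed.

Lemma wt_le S S' w : ens_measurable S -> ens_measurable S' -> S `<=` S' -> wt S w <= wt S' w.
Proof.
move=> mS mS' SS'; apply: fine_le; rewrite ?fin_num_measure//; try exact: measurable_section_event.
apply: le_measure; rewrite ?inE; try exact: measurable_section_event.
by move=> w' [h1 h2]; split => //; exact: SS'.
Qed.

Lemma wtT w : wt setT w = fine (Q (nonint L W k a b w)).
Proof. by rewrite /wt (_ : [set w' | setT _] = setT)// setTI. Qed.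

Lemma kap_ge0_le1 S w : ens_measurable S -> 0 <= kap S w <= 1.
Proof.
move=> mS; have le := wt_le w mS ens_measurableT (@subsetT _ S).
rewrite /kap divr_ge0 ?wt_ge0//=.
have [->|n0] := eqVneq (wt setT w) 0; first by rewrite invr0 mulr0.
by rewrite ler_pdivrMr ?mul1r// lt_neqAle eq_sym n0 wt_ge0.
Qed.

Lemma measurable_kap S : ens_measurable S -> measurable_fun [set: extspace] (kap S : extspace -> R).
Proof.
move=> mS.
(* The reciprocal is expressed as the exponential of minus the logarithm. Where the denominator
   vanishes the numerator does too, so the formula holds there as well. *)
rewrite (_ : kap S = (fun w => wt S w * expR (- ln (wt setT w)))).
  apply: measurable_funM; first exact: measurable_wt.
  apply: measurableT_comp => //; apply: measurableT_comp; first exact: oppr_measurable.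
  by apply: measurableT_comp; [exact: measurable_ln|exact: measurable_wt ens_measurableT].
apply/funext => w; rewrite /kap.
have [w0|n0] := eqVneq (wt setT w) 0.
  have := wt_le w mS ens_measurableT (@subsetT _ S); rewrite w0 => le.
  by rewrite (_ : wt S w = 0) ?mul0r//; apply/eqP; rewrite eq_le le wt_ge0.
by rewrite expRN lnK// posrE lt_neqAle eq_sym n0 wt_ge0.
Qed.

End resampling.

Lemma ae_eq_sets_measure d (T : measurableType d) (R : realType) (Q : probability T R) (Z A B : set T) :
  measurable Z -> measurable A -> measurable B -> Q (~` Z) = 0%E ->
  (forall w, Z w -> A w <-> B w) -> Q A = Q B.
Proof.
move=> mZ mA mB QZ AB.
have H S : measurable S -> Q S = Q (S `&` Z).
  move=> mS; rewrite (measureDI Q mS mZ) [X in (X + _)%E](_ : _ = 0%E) ?add0e//.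
  apply: (@subset_measure0 _ _ _ Q _ (~` Z)) => //; try exact: measurableD; try exact: measurableC.
rewrite H// [RHS]H//; congr (Q _); apply/seteqP; split => w [h Zw]; split => //; exact/(AB w Zw).
Qed.

(** * Midpoint log-concavity of the Gibbs kernel *)

Section log_concavity.
Context (R : realType) d' (Omega' : measurableType d') (Q : probability Omega' R)
  (W : nat -> R -> Omega' -> R) d (Omega : measurableType d) (L : nat -> R -> Omega -> R).
Hypothesis HW : std_BM_family Q W.
Hypothesis HL : line_ensemble L.
Variables (k : nat) (a b : R).
Hypothesis ab : a < b.
Variable w : Omega.

Let rs w' := resample L W k a b w w'.
Let M p := (2 ^ p.+1)%N.
Let vec p := incr_vec W (M p) (k * M p).

Let M0 p : (0 < M p)%N. Proof. by rewrite expn_gt0. Qed.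
Let MR0 p : 0 < (M p)%:R :> R. Proof. by rewrite ltr0n. Qed.
Let sM0 p : Num.sqrt (M p)%:R != 0 :> R. Proof. by rewrite gt_eqF// sqrtr_gt0. Qed.

(** The paths start at 0 only almost surely. On [Z] the values at grid times are sums of increments,
    and events are compared there. *)
Let Z := [set w' | forall i, W i 0 w' = 0].

Let mZ : measurable Z.
Proof.
rewrite (_ : Z = \bigcap_i [set w' | W i 0 w' = 0]); last first.
  by apply/seteqP; split => w' h i; [move=> _; exact: h|exact: h].
apply: bigcapT_measurable => i.
by have m0 : measurable [set (0 : R)]; [by []|have := HW.1 i 0 measurableT _ m0; rewrite setTI].
Qed.

Let QZ : Q (~` Z) = 0%E.
Proof.
have mZi i : measurable [set w' | W i 0 w' = 0].
  by have m0 : measurable [set (0 : R)]; [by []|have := HW.1 i 0 measurableT _ m0; rewrite setTI].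
have -> : ~` Z = \bigcup_i ~` [set w' | W i 0 w' = 0].
  apply/seteqP; split => w' /=; last by move=> [i _ h] H; exact: (h (H i)).
  by move=> /existsNP[i h]; exists i.
apply: (@measure_negligible _ _ _ Q).
  by apply: bigcupT_measurable => i; exact: measurableC.
apply: negligible_bigcup => i; exists (~` [set w' | W i 0 w' = 0]); split => //.
  exact: measurableC.
have h1 : Q [set w' | W i 0 w' = 0] = 1%E.
  rewrite -[LHS]fineK; first by rewrite (bm_zero HW).
  exact: fin_num_measure.
apply: etrans (probability_setC Q (mZi i)) _.
by rewrite [X in (1 - X)%E]h1 subee.
Qed.

Let Wv p i j (v : seqspace R) : R := \sum_(0 <= l < j) v (i * M p + l)%N / Num.sqrt (M p)%:R.

Let Wv_vec p i j w' : Z w' -> (i < k)%N -> (j <= M p)%N ->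
  W i (j%:R / (M p)%:R) w' = Wv p i j (vec p w').
Proof.
move=> Zw ik jM; rewrite /Wv.
transitivity (\sum_(0 <= l < j) (W i (l.+1%:R / (M p)%:R) w' - W i (l%:R / (M p)%:R) w')).
  rewrite (telescope_sumr (fun l => W i (l%:R / (M p)%:R) w'))//.
  by rewrite mul0r Zw subr0.
apply: eq_big_nat => l /andP[_ lj].
have lM : (l < M p)%N by exact: leq_trans lj jM.
rewrite /vec /incr_vec (_ : (i * M p + l < k * M p)%N); last first.
  by rewrite (leq_trans (_ : _ < i.+1 * M p)%N)// ?leq_mul2r ?ik ?orbT// mulSn addnC ltn_add2r.
rewrite /incr divnMDl// divn_small// addn0 modnMDl modn_small//.
by rewrite mulrAC divff// mul1r.
Qed.

Let c := Num.sqrt (2 * (b - a)).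
(** The heights at grid points in terms of the increment vector [v]. For fixed [w] this is affine in
    [v]: a bridge for the resampled lines, a constant for those below. Hence it commutes with
    midpoints. *)
Let Rv p i j (v : seqspace R) : R :=
  if (i < k)%N then
    L i a w + j%:R / (M p)%:R * (L i b w - L i a w) + c * (Wv p i j v - j%:R / (M p)%:R * Wv p i (M p) v)
  else L i (gridpt a b p.+1 j) w.

Let Rv_vec p i j w' : Z w' -> (j <= M p)%N -> rs w' i (gridpt a b p.+1 j) = Rv p i j (vec p w').
Proof.
move=> Zw jM; rewrite /rs /resample /Rv gridpt_itv// andbT; case: ifP => // ik.
have ba : b - a != 0 by rewrite gt_eqF// subr_gt0.
have sE : (gridpt a b p.+1 j - a) / (b - a) = j%:R / (M p)%:R.
  by rewrite /gridpt addrC addKr mulrC mulKf.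
rewrite /bridge sE (Wv_vec Zw ik jM); congr (_ + _ * (_ - _ * _)).
by rewrite -(Wv_vec Zw ik (leqnn _)) divff// gt_eqF.
Qed.

Let Wv_mid p i j u v : Wv p i j (midseq u v) = (Wv p i j u + Wv p i j v) / 2.
Proof.
rewrite /Wv -big_split/= big_distrl/=; apply: eq_bigr => l _; rewrite /midseq; field.
exact: sM0.
Qed.

Let Rv_mid p i j u v : Rv p i j (midseq u v) = (Rv p i j u + Rv p i j v) / 2.
Proof. by rewrite /Rv; case: ifP => _; rewrite ?Wv_mid; field; rewrite ?gt_eqF. Qed.

Let mRv p i j : measurable_fun [set: seqspace R] (Rv p i j).
Proof.
have mWv j' : measurable_fun [set: seqspace R] (Wv p i j').
  apply: measurable_sum => l; apply: measurable_funM => //; exact: measurable_coord.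
have [ik|ik] := boolP (i < k)%N; rewrite /Rv ?ik ?(negbTE ik)//; apply: measurable_funD => //.
by apply: measurable_funM => //; apply: measurable_funB => //; exact: measurable_funM.
Qed.

Let Av (q p : nat) (t : R) : set (seqspace R) :=
  [set v | (forall i j, (i < k)%N -> (j <= M p)%N -> q.+1%:R^-1 <= Rv p i j v - Rv p i.+1 j v) /\
    t < Rv p 0 (2 ^ p)%N v].

Let mAv q p t : measurable (Av q p t).
Proof.
rewrite (_ : Av q p t = (\bigcap_i \bigcap_j [set v : seqspace R | (i < k)%N -> (j <= M p)%N ->
  q.+1%:R^-1 <= Rv p i j v - Rv p i.+1 j v]) `&` [set v : seqspace R | t < Rv p 0 (2 ^ p)%N v]); last first.
  apply/seteqP; split => v [h ?]; split => //; first by move=> i _ j _; exact: h.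
  by move=> i j; exact: (h i I j I).
apply: (@measurableI _ (seqspace R)); last by apply: measurable_lt_set.
apply: bigcapT_measurable => i; apply: bigcapT_measurable => j.
have [ik|ik] := boolP (i < k)%N; last by rewrite (_ : [set v | _] = setT)//; apply/seteqP; split.
have [jp|jp] := boolP (j <= M p)%N; last by rewrite (_ : [set v | _] = setT)//; apply/seteqP; split.
rewrite (_ : [set v | _] = [set v : seqspace R | q.+1%:R^-1 <= Rv p i j v - Rv p i.+1 j v]).
  by apply: measurable_le_set => //; exact: measurable_funB.
by apply/seteqP; split => z /=; [exact|move=> ? _ _].
Qed.

Let x0 := (a + b) / 2.
Let mid_grid p : gridpt a b p.+1 (2 ^ p) = x0.
Proof.
rewrite /gridpt /x0 expnS natrM; set X := (2 ^ p)%:R.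
by field; rewrite /X pnatr_eq0 -lt0n expn_gt0.
Qed.

Let At q p t := [set w' | grid_gap W L k a b q p w w' /\ t < rs w' 0%N x0].

Let mrs i x : measurable_fun [set: Omega'] (fun w' => rs w' i x).
Proof.
have := measurable_resample HW HL (k := k) (a := a) (b := b) i x.
move=> /(measurableT_comp)/(_ (pair1_measurable (w : extspace L k a b))).
exact.
Qed.

Let mAt q p t : measurable (At q p t).
Proof.
apply: measurableI; last exact: measurable_lt_set.
rewrite (_ : grid_gap W L k a b q p w = \bigcap_i \bigcap_j [set w' | (i < k)%N -> (j <= M p)%N ->
  q.+1%:R^-1 <= gapf W L k a b i (gridpt a b p.+1 j) w w']); last first.
  by apply/seteqP; split => v h; [move=> i _ j _; exact: h|move=> i j; exact: (h i I j I)].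
apply: bigcapT_measurable => i; apply: bigcapT_measurable => j.
have [ik|ik] := boolP (i < k)%N; last by rewrite (_ : [set v | _] = setT)//; apply/seteqP; split.
have [jp|jp] := boolP (j <= M p)%N; last by rewrite (_ : [set v | _] = setT)//; apply/seteqP; split.
rewrite (_ : [set v | _] = [set w' | q.+1%:R^-1 <= gapf W L k a b i (gridpt a b p.+1 j) w w']).
  by apply: measurable_le_set => //; apply: measurable_funB; exact: mrs.
by apply/seteqP; split => z /=; [exact|move=> ? _ _].
Qed.

Let mvecAv q p t : measurable (vec p @^-1` Av q p t).
Proof.
by have := measurable_incr_vec HW (M p) (k * M p) measurableT (mAv q p t); rewrite setTI.
Qed.

Let QAt q p t : Q (At q p t) = Q (vec p @^-1` Av q p t).
Proof.
apply: (@ae_eq_sets_measure _ _ _ _ Z) => // w' Zw.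
have hp : (2 ^ p <= M p)%N by rewrite leq_exp2l.
rewrite /At /Av/= -Rv_vec// mid_grid; split=> -[h1 h2]; split => // i j ik jp.
  by rewrite -!Rv_vec//; exact: h1.
by rewrite /gapf -!/(rs _ _ _) !Rv_vec//; exact: h1.
Qed.

(** All constraints are linear inequalities in the increments, so averaging two vectors keeps every
    gap above the margin and puts the top line above [m]. The inequality for Gaussian vectors
    applies. *)
Let step1 q p (s t m : R) : s + t = 2 * m ->
  fine (Q (At q p s)) * fine (Q (At q p t)) <= fine (Q (At q p m)) ^+ 2.
Proof.
move=> stm; rewrite !QAt; apply: (prekopa_incr HW (M0 p)) => // u v [u1 u2] [v1 v2].
split => [i j ik jp|]; last by rewrite Rv_mid; lra.
rewrite !Rv_mid; have := u1 i j ik jp; have := v1 i j ik jp.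
by set e := q.+1%:R^-1; lra.
Qed.

Let It q t := \bigcap_p At q p t.
Let Et t := [set w' | t < rs w' 0%N x0] `&` nonint L W k a b w.

Let mIt q t : measurable (It q t). Proof. exact: bigcapT_measurable. Qed.

Let EtE t : Et t = \bigcup_q It q t.
Proof.
apply/seteqP; split => w'.
  by move=> [h /(nonint_gridP HW HL k ab w w')[q Hq]]; exists q => // p _; split.
move=> [q _ H]; split; first by have [] := H 0%N I.
by apply/(nonint_gridP HW HL k ab w w'); exists q => p; have [] := H p I.
Qed.

Let mEt t : measurable (Et t).
Proof. by rewrite EtE; exact: bigcupT_measurable. Qed.

(** The grid of one level is contained in the next, so [At q p m] decreases in [p] and continuity
    from above applies on the right; on the left each [It] is contained in every [At]. *)
Let step2 q (s t m : R) : s + t = 2 * m ->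
  fine (Q (It q s)) * fine (Q (It q t)) <= fine (Q (It q m)) ^+ 2.
Proof.
move=> stm.
have cv : Q (At q p m) @[p --> \oo] --> Q (It q m).
  apply: nonincreasing_cvg_mu => //.
  - by rewrite -ge0_fin_numE// fin_num_measure.
  - exact: bigcapT_measurable.
  - apply/nonincreasing_seqP => p; apply/subsetPset => w' [h1 h2]; split => // i j ik jp.
    have := h1 i (2 * j)%N ik; rewrite gridpt_succ; apply.
    by rewrite [(2 ^ p.+2)%N]expnS leq_mul2l.
have cvf : fine (Q (At q p m)) @[p --> \oo] --> fine (Q (It q m)).
  by apply: fine_cvg; rewrite fineK ?fin_num_measure//; exact: cv.
have cv2 : fine (Q (At q p m)) ^+ 2 @[p --> \oo] --> fine (Q (It q m)) ^+ 2.
  by rewrite !expr2; under eq_fun do rewrite expr2; exact: cvgM.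
rewrite -(cvg_lim (@Rhausdorff R) cv2)//.
apply: limr_ge; first by apply/cvg_ex; exists (fine (Q (It q m)) ^+ 2).
apply: nearW => p; apply: le_trans (step1 q p stm).
by rewrite ler_pM ?fine_ge0//; apply: fine_le; rewrite ?fin_num_measure//;
  apply: le_measure; rewrite ?inE// => w' /(_ p I).
Qed.

(** Smaller margins enlarge [It], and their union over [q] is the full event, so continuity from
    below removes the margin. The conditioning probability is common to all three events, which
    turns this into [kap_midpoint]. *)
Lemma wt_midpoint (s t m : R) : s + t = 2 * m ->
  fine (Q (Et s)) * fine (Q (Et t)) <= fine (Q (Et m)) ^+ 2.
Proof.
move=> stm.
have cv r : fine (Q (It q r)) @[q --> \oo] --> fine (Q (Et r)).
  have : Q (It q r) @[q --> \oo] --> Q (Et r).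
    rewrite EtE; apply: nondecreasing_cvg_mu => //; first exact: bigcupT_measurable.
    apply/nondecreasing_seqP => q; apply/subsetPset => w' H p _; have [h1 h2] := H p I.
    split => // i j ik jp; apply: le_trans (h1 i j ik jp).
    by rewrite lef_pV2 ?posrE// ler_nat.
  by move=> h; apply: fine_cvg; rewrite fineK ?fin_num_measure.
have cv2 : fine (Q (It q s)) * fine (Q (It q t)) @[q --> \oo] --> fine (Q (Et s)) * fine (Q (Et t)).
  exact: cvgM (cv s) (cv t).
rewrite -(cvg_lim (@Rhausdorff R) cv2)//.
apply: limr_le; first by apply/cvg_ex; eexists; exact: cv2.
apply: nearW => q; apply: le_trans (step2 q stm) _.
rewrite lerXn2r ?nnegrE ?fine_ge0//.
apply: fine_le; rewrite ?fin_num_measure//.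
apply: le_measure; rewrite ?inE// EtE => w' h.
by exists q.
Qed.

Lemma kap_midpoint (s t m : R) : s + t = 2 * m ->
  kap Q W L k a b [set f | s < f 0%N x0] w * kap Q W L k a b [set f | t < f 0%N x0] w <=
  kap Q W L k a b [set f | m < f 0%N x0] w ^+ 2.
Proof.
move=> stm; rewrite /kap mulrACA -expr2 exprMn ler_wpM2r ?sqr_ge0//.
exact: wt_midpoint stm.
Qed.

End log_concavity.

(** * Reverse martingales and extremality *)

Section density.
Context d (T : measurableType d) (R : realType).
Variable P : probability T R.

Lemma integral_set_bmeas (A : set T) (h : T -> R) : measurable A -> bmeas h ->
  (\int[P]_(x in A) (h x)%:E = (\int[P]_x (\1_A x * h x)%R)%R%:E)%E.
Proof.
move=> mA bh; rewrite -bmeas_integralE; last exact: bmeasM (bmeas_indic R mA) bh.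
rewrite integral_mkcond; apply: eq_integral => x _.
rewrite /patch indicE; case: ifPn => _; first by rewrite mul1r.
by rewrite mul0r.
Qed.

Lemma density_probability (h : T -> R) : bmeas h -> (forall x, 0 <= h x) ->
  \int[P]_x h x = 1 ->
  exists P' : probability T R,
    (forall A, measurable A -> P' A = \int[P]_(x in A) (h x)%:E)%E /\
    (forall f, bmeas f -> \int[P']_x f x = \int[P]_x (f x * h x)).
Proof.
move=> bh h0 h1.
pose nu (A : set T) := (\int[P]_(x in A) (h x)%:E)%E.
have nu0 : nu set0 = 0%E by rewrite /nu integral_set0.
have nu_ge0 A : (0 <= nu A)%E by apply: integral_ge0 => x _; rewrite lee_fin.
have nu_sigma : semi_sigma_additive nu.
  move=> F mF tF mUF; rewrite /nu ge0_integral_bigcup//=.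
  - by apply: is_cvg_ereal_nneg_natsum_cond => n _ _; exact: nu_ge0.
  - by apply/measurable_EFinP/measurable_funTS; exact: bh.1.
  - by move=> x _; rewrite lee_fin.
pose m : {measure set T -> \bar R} := HB.pack nu (isMeasure.Build _ _ _ nu nu0 nu_ge0 nu_sigma).
have m1 : m setT = 1%E by rewrite /m/= /nu bmeas_integralE// h1.
pose P' : probability T R := HB.pack (Measure.sort m) (Measure_isProbability.Build _ _ _ m m1).
exists P'; split => // f bf.
have key g : bmeas g -> (forall x, 0 <= g x) -> \int[P']_x g x = \int[P]_x (g x * h x).
  move=> bg g0; rewrite /Rintegral (@ge0_integral_density _ _ _ P P' h)//.
  - exact: bh.1.
  - by apply/measurable_EFinP; exact: bg.1.
have [_ [M fM]] := bf.
have bg : bmeas (fun x => f x + M) by exact: bmeasD bf (bmeas_cst _ M).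
have : \int[P']_x (f x + M) = \int[P]_x ((f x + M) * h x).
  by apply: key => // x; have := fM x; rewrite ler_norml => /andP[]; lra.
rewrite bintD//; last exact: bmeas_cst.
rewrite bint_cst; under [in RHS]eq_Rintegral do rewrite mulrDl.
rewrite bintD; [|exact: bmeasM|exact: bmeasZ].
by rewrite bintZ// h1 mulr1 => /addIr.
Qed.

(** Extends the identity from indicators to bounded functions: each density, suitably normalised,
    defines a probability, and the images of the two under [p] coincide. *)
Lemma integral_eq_on_subsigma d' (T' : measurableType d') (p : T -> T') (h1 h2 : T -> R) :
  measurable_fun setT p -> bmeas h1 -> bmeas h2 ->
  (forall x, 0 <= h1 x) -> (forall x, 0 <= h2 x) ->
  (forall A, measurable A ->
    \int[P]_x (\1_(p @^-1` A) x * h1 x) = \int[P]_x (\1_(p @^-1` A) x * h2 x)) ->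
  forall f, bmeas f -> \int[P]_x (f (p x) * h1 x) = \int[P]_x (f (p x) * h2 x).
Proof.
move=> mp bh1 bh2 h10 h20 H f bf.
have mpre A : measurable A -> measurable (p @^-1` A).
  by move=> mA; have := mp measurableT A mA; rewrite setTI.
pose c := \int[P]_x h1 x.
have cE : c = \int[P]_x h2 x.
  have := H setT measurableT; rewrite preimage_setT indicT.
  by under eq_Rintegral do rewrite mul1r; under [RHS]eq_Rintegral do rewrite mul1r.
have c0 : 0 <= c by exact: bint_ge0.
have c1 : 0 < 1 + c by lra.
(* The normalised densities [(1 + h) / (1 + c)] avoid the case [c = 0]. *)
have dens h : bmeas h -> (forall x, 0 <= h x) -> \int[P]_x h x = c ->
    exists P' : probability T R,
      (forall A, measurable A -> P' A = ((fine (P A) + \int[P]_x (\1_A x * h x)) / (1 + c))%:E) /\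
      (forall f, bmeas f -> \int[P']_x f x = (\int[P]_x f x + \int[P]_x (f x * h x)) / (1 + c)).
  move=> bh h0 hc.
  have E g : bmeas g -> \int[P]_x (g x * ((1 + h x) / (1 + c))) = (\int[P]_x g x + \int[P]_x (g x * h x)) / (1 + c).
    move=> bg; under eq_Rintegral do rewrite mulrA mulrDr mulr1.
    by rewrite bintZr ?bintD//; [exact: bmeasM|apply: bmeasD => //; exact: bmeasM].
  have bD : bmeas (fun x => (1 + h x) / (1 + c)).
    by apply: bmeasM (bmeas_cst _ _); apply: bmeasD (bmeas_cst _ _) bh.
  have [||P' [HA Hf]] := density_probability bD.
  - by move=> x; rewrite divr_ge0//; have := h0 x; lra.
  - have := E (fun=> 1) (bmeas_cst _ 1).
    under eq_Rintegral do rewrite mul1r; move=> ->.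
    by under [X in _ + X]eq_Rintegral do rewrite mul1r; rewrite hc bint_cst divff ?gt_eqF.
  exists P'; split => [A mA|g bg]; last by rewrite Hf// E.
  rewrite HA// integral_set_bmeas// E; last exact: bmeas_indic.
  by rewrite bint_indic.
have [P1 [A1 F1]] := dens h1 bh1 h10 erefl.
have [P2 [A2 F2]] := dens h2 bh2 h20 (esym cE).
have : \int[P1]_x f (p x) = \int[P2]_x f (p x).
  rewrite -(bint_law_of mp P1 bf) -(bint_law_of mp P2 bf).
  rewrite /Rintegral; congr fine; apply: eq_measure_integral => A mA _.
  transitivity (P1 (p @^-1` A)); first by [].
  transitivity (P2 (p @^-1` A)); last by [].
  by rewrite A1 ?A2 ?H//; exact: mpre.
have bfp : bmeas (fun x => f (p x)) by exact: bmeas_comp.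
rewrite F1// F2// => /(mulIf (invr_neq0 (lt0r_neq0 c1)))/addrI.
by [].
Qed.

Lemma bint_cvg_ae (f : nat -> T -> R) (g : T -> R) (M : R) :
  (forall n, measurable_fun [set: T] (f n)) -> (forall n x, `|f n x| <= M) -> bmeas g ->
  {ae P, forall x, f n x @[n --> \oo] --> g x} ->
  \int[P]_x f n x @[n --> \oo] --> \int[P]_x g x.
Proof.
move=> mf fM bg fg.
apply: (@fine_cvg _ _ _ _ (fun n => \int[P]_x (f n x)%:E)%E).
rewrite -bmeas_integralE//.
have mf' n : measurable_fun [set: T] (fun x => (f n x)%:E) by exact/measurable_EFinP.
have mg' : measurable_fun [set: T] (EFin \o g) by apply/measurable_EFinP; exact: bg.1.
have fg' : {ae P, forall x, [set: T] x -> (f n x)%:E @[n --> \oo] --> (EFin \o g) x}.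
  by apply: filterS fg => x fgx _; apply: cvg_EFin; [exact: nearW|exact: fgx].
have iM : P.-integrable [set: T] (fun=> M%:E) by exact: finite_measure_integrable_cst.
have fM' : {ae P, forall x n, [set: T] x -> (`|(f n x)%:E| <= M%:E)%E}.
  by apply: aeW => x n _; rewrite lee_fin.
by have [_ _ ] := dominated_convergence measurableT mf' mg' fg' iM fM'.
Qed.

End density.

(** * Convergence of conditional probabilities along decreasing sigma-algebras *)

Section reverse_martingale.
Context d (T : measurableType d) (R : realType).
Variable P : probability T R.

(** The expected total variation of the sequence is at most 2, so the series of increments converges
    absolutely almost everywhere. *)
Lemma ae_cvg_summable_increments (u : nat -> T -> R) :
  (forall j, bmeas (u j)) ->
  (forall j, \int[P]_x `|u j.+1 x - u j x| <= 2 / (2 ^ j.+1)%:R) ->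
  {ae P, forall x, cvgn (fun j => u j x)}.
Proof.
move=> bu hu.
pose D j x := `|u j.+1 x - u j x|.
have mD j : measurable_fun setT (D j).
  by apply: measurableT_comp => //; apply: measurable_funB; [exact: (bu j.+1).1|exact: (bu j).1].
have bD j : bmeas (D j).
  split; first exact: mD.
  have [_ [M1 h1]] := bu j.+1; have [_ [M2 h2]] := bu j; exists (M1 + M2) => x.
  by rewrite /D normr_id (le_trans (ler_normB _ _))// lerD.
pose S x := (\sum_(j <oo) (D j x)%:E)%E.
have mS : measurable_fun setT S.
  apply: ge0_emeasurable_sum => [j x _ _|j _]; first by rewrite lee_fin /D.
  exact/measurable_EFinP.
have intS : (\int[P]_x S x < +oo)%E.
  rewrite /S integral_nneseries//.
  - apply: (@le_lt_trans _ _ (2%:E)); last exact: ltry.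
    apply: le_trans (@epsilon_trick0 R 2 xpredT (ler0n _ _)).
    apply: lee_nneseries => [j _ _|j _]; first by apply: integral_ge0 => x _; rewrite lee_fin /D.
    by rewrite bmeas_integralE// lee_fin; exact: hu.
  - by move=> j; exact/measurable_EFinP.
  - by move=> j x _; rewrite lee_fin /D.
have S0 x : (0 <= S x)%E by apply: nneseries_ge0 => j _ _; rewrite lee_fin /D.
have iS : P.-integrable setT S.
  apply/integrableP; split => //.
  by under eq_integral do rewrite gee0_abs//.
have := integrable_ae measurableT iS.
apply: filterS => x /(_ I) fS.
have cn : cvgn [normed series (telescope (u ^~ x))].
  apply: nondecreasing_is_cvgn; first by apply: nondecreasing_series => n _ _; rewrite normr_ge0.
  exists (fine (S x)) => _ [n _ <-].
  rewrite -lee_fin fineK// /series/= -sumEFin.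
  rewrite /S.
  by apply: (@nneseries_lim_ge _ (fun j => (D j x)%:E) xpredT 0%N n) => j _; rewrite lee_fin /D.
have cs := normed_cvg cn.
rewrite (_ : (fun j => u j x) = (fun j => u 0%N x + series (telescope (u ^~ x)) j)).
  by apply: is_cvgD; [exact: is_cvg_cst|exact: cs].
by apply/funext => j; rewrite -eq_sum_telescope.
Qed.

(** Dropping the first [m] terms shows that a limsup is measurable for the sigma-algebra [sub n],
    whatever [n]. *)
Lemma limn_esup_shift (v : nat -> \bar R) m : limn_esup (fun j => v (j + m)%N) = limn_esup v.
Proof.
have E : esups (fun j => v (j + m)%N) = [sequence esups v (n + m)%N]_n.
  apply/funext => n; rewrite /esups/=; congr ereal_sup; rewrite /sdrop; apply/seteqP; split => _ [k/= nk <-].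
    by exists (k + m)%N => //=; rewrite leq_add2r.
  exists (k - m)%N => /=; first by rewrite leq_subRL ?(leq_trans (leq_addl _ _) nk)// addnC.
  by rewrite subnK// (leq_trans (leq_addl _ _) nk).
rewrite !limn_esup_lim E; apply/cvg_lim => //.
by rewrite (cvg_shiftn m); exact: is_cvg_esups.
Qed.

Variable G : nat -> set (set T).
Let sub n := g_sigma_algebraType (G n).
Hypothesis Gmeas : forall n, G n `<=` measurable.
Hypothesis Gdecr : forall m n, (m <= n)%N -> G n `<=` G m.

Lemma measurable_id_sub n : measurable_fun setT (id : T -> sub n).
Proof.
apply: (@measurability _ _ T (sub n) setT _ (G n) erefl) => _ [A GA <-].
by rewrite setTI preimage_id; exact: Gmeas GA.
Qed.

Lemma measurable_sub_decr m n (f : T -> R) : (m <= n)%N ->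
  measurable_fun [set: sub n] f -> measurable_fun [set: sub m] f.
Proof.
move=> mn mf _ B mB; apply: sub_sigma_algebra2 (Gdecr mn) _ _.
exact: mf measurableT _ mB.
Qed.

Lemma bmeas_sub_decr m n (f : T -> R) : (m <= n)%N ->
  bmeas (f : sub n -> R) -> bmeas (f : sub m -> R).
Proof. by move=> mn [mf ?]; split => //; exact: measurable_sub_decr mf. Qed.

Lemma bmeas_sub n (f : T -> R) : bmeas (f : sub n -> R) -> bmeas f.
Proof.
move=> [mf ?]; split => // _ B mB.
by have := measurable_id_sub measurableT (mf measurableT B mB); rewrite !setTI.
Qed.

Variables (E : set T) (kp : nat -> T -> R).
Hypothesis mE : measurable E.
Hypothesis kp01 : forall n x, 0 <= kp n x <= 1.
Hypothesis mkp : forall n, measurable_fun [set: sub n] (kp n).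
Hypothesis cond : forall n (f : T -> R), bmeas (f : sub n -> R) ->
  \int[P]_x (f x * \1_E x) = \int[P]_x (f x * kp n x).

Let bkp_sub n : bmeas (kp n : sub n -> R).
Proof. exact: bmeas01. Qed.

Let bkp n : bmeas (kp n). Proof. exact: bmeas_sub (bkp_sub n). Qed.

Let a n := \int[P]_x (kp n x ^+ 2).

Let aE n : a n = \int[P]_x (kp n x * \1_E x).
Proof. by rewrite (cond (bkp_sub n)). Qed.

Let akk m n : (m <= n)%N -> a n = \int[P]_x (kp n x * kp m x).
Proof. by move=> mn; rewrite aE (cond (bmeas_sub_decr mn (bkp_sub n))). Qed.

(** Orthogonality of martingale increments: by [akk], the cross term equals the second moment of the
    later variable. *)
Let a_diff m n : (m <= n)%N -> \int[P]_x ((kp n x - kp m x) ^+ 2) = a m - a n.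
Proof.
move=> mn.
under eq_Rintegral do rewrite sqrrB.
rewrite bintD; [|apply: bmeasB|]; try exact: bmeasX.
  rewrite bintB; [|exact: bmeasX|].
    under [X in _ - X + _]eq_Rintegral do rewrite -mulr_natl.
    by rewrite bintZ -?akk//; [rewrite -/(a n) -/(a m); lra|exact: bmeasM].
all: under eq_fun do rewrite -mulr_natl; apply: bmeasZ; exact: bmeasM.
Qed.

Let a_ni m n : (m <= n)%N -> a n <= a m.
Proof.
by move=> mn; rewrite -subr_ge0 -a_diff//; apply: bint_ge0 => x; exact: sqr_ge0.
Qed.

Let a_cvg : cvgn a.
Proof.
apply: nonincreasing_is_cvgn; first by move=> m n; exact: a_ni.
by exists 0 => _ [n _ <-]; apply: bint_ge0 => x; exact: sqr_ge0.
Qed.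

Lemma fast_subsequence (b : nat -> R) (e : nat -> R) : cvgn b -> (forall j, 0 < e j) ->
  exists s : nat -> nat, [/\ forall j, (j <= s j)%N, forall j, (s j <= s j.+1)%N &
    forall j, `|b (s j) - limn b| <= e j].
Proof.
move=> cb e0.
have ex j : exists N, forall n, (N <= n)%N -> `|b n - limn b| <= e j.
  have /cvgrPdist_le /(_ _ (e0 j)) [N _ HN] := cb.
  by exists N => n Nn; rewrite distrC; exact: HN.
have [N HN] := choice ex.
(* The sum of all thresholds up to [j] dominates the [j]-th one and is monotone; the summand [j]
   makes the indices tend to infinity. *)
exists (fun j => j + \sum_(i < j.+1) N i)%N; split => j.
- exact: leq_addr.
- by rewrite [X in (_ <= _ + X)%N]big_ord_recr/= leq_add// leq_addr.
- by apply: HN; rewrite big_ord_recr/= addnA leq_addl.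
Qed.

(** Second moments decrease, so by [a_diff] the sequence is Cauchy in L2, and a fast subsequence
    converges almost everywhere. The second moment at stage [n] is also the integral of [kp n] over
    [E], which identifies its limit in terms of [g]. *)
Lemma reverse_martingale_limit : exists g : T -> R,
  [/\ forall x, 0 <= g x <= 1, forall n, measurable_fun [set: sub n] g,
      \int[P]_x g x = fine (P E) &
      \int[P]_x (kp n x ^+ 2) @[n --> \oo] --> \int[P]_x (g x * \1_E x)].
Proof.
have [s [sj sm sa]] := @fast_subsequence a (fun j => ((2 ^ j)%:R ^+ 2)^-1) a_cvg
  (fun j => ltac:(by rewrite invr_gt0 exprn_gt0// ltr0n expn_gt0)).
pose u j := kp (s j).
have u_ae : {ae P, forall x, cvgn (fun j => u j x)}.
  apply: ae_cvg_summable_increments => [j|j]; first exact: bkp.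
  set X : R := (2 ^ j)%:R; have X0 : 0 < X by rewrite /X ltr0n expn_gt0.
  have bd : bmeas (fun x => u j.+1 x - u j x) by apply: bmeasB; exact: bkp.
  have bq : bmeas (fun x => (u j.+1 x - u j x) ^+ 2) by exact: bmeasX.
  (* Young's inequality [y <= X y^2 / 2 + 1 / (2 X)] with [X = 2^j]: since the squared L2 increment
     is at most [1 / X^2], the bound is [1 / X]. *)
  apply: (@le_trans _ _ (\int[P]_x (X / 2 * (u j.+1 x - u j x) ^+ 2 + X^-1 / 2))).
    apply: bint_le => [||x].
    - split; first by apply: measurableT_comp => //; exact: bd.1.
      by have [_ [M hM]] := bd; exists M => x; rewrite normr_id.
    - by apply: bmeasD (bmeas_cst _ _); exact: bmeasZ.
    - rewrite -real_normK ?num_real//; set y := `|_|.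
      rewrite -subr_ge0 (_ : _ - _ = X / 2 * (y - X^-1) ^+ 2); last by field; rewrite gt_eqF.
      by rewrite mulr_ge0 ?sqr_ge0// divr_ge0// ltW.
  rewrite bintD; [|exact: bmeasZ|exact: bmeas_cst].
  rewrite bint_cst bintZ// a_diff//.
  have h1 : a (s j) - a (s j.+1) <= (X ^+ 2)^-1.
    apply: le_trans (sa j); apply: le_trans (ler_norm _); rewrite lerD2l lerN2.
    by apply: nonincreasing_cvgn_ge => // m n; exact: a_ni.
  rewrite expnS natrM -/X.
  apply: (@le_trans _ _ (X / 2 * (X ^+ 2)^-1 + X^-1 / 2)); first by rewrite lerD2r ler_wpM2l// divr_ge0// ltW.
  by rewrite le_eqVlt; apply/orP; left; apply/eqP; field; rewrite gt_eqF.
(* The limsup is defined at every point and depends only on the tail of the sequence; the clipping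
   secures values in [[0, 1]] everywhere. *)
pose g x := Num.max 0 (Num.min 1 (fine (limn_esup (fun j => (u j x)%:E)))).
have g01 x : 0 <= g x <= 1.
  by rewrite /g le_max lexx/= ge_max ler01/= ge_min lexx.
have mg n : measurable_fun [set: sub n] g.
  apply: measurable_maxr => //; apply: measurable_minr => //.
  apply: measurableT_comp => //.
  rewrite (_ : (fun x => _) = (fun x => limn_esup (fun j => (u (j + n)%N x)%:E))); last first.
    by apply/funext => x; rewrite (limn_esup_shift (fun j => (u j x)%:E)).
  apply: (@measurable_fun_limn_esup _ (sub n) R setT (fun j x => (u (j + n)%N x)%:E)) => j.
  apply/measurable_EFinP; apply: (@measurable_sub_decr n (s (j + n)%N)) => //.
  exact: leq_trans (leq_addl _ _) (sj _).
have bg : bmeas g by apply: (@bmeas_sub 0%N); exact: bmeas01.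
have u_g : {ae P, forall x, u j x @[j --> \oo] --> g x}.
  apply: filterS u_ae => x cu.
  have l01 : 0 <= limn (fun j => u j x) <= 1.
    apply/andP; split; [apply: limr_ge => //|apply: limr_le => //]; apply: nearW => j.
      by have /andP[] := kp01 (s j) x.
    by have /andP[] := kp01 (s j) x.
  rewrite (_ : g x = limn (fun j => u j x)); first exact: cu.
  rewrite /g.
  have -> : limn_esup (fun j => (u j x)%:E) = (limn (fun j => u j x))%:E.
    have cE : (u j x)%:E @[j --> \oo] --> (limn (fun j => u j x))%:E.
      by apply: cvg_EFin; [exact: nearW|exact: cu].
    by rewrite is_cvg_limn_esupE; [exact/cvg_lim|apply/cvg_ex; eexists; exact: cE].
  rewrite /=; case/andP: l01 => l0 l1.
  by rewrite (min_idPr l1) (max_idPr l0).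
have u1 j x : `|u j x| <= 1.
  by have /andP[h1 h2] := kp01 (s j) x; rewrite ger0_norm.
have E1 j : \int[P]_x u j x = fine (P E).
  have := cond (bmeas_cst (sub (s j)) 1).
  under eq_Rintegral do rewrite mul1r; under [X in _ = X -> _]eq_Rintegral do rewrite mul1r.
  by rewrite bint_indic// => ->.
exists g; split => //.
  have cI := bint_cvg_ae (fun j => (bkp (s j)).1) u1 bg u_g.
  rewrite -(cvg_lim (@Rhausdorff R) cI)//.
  by under eq_fun do rewrite E1; rewrite lim_cst.
have ca : a n @[n --> \oo] --> limn a by exact: a_cvg.
suff <- : limn a = \int[P]_x (g x * \1_E x) by exact: ca.
have c1 : a (s j) @[j --> \oo] --> limn a.
  apply: cvg_comp ca; apply/cvgnyPge => N; near=> j.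
  by apply: leq_trans (sj j); near: j; exact: nbhs_infty_ge.
have bE : bmeas (\1_E : T -> R) by exact: bmeas_indic.
have c2 : a (s j) @[j --> \oo] --> \int[P]_x (g x * \1_E x).
  under eq_fun do rewrite aE.
  apply: (bint_cvg_ae (M := 1)) => [j|j x||].
  - exact: (bmeasM (bkp (s j)) bE).1.
  - by rewrite normrM -[leRHS]mulr1 ler_pM ?u1// indicE; case: (_ \in _); rewrite ?normr1 ?normr0.
  - exact: bmeasM.
  - by apply: filterS u_g => x ux; apply: cvgM; [exact: ux|exact: cvg_cst].
exact: (cvg_unique (@Rhausdorff R) c1 c2).
Unshelve. all: by end_near. Qed.

End reverse_martingale.

(** * Gibbs ensembles under a change of density, and the use of extremality *)

Section extremal_ensembles.
Context (R : realType) d' (Omega' : measurableType d') (Q : probability Omega' R)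
  (W : nat -> R -> Omega' -> R) d (Omega : measurableType d) (P : probability Omega R)
  (L : nat -> R -> Omega -> R).
Hypothesis HW : std_BM_family Q W.
Hypothesis HL : line_ensemble L.

Lemma measurable_ens_at (S : set (ens R)) : ens_measurable S ->
  measurable [set w | S (ens_at L w)].
Proof.
move=> mS.
have mF : measurable_fun [set: Omega] (ens_at L : Omega -> g_sigma_algebraType (@ens_cylinders R)).
  apply: (@measurability _ _ _ (g_sigma_algebraType (@ens_cylinders R)) setT _ (@ens_cylinders R) erefl).
  by move=> _ [_ [i [x [B [mB ->]]]] <-]; exact: (HL.1 i x measurableT B mB).
by have := mF measurableT S mS; rewrite setTI.
Qed.

Lemma extgen_measurable k a b : extgen L k a b `<=` measurable.
Proof.
by move=> _ [i [x [B [_ [mB ->]]]]]; have := HL.1 i x measurableT B mB; rewrite setTI.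
Qed.

Lemma extgen_sub k a b k' a' b' : (k' <= k)%N -> a <= a' -> b' <= b ->
  extgen L k a b `<=` extgen L k' a' b'.
Proof.
move=> kk aa bb _ [i [x [B [ext [mB ->]]]]]; exists i, x, B; split => // -[ik /andP[ax xb]].
by apply: ext; split; [exact: leq_trans ik kk|rewrite (le_trans aa ax) (le_trans xb bb)].
Qed.

Lemma measurable_id_ext k a b : measurable_fun setT (id : Omega -> extspace L k a b).
Proof. exact: (@measurable_id_sub _ _ (fun=> extgen L k a b) (fun=> @extgen_measurable k a b) 0%N). Qed.

Lemma bmeas_ext k a b (f : Omega -> R) : bmeas (f : extspace L k a b -> R) -> bmeas f.
Proof. exact: (@bmeas_sub _ _ _ (fun=> extgen L k a b) (fun=> @extgen_measurable k a b) 0%N). Qed.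

Lemma bmeas_kap k a b S : a < b -> ens_measurable S ->
  bmeas (kap Q W L k a b S : extspace L k a b -> R).
Proof. by move=> ab mS; apply: bmeas01; [exact: measurable_kap|move=> x; exact: kap_ge0_le1]. Qed.

Lemma kapE k a b S w : kap Q W L k a b S w =
  fine (Q ([set w' | S (resample L W k a b w w')] `&` nonint L W k a b w)) / fine (Q (nonint L W k a b w)).
Proof. by rewrite /kap wtT. Qed.

(** The Gibbs property as a conditional expectation: exterior events are replaced by bounded
    exterior functions, so that densities may serve as test functions. *)
Lemma gibbs_bint k a b S (f : Omega -> R) : brownian_gibbs Q W P L -> (0 < k)%N -> a < b ->
  ens_measurable S -> bmeas (f : extspace L k a b -> R) ->
  \int[P]_w (f w * \1_[set w | S (ens_at L w)] w) = \int[P]_w (f w * kap Q W L k a b S w).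
Proof.
move=> BG k0 ab mS bf.
have mE := measurable_ens_at mS.
have bk := bmeas_ext (bmeas_kap k ab mS).
apply: (@integral_eq_on_subsigma _ _ _ P _ (extspace L k a b) id _ _ (@measurable_id_ext k a b) _ bk) => //.
- exact: bmeas_indic.
- by move=> x; have /andP[] := kap_ge0_le1 HW HL k ab x mS.
move=> A mA; rewrite preimage_id.
have mA' : measurable (A : set Omega).
  by have := measurable_id_ext measurableT mA; rewrite setTI.
apply: EFin_inj.
apply: etrans (esym (integral_set_bmeas P mA' (bmeas_indic R mE))) _.
apply: etrans (integral_set_bmeas P mA' bk).
transitivity (P (A `&` [set w | S (ens_at L w)])).
  by rewrite integral_indic// setIC.
rewrite (BG k a b k0 ab A S mA mS).
by apply: eq_integral => w _; rewrite kapE.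
Qed.

(** The density is measurable for the exterior of every box, so it can be absorbed into the test
    function; the resampling kernel stays the same. *)
Lemma gibbs_density (P' : probability Omega R) (h : Omega -> R) :
  brownian_gibbs Q W P L ->
  (forall k a b, bmeas (h : extspace L k a b -> R)) ->
  (forall A, measurable A -> P' A = \int[P]_(x in A) (h x)%:E)%E ->
  (forall f, bmeas f -> \int[P']_x f x = \int[P]_x (f x * h x)) ->
  brownian_gibbs Q W P' L.
Proof.
move=> BG bh PA Pf k a b k0 ab A S mA mS.
have mE := measurable_ens_at mS.
have mA' : measurable (A : set Omega).
  by have := measurable_id_ext measurableT (mA : measurable (A : set (extspace L k a b))); rewrite setTI.
have bA : bmeas (\1_A : extspace L k a b -> R) by exact: bmeas_indic.
have bk := bmeas_ext (bmeas_kap k ab mS).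
have bhO := bmeas_ext (bh k a b).
rewrite PA; last exact: measurableI.
rewrite integral_set_bmeas//; last exact: measurableI.
under [RHS]eq_integral do rewrite -kapE.
rewrite integral_set_bmeas// Pf; last by apply: bmeasM => //; exact: bmeas_indic.
congr EFin.
transitivity (\int[P]_w ((\1_A w * h w) * \1_[set w | S (ens_at L w)] w)).
  by apply: eq_Rintegral => w _; rewrite indicI/=; ring.
rewrite (gibbs_bint BG k0 ab mS (bmeasM bA (bh k a b))).
by apply: eq_Rintegral => w _; ring.
Qed.

(** The shift by one keeps every box nondegenerate. The box is centred, so the midpoint at which
    [kap_midpoint] reads the top line is 0. *)
Definition boxgen n := extgen L n.+1 (- n.+1%:R) n.+1%:R.
Definition boxkap t n : Omega -> R :=
  kap Q W L n.+1 (- n.+1%:R) n.+1%:R [set f | t < f 0%N 0].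

Lemma box_lt n : - n.+1%:R < n.+1%:R :> R.
Proof. by rewrite (@lt_trans _ _ 0)// ?oppr_lt0 ltr0n. Qed.

Lemma ens_measurable_top t : ens_measurable [set f : ens R | t < f 0%N 0].
Proof.
apply: sub_sigma_algebra; exists 0%N, 0, `]t, +oo[%classic; split => //.
by apply/seteqP; split => f; rewrite /= in_itv/= andbT.
Qed.

Lemma boxgen_decr m n : (m <= n)%N -> boxgen n `<=` boxgen m.
Proof. by move=> mn; apply: extgen_sub; rewrite ?lerN2 ?ler_nat ?ltnS. Qed.

(** Every box lies in one of the exhausting boxes. Measurability for all [boxgen n] therefore gives
    measurability for the exterior of an arbitrary box. *)
Lemma boxgen_sub k a b : exists n, boxgen n `<=` extgen L k a b.
Proof.
pose n := maxn k (maxn (Num.truncn `|a|) (Num.truncn `|b|)).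
exists n; apply: extgen_sub.
- exact: leq_trans (leq_maxl k _) (leqnSn _).
- have : `|a| <= n.+1%:R.
    rewrite ltW// (lt_le_trans (truncnS_gt _))// ler_nat ltnS /n.
    by rewrite !leq_max leqnn orbT.
  by rewrite ler_norml => /andP[].
- have : `|b| <= n.+1%:R.
    rewrite ltW// (lt_le_trans (truncnS_gt _))// ler_nat ltnS /n.
    by rewrite !leq_max leqnn !orbT.
  by rewrite ler_norml => /andP[].
Qed.

Let tl t : set Omega := [set w | t < L 0%N 0 w].
Definition tailp t : R := fine (P (tl t)).

Let mtl t : measurable (tl t).
Proof. exact: measurable_ens_at (ens_measurable_top t). Qed.

Lemma boxkap_cond t n (f : Omega -> R) : brownian_gibbs Q W P L ->
  bmeas (f : g_sigma_algebraType (boxgen n) -> R) ->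
  \int[P]_w (f w * \1_(tl t) w) = \int[P]_w (f w * boxkap t n w).
Proof.
move=> BG bf.
exact: (gibbs_bint BG (ltn0Sn n) (box_lt n) (ens_measurable_top t) bf).
Qed.

Lemma boxkap01 t n w : 0 <= boxkap t n w <= 1.
Proof. exact: (kap_ge0_le1 HW HL n.+1 (box_lt n) w (ens_measurable_top t)). Qed.

Lemma bmeas_boxkap t n : bmeas (boxkap t n : g_sigma_algebraType (boxgen n) -> R).
Proof. exact: bmeas_kap (box_lt n) (ens_measurable_top t). Qed.

Lemma boxkap_midpoint (s t m : R) n w : s + t = 2 * m ->
  boxkap s n w * boxkap t n w <= boxkap m n w ^+ 2.
Proof.
move=> stm; have := @kap_midpoint _ _ _ Q W _ _ L HW HL n.+1 _ _ (box_lt n) w s t m stm.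
by rewrite addNr mul0r.
Qed.

(* The limit [g] of [boxkap t n] is measurable for every exterior sigma-algebra, so the laws with densities
   [(1 + g) / (1 + G)] and [(2 - g) / (2 - G)] are again Brownian Gibbs; extremality equates their tails at [t],
   which reads [al = G ^+ 2]. *)
Lemma extremal_boxkap_cvg t : extremal Q W P L ->
  \int[P]_w (boxkap t n w ^+ 2) @[n --> \oo] --> tailp t ^+ 2.
Proof.
move=> [[_ BG] ext].
have [g [g01 mg gE gcvg]] := @reverse_martingale_limit _ Omega R P boxgen
  (fun n => @extgen_measurable n.+1 (- n.+1%:R) n.+1%:R) boxgen_decr (tl t) (boxkap t)
  (mtl t) (boxkap01 t) (fun n => (bmeas_boxkap t n).1) (fun n f => @boxkap_cond t n f BG).
set al := \int[P]_x (g x * \1_(tl t) x) in gcvg.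
rewrite -/(tailp t) in gE; set G := tailp t in gE *.
suff -> : G ^+ 2 = al by exact: gcvg.
have bg k a b : bmeas (g : extspace L k a b -> R).
  apply: bmeas01 => //; have [n sub] := boxgen_sub k a b.
  by move=> _ B mB; apply: sub_sigma_algebra2 sub _ _; exact: mg measurableT _ mB.
have bgO := bmeas_ext (bg 1%N 0 1).
have bE : bmeas (\1_(tl t) : Omega -> R) by exact: bmeas_indic.
have /andP[G0 G1] : 0 <= G <= 1.
  rewrite -gE bint_ge0/=; last by move=> x; have /andP[] := g01 x.
  rewrite -[leRHS](bint_cst P); apply: bint_le => [//||x]; first exact: bmeas_cst.
  by have /andP[] := g01 x.
have dens (p q c : R) : 0 < c -> (forall x, 0 <= p + q * g x) -> p + q * G = c ->
    exists P' : probability Omega R, BG_line_ensemble Q W P' L /\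
    forall S, ens_measurable S -> law P' L S =
      ((p * \int[P]_w \1_[set w | S (ens_at L w)] w + q * \int[P]_w (g w * \1_[set w | S (ens_at L w)] w)) / c)%:E.
  move=> c0 h0 hc.
  pose h x := (p + q * g x) / c.
  have bh k a b : bmeas (h : extspace L k a b -> R).
    by apply: bmeasM (bmeas_cst _ _); apply: bmeasD (bmeas_cst _ _) _; exact: bmeasZ.
  have bhO := bmeas_ext (bh 1%N 0 1).
  have [||P' [PA Pf]] := density_probability (P := P) bhO.
  - by move=> x; rewrite divr_ge0// ltW.
  - rewrite bintZr; last by apply: bmeasD (bmeas_cst _ _) _; exact: bmeasZ.
    rewrite bintD; [|exact: bmeas_cst|exact: bmeasZ].
    by rewrite bint_cst bintZ// gE hc divff ?gt_eqF.
  exists P'; split; first by split => //; exact: gibbs_density BG bh PA Pf.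
  move=> S mS; have mE := measurable_ens_at mS.
  have bS : bmeas (\1_[set w | S (ens_at L w)] : Omega -> R) by exact: bmeas_indic.
  rewrite /law PA// integral_set_bmeas//; congr EFin.
  transitivity (\int[P]_x ((p * \1_[set w | S (ens_at L w)] x + q * (g x * \1_[set w | S (ens_at L w)] x)) / c)).
    by apply: eq_Rintegral => x _; rewrite /h; ring.
  rewrite bintZr; last by apply: bmeasD; apply: bmeasZ => //; exact: bmeasM.
  by rewrite bintD ?bintZ//; try apply: bmeasZ => //; exact: bmeasM.
(* The densities are built on [1 + g] and [2 - g] because their integrals [1 + G] and [2 - G] are at
   least 1, even when [G] is 0 or 1. *)
have [||//|P1 [BG1 law1]] := dens 1 1 (1 + G).
- by lra.
- by move=> x; have /andP[] := g01 x; lra.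
- by rewrite mul1r.
have [||//|P2 [BG2 law2]] := dens 2 (-1) (2 - G).
- by lra.
- by move=> x; have /andP[] := g01 x; lra.
- by rewrite mulN1r.
(* The weights [(1 + G) / 3] and [(2 - G) / 3] cancel the normalisations, and the mixed density is
   [((1 + g) + (2 - g)) / 3 = 1]. *)
have := ext _ _ P1 L _ _ P2 L ((1 + G) / 3) BG1 BG2 _ _ _ (ens_measurable_top t).
rewrite law1; last exact: ens_measurable_top.
rewrite law2; last exact: ens_measurable_top.
have -> : \int[P]_w \1_[set w | [set f : ens R | t < f 0%N 0] (ens_at L w)] w = G.
  exact: (bint_indic P (mtl t)).
have -> : \int[P]_w (g w * \1_[set w | [set f : ens R | t < f 0%N 0] (ens_at L w)] w) = al by [].
move=> H.
have {}H : (1 * G + 1 * al) / (1 + G) = (2 * G + (-1) * al) / (2 - G).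
  apply: EFin_inj; apply: H; first by apply/andP; split; lra.
  move=> S mS; rewrite law1// law2// -!EFinM -EFinD /law.
  rewrite -[LHS]fineK ?fin_num_measure//; last exact: measurable_ens_at.
  rewrite -bint_indic; last exact: measurable_ens_at.
  congr EFin; field; lra.
have G1' : 1 + G != 0 by rewrite gt_eqF//; lra.
have G2' : 2 - G != 0 by rewrite gt_eqF//; lra.
move/eqP : H; rewrite eqr_div// => /eqP H; nra.
Qed.

(** Nonnegativity of the variance of [boxkap s n + boxkap t n] bounds the covariance from below by
    minus half the sum of the two variances, which vanish in the limit by [extremal_boxkap_cvg]. So
    second moments suffice to pass from the pointwise inequality to [tailp]. *)
Lemma tailp_midpoint (s t m : R) : extremal Q W P L -> s + t = 2 * m ->
  tailp s * tailp t <= tailp m ^+ 2.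
Proof.
move=> ext stm; have BG := ext.1.2.
have bk r n : bmeas (boxkap r n) by exact: bmeas_ext (bmeas_boxkap r n).
have Ek r n : \int[P]_w boxkap r n w = tailp r.
  have := boxkap_cond r BG (bmeas_cst (g_sigma_algebraType (boxgen n)) 1).
  under eq_Rintegral do rewrite mul1r; under [X in _ = X -> _]eq_Rintegral do rewrite mul1r.
  by move=> <-; rewrite bint_indic.
have key n : tailp s * tailp t - (\int[P]_w (boxkap s n w ^+ 2) - tailp s ^+ 2 +
    (\int[P]_w (boxkap t n w ^+ 2) - tailp t ^+ 2)) / 2 <= \int[P]_w (boxkap m n w ^+ 2).
  apply: (@le_trans _ _ (\int[P]_w (boxkap s n w * boxkap t n w))); last first.
    by apply: bint_le => [||w]; [exact: bmeasM|exact: bmeasX|exact: boxkap_midpoint].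
  have h : 0 <= \int[P]_w ((boxkap s n w + boxkap t n w - (tailp s + tailp t)) ^+ 2).
    by apply: bint_ge0 => w; exact: sqr_ge0.
  have E : \int[P]_w ((boxkap s n w + boxkap t n w - (tailp s + tailp t)) ^+ 2) =
      \int[P]_w (boxkap s n w ^+ 2) + \int[P]_w (boxkap t n w ^+ 2)
      + 2 * \int[P]_w (boxkap s n w * boxkap t n w) - (tailp s + tailp t) ^+ 2.
    set c := tailp s + tailp t.
    transitivity (\int[P]_w (boxkap s n w ^+ 2 + boxkap t n w ^+ 2 +
      2 * (boxkap s n w * boxkap t n w) + (- (2 * c)) * (boxkap s n w + boxkap t n w) + c ^+ 2)).
      by apply: eq_Rintegral => w _; ring.
    have b1 := bmeasX 2 (bk s n); have b2 := bmeasX 2 (bk t n).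
    have b3 : bmeas (fun w => 2 * (boxkap s n w * boxkap t n w)) by apply: bmeasZ; exact: bmeasM.
    have b4 : bmeas (fun w => (- (2 * c)) * (boxkap s n w + boxkap t n w)) by apply: bmeasZ; exact: bmeasD.
    rewrite bintD; [|exact: bmeasD (bmeasD (bmeasD b1 b2) b3) b4|exact: bmeas_cst].
    rewrite bintD; [|exact: bmeasD (bmeasD b1 b2) b3|exact: b4].
    rewrite bintD; [|exact: bmeasD b1 b2|exact: b3].
    rewrite bintD// bint_cst bintZ; last exact: bmeasM.
    by rewrite bintZ ?bintD ?Ek//; [rewrite /c; ring|exact: bmeasD].
  by rewrite E in h; lra.
have cs := @extremal_boxkap_cvg s ext; have ct := @extremal_boxkap_cvg t ext.
have cm := @extremal_boxkap_cvg m ext.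
have cl : tailp s * tailp t - (\int[P]_w (boxkap s n w ^+ 2) - tailp s ^+ 2 +
    (\int[P]_w (boxkap t n w ^+ 2) - tailp t ^+ 2)) / 2 @[n --> \oo] -->
  tailp s * tailp t - (tailp s ^+ 2 - tailp s ^+ 2 + (tailp t ^+ 2 - tailp t ^+ 2)) / 2.
  apply: cvgB; first exact: cvg_cst.
  apply: cvgM; last exact: cvg_cst.
  by apply: cvgD; apply: cvgB => //; exact: cvg_cst.
rewrite !subrr addr0 mul0r subr0 in cl.
rewrite -(cvg_lim (@Rhausdorff R) cl)// -(cvg_lim (@Rhausdorff R) cm)//.
apply: ler_lim; [by apply/cvg_ex; eexists; exact: cl|by apply/cvg_ex; eexists; exact: cm|].
by apply: nearW => n; exact: key.
Qed.

End extremal_ensembles.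

(** * Exponential tails *)

(** With [s] fixed, the ratio [r x = G (s + x) / G s] satisfies [r (2 x) <= r x ^ 2]. One value
    [r h < 1] is squared at each doubling of the distance, and monotonicity fills the gaps between
    the points [s + 2^k h]. *)
Lemma midpoint_log_concave_exp_tail (R : realType) (G : R -> R) :
  (forall t : R, 0 <= G t <= 1) -> (forall s t : R, s <= t -> G t <= G s) ->
  (forall s t m : R, s + t = 2 * m -> G s * G t <= G m ^+ 2) ->
  (exists s, 0 < G s) -> (forall e : R, 0 < e -> exists t, G t < e) ->
  exists theta0 c : R, 0 < c /\ forall theta : R, theta0 < theta -> G theta <= expR (- (c * theta)).
Proof.
move=> G01 Gmono Gmid [s Gs] Glim.
have [t Gt] := Glim _ Gs.
have st : s < t by rewrite ltNge; apply/negP => /Gmono; rewrite leNgt Gt.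
pose h := t - s; have h0 : 0 < h by rewrite subr_gt0.
pose r x := G (s + x) / G s.
have r0 x : 0 <= r x by rewrite divr_ge0 ?(ltW Gs)//; have /andP[] := G01 (s + x).
have r2 x : r (2 * x) <= r x ^+ 2.
  rewrite /r expr_div_n expr2 invfM mulrA ler_pM2r ?invr_gt0//.
  rewrite ler_pdivlMr// mulrC -expr2; apply: Gmid; lra.
(* The floor [1 / 2] keeps [q] positive when [r h] is 0, so that [ln q] is meaningful. *)
pose q := Num.max (r h) 2^-1.
have q0 : 0 < q by rewrite lt_max invr_gt0 ltr0n orbT.
have q1 : q < 1.
  rewrite gt_max invf_lt1 ?ltr1n//= andbT /r ltr_pdivrMr// mul1r.
  by rewrite /h addrC subrK.
pose lam := - ln q; have lam0 : 0 < lam by rewrite oppr_gt0 ln_lt0// q0.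
have rk k : r ((2 ^ k)%:R * h) <= expR (- (lam * (2 ^ k)%:R)).
  elim: k => [|k IH].
    by rewrite mul1r mulr1 opprK lnK ?posrE// le_max lexx.
  rewrite expnS natrM -mulrA (le_trans (r2 _))//.
  have -> : - (lam * (2%:R * (2 ^ k)%:R)) = - (lam * (2 ^ k)%:R) + - (lam * (2 ^ k)%:R) by ring.
  by rewrite expRD expr2 ler_pM.
(* Beyond [t] the quotient [y = (th - s) / h] is at least 1, so some [2^k] lies between [y / 2] and
   [y]. Beyond [2 s] one has [th - s >= th / 2]. Each of these two losses costs a factor 2, whence
   the 4. *)
exists (Num.max t (2 * s)), (lam / (4 * h)); split; first by rewrite divr_gt0// mulr_gt0.
move=> th; rewrite gt_max => /andP[tth sth].
pose y := (th - s) / h.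
have y1 : 1 <= y by rewrite ler_pdivlMr// mul1r /h lerD2r ltW.
have y0 : 0 <= y by rewrite (le_trans ler01).
pose n := Num.truncn y.
have n0 : (0 < n)%N by rewrite /n truncn_gt0.
have /andP[k1 k2] := trunc_log_bounds (ltnSn 1) n0.
set k := trunc_log 2 n in k1 k2.
have ky : (2 ^ k)%:R <= y.
  apply: (@le_trans _ _ n%:R); first by rewrite ler_nat.
  by rewrite truncn_le.
have yk : y <= 2 * (2 ^ k)%:R.
  rewrite -natrM -expnS ltW// (lt_le_trans (truncnS_gt _))//.
  by rewrite ler_nat.
apply: (@le_trans _ _ (G (s + (2 ^ k)%:R * h))).
  apply: Gmono; have := ler_wpM2r (ltW h0) ky.
  by rewrite /y divfK ?gt_eqF//; lra.
apply: (@le_trans _ _ (r ((2 ^ k)%:R * h))).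
  rewrite /r ler_pdivlMr// ler_piMr//; first by have /andP[] := G01 (s + (2 ^ k)%:R * h).
  by have /andP[] := G01 s.
apply: le_trans (rk k) _; rewrite ler_expR lerN2.
have -> : lam / (4 * h) * th = lam * (th / (4 * h)) by ring.
rewrite ler_pM2l//.
apply: (@le_trans _ _ (y / 2)); last by rewrite ler_pdivrMr// mulrC.
rewrite /y ler_pdivrMr ?mulr_gt0//.
have -> : (th - s) / h / 2 * (4 * h) = 2 * (th - s) by field; rewrite gt_eqF.
lra.
Qed.

Section tail_function.
Context (R : realType) d (Omega : measurableType d) (P : probability Omega R).
Variable X : Omega -> R.
Hypothesis mX : measurable_fun [set: Omega] X.

Let G t := fine (P [set w | t < X w]).

Let mt t : measurable [set w | t < X w].
Proof. by apply: measurable_lt_set. Qed.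

Lemma upper_tail_antitone s t : s <= t -> G t <= G s.
Proof.
move=> st; apply: fine_le; rewrite ?fin_num_measure//.
apply: le_measure; rewrite ?inE// => w /=; exact: le_lt_trans.
Qed.

Lemma upper_tail_small e : 0 < e -> exists t, G t < e.
Proof.
move=> e0.
have cv : P [set w | n%:R < X w] @[n --> \oo] --> P (\bigcap_n [set w | n%:R < X w]).
  apply: nonincreasing_cvg_mu => //.
  - by rewrite -ge0_fin_numE// fin_num_measure.
  - exact: bigcapT_measurable.
  - apply/nonincreasing_seqP => n; apply/subsetPset => w /=; apply: le_lt_trans.
    by rewrite ler_nat.
have E : \bigcap_n [set w | n%:R < X w] = set0.
  apply/seteqP; split => // w /(_ (Num.truncn `|X w|).+1 I)/= h.
  by have := lt_trans (truncnS_gt `|X w|) h; rewrite ltNge ler_norm.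
rewrite E measure0 in cv.
have /cvgrPdist_lt /(_ e e0) [n _ Hn] : G n%:R @[n --> \oo] --> (0 : R).
  exact: (fine_cvg cv).
exists n%:R; have := Hn n (leqnn n); rewrite /= sub0r normrN ger0_norm//.
exact: fine_ge0.
Qed.

Lemma upper_tail_pos : exists s, 0 < G s.
Proof.
have cv : P [set w | - n%:R < X w] @[n --> \oo] --> P (\bigcup_n [set w | - n%:R < X w]).
  apply: nondecreasing_cvg_mu => //.
  - exact: bigcupT_measurable.
  - apply/nondecreasing_seqP => n; apply/subsetPset => w /=; apply: le_lt_trans.
    by rewrite lerN2 ler_nat.
have E : \bigcup_n [set w | - n%:R < X w] = setT.
  apply/seteqP; split => // w _; exists (Num.truncn `|X w|).+1 => //=.
  by rewrite ltrNl (le_lt_trans _ (truncnS_gt _))// -normrN ler_norm.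
rewrite E probability_setT in cv.
have /cvgrPdist_lt /(_ 1 ltr01) [n _ Hn] : G (- n%:R) @[n --> \oo] --> (1 : R).
  exact: (fine_cvg cv).
exists (- n%:R); have := Hn n (leqnn n); rewrite /= ltr_norml; lra.
Qed.

End tail_function.

Theorem mainTheorem6 (R : realType)
    (d' : measure_display) (Omega' : measurableType d')
    (Q : probability Omega' R) (W : nat -> R -> Omega' -> R)
    (d : measure_display) (Omega : measurableType d)
    (P : probability Omega R) (L : nat -> R -> Omega -> R) :
  std_BM_family Q W ->
  extremal_stationary Q W P L ->
  exists theta0 c : R, 0 < c /\
    forall theta : R, theta0 < theta ->
      (P [set w | (theta < L 0%N 0 w)%R] <= (expR (- (c * theta)))%:E)%E.
Proof.
move=> HW [_ ext]; have HL := ext.1.1.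
have mX := HL.1 0%N 0.
have mt t : measurable [set w | t < L 0%N 0 w] by apply: measurable_lt_set.
have [|||||theta0 [c [c0 H]]] := @midpoint_log_concave_exp_tail R (tailp P L).
- move=> t; rewrite fine_ge0//= -lee_fin fineK ?fin_num_measure//.
  exact: probability_le1.
- by move=> s t; exact: upper_tail_antitone.
- by move=> s t m stm; exact: (@tailp_midpoint _ _ _ Q W _ _ P L HW HL s t m ext stm).
- exact: upper_tail_pos.
- by move=> e; exact: upper_tail_small.
exists theta0, c; split => // theta /H.
by rewrite -lee_fin fineK// fin_num_measure.
Qed.
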